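(* Let $r>1$ and let $Z^{(1)},\dots,Z^{(r)}$ be $r$ independent recurrent random walks in the same random environment $\omega$. Let $\delta\in(0,1)$. There exist events $\Delta_N(\delta)$, $N\ge1$, and $\widehat b(N)\in2\mathbb Z$, depending only on the environment $\omega$, and constants $c(\delta)>0$ and $\varepsilon(\delta)\in(0,1)$, with $$\liminf_{N\to+\infty}\mathsf P[\Delta_N(\delta)]\ge1-\delta,$$ such that: for every $(y_1,\dots,y_r)\in(2\mathbb Z)^r$ there exists $N_1\in\mathbb N$ such that for every $N\ge N_1$, every $\omega\in\Delta_N(\delta)$ and every $j\in\{1,\dots,r\}$, $$\forall n\in\big[N^{1-\varepsilon(\delta)},N\big]\cap(2\mathbb N),\qquad P_\omega^{y_j}\big[Z_n^{(j)}=\widehat b(N)\big]\ge c(\delta).$$ This remains true if $(2\mathbb Z)^r$ and $2\mathbb N$ are replaced respectively by $(2\mathbb Z+1)^r$ and $2\mathbb N+1$.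
   Context: On a probability space $(\Omega,\mathcal F,\mathsf P)$ (expectation $\mathsf E$), $\omega=(\omega_x)_{x\in\mathbb Z}$ is a collection of i.i.d. random variables with values in $(0,1)$. With $\rho_k=(1-\omega_k)/\omega_k$, assume there is $\varepsilon_0\in(0,1/2)$ such that $\mathsf P[\omega_0\in[\varepsilon_0,1-\varepsilon_0]]=1$, $\mathsf E[\log\rho_0]=0$ and $\mathsf E[(\log\rho_0)^2]>0$. For fixed $\omega$, $P_\omega^{y}[Z^{(j)}\in\cdot]$ denotes the law of the Markov chain $Z^{(j)}$ on $\mathbb Z$ started at $y\in\mathbb Z$ with $P_\omega^{y}[Z^{(j)}_{n+1}=z+1\mid Z^{(j)}_n=z]=\omega_z=1-P_\omega^{y}[Z^{(j)}_{n+1}=z-1\mid Z^{(j)}_n=z]$. *)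

(* Defs.v *)
From mathcomp Require Import all_boot all_order all_algebra finmap.
From mathcomp Require Import all_classical all_reals all_analysis.

Set Implicit Arguments.
Unset Strict Implicit.
Unset Printing Implicit Defensive.

Import Order.TTheory GRing.Theory Num.Theory.
Import numFieldNormedType.Exports.

Local Open Scope classical_set_scope.
Local Open Scope ring_scope.

Definition generated_sigma (T U I : Type) (G : set_system U) (X : I -> T -> U) :
    set_system T :=
  <<s \bigcup_(i in [set: I]) preimage_set_system [set: T] (X i) G >>.

Definition mutually_independent (d : measure_display) (T : measurableType d)
    (R : realType) (P : probability T R) (I : choiceType)
    (F : I -> set_system T) : Prop :=
  forall (J : {fset I}) (A : I -> set T),
    (forall i, i \in J -> F i (A i)) ->
    P (\bigcap_(i in [set` J]) A i) = (\prod_(i <- J) P (A i))%E.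

(* The laws are compared on Borel sets only, and not as functions
   [distribution P (X i)]: a measure has arbitrary values on the nonmeasurable
   sets. *)
Definition iid (d : measure_display) (T : measurableType d) (R : realType)
    (P : probability T R) (I : choiceType) (X : I -> {RV P >-> R}) : Prop :=
  mutually_independent P
    (fun i => preimage_set_system [set: T] (X i) measurable) /\
  (forall (i j : I) (B : set R), measurable B ->
    P (X i @^-1` B) = P (X j @^-1` B)).

Definition rho (R : realType) (w : int -> R) (k : int) : R := (1 - w k) / w k.

(* [Z] is, under [Q], the Markov chain with law $P_w^y$.  The conditional
   probabilities given a trajectory up to time [n] are multiplied out, so that
   trajectories of probability zero are harmless. *)
Record walk_in_environment (R : realType) (w : int -> R) (y : int)
    (d : measure_display) (T : measurableType d) (Q : probability T R)
    (Z : nat -> T -> int) : Prop := WalkInEnvironment {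
  walk_measurable : forall n z, measurable (Z n @^-1` [set z]);
  walk_start : Q (Z 0%N @^-1` [set y]) = 1%E;
  walk_right : forall (n : nat) (s : nat -> int),
    let past := [set u | forall k, (k <= n)%N -> Z k u = s k] in
    Q (past `&` Z n.+1 @^-1` [set s n + 1]) = (Q past * (w (s n))%:E)%E;
  walk_left : forall (n : nat) (s : nat -> int),
    let past := [set u | forall k, (k <= n)%N -> Z k u = s k] in
    Q (past `&` Z n.+1 @^-1` [set s n - 1]) = (Q past * (1 - w (s n))%:E)%E
}.

(* The sets of integers are all taken to be measurable. *)
Definition independent_walks (R : realType) (w : int -> R) (r : nat)
    (y : 'I_r -> int) (d : measure_display) (T : measurableType d)
    (Q : probability T R) (Z : 'I_r -> nat -> T -> int) : Prop :=
  (forall j, walk_in_environment w (y j) Q (Z j)) /\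
  mutually_independent Q (fun j => generated_sigma [set: set int] (Z j)).

(* Main.v *)
(** Let [V] be the potential of the environment, whose increments are the
    [ln rho_k], and let [H = ln N].  The walk is reversible, and its stationary
    measure is of order [exp (- V)].

    Quenched part.  Let [b] be the bottom of a valley with walls higher than
    [V b + H], such that the sum of [exp (V b - V)] over the valley is at most
    [K].  The walk started at [b] is unlikely to leave the valley before the
    time [N], and Cauchy-Schwarz together with reversibility gives
    [P_b (Z_2m = b) >= 1 / (4 K)].  If moreover no climb on the way from [y] to
    [b] is higher than [(1 - 2 alpha) H], then [b] is hit before [N^(1 - alpha)]
    with probability at least [1 / 2].

    Environment part.  On each side of the origin let [T1 <= T2] be the first
    times at which [V] has climbed [h1 = (1 - 2 alpha) H] and
    [h2 = (1 + alpha) H] above its running minimum, [v] the minimum up to [T1],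
    and [M] the maximum before this minimum is reached.  A valley as above
    exists unless [v] is improved between [T1] and [T2], one of the sums of
    [exp (v - V)] is large, or [M] on one side falls in a window of length
    [O(alpha H)] determined by the other side.  All these events are estimated
    by fair games: the gain of a predictable bet on the increments of [V] has
    mean zero, and a game with gains at most [A] loses [B] with probability at
    most [A / (A + B)].  The sums of [exp (v - V)] and the time [T2] are
    controlled by the strict submartingale [exp (- lambda V)]. *)

Require Import Defs.
From HB Require Import structures.
From mathcomp Require Import all_boot all_order all_algebra finmap.
From mathcomp Require Import all_classical all_reals all_analysis.
From mathcomp Require Import measurable_realfun.
From mathcomp Require Import zify ring lra.

Set Implicit Arguments.
Unset Strict Implicit.
Unset Printing Implicit Defensive.

Import Order.TTheory GRing.Theory Num.Theory.
Import numFieldNormedType.Exports.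

Local Open Scope classical_set_scope.
Local Open Scope ring_scope.

(** * Walks on the integers *)

(** No scaling limit is taken: the increments [ln rho_k] are bounded and centred, so every
    probability comes from Markov's inequality applied to finite sums, uniformly in [N]. The events
    are rare because of a hierarchy of lengths [H], [g H], [g^2 H], [g^3 H] with [g = delta / 100]:
    each game sets one length against a longer one, and so fails with probability at most a multiple
    of [g]. A bet on a window needs a level that is known when the bet begins. The level depends on
    the opposite side only and the sides are independent, so a gambler on one side is simply told
    the whole opposite path at time 0. Only [N1] may depend on the starting points, so all starting
    points up to a small multiple of [ln N] are treated at once. [Delta N] is defined by the desired
    estimate itself, as the set of environments with some even site that satisfies it; the valleys
    only serve to show that this set is likely. The target must be even: an odd bottom is replaced
    by its right neighbour, at the price of one more step and a factor [eps0]. *)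

Section Primitive.
Variable R : realType.

(** Discrete antiderivative vanishing at 0, with the sign of an oriented integral on the left of 0.
    It yields the potential from its increments, the scale function [prim E], and the solution of
    the equation for mean exit times. *)
Definition prim (F : int -> R) (x : int) : R :=
  match x with
  | Posz n => \sum_(k < n) F k%:Z
  | Negz n => - \sum_(k < n.+1) F (Negz k)
  end.

Lemma primS F x : prim F (x + 1) = prim F x + F x.
Proof.
case: x => [n|[|n]].
- by rewrite -PoszD addn1 /= big_ord_recr.
- by rewrite /= big_ord0 big_ord1 addNr.
- have -> : Negz n.+1 + 1 = Negz n by rewrite !NegzE; lia.
  by rewrite /= [in RHS]big_ord_recr /= opprD -addrA addNr addr0.
Qed.

Lemma primB F x n : prim F (x + n%:Z) - prim F x = \sum_(i < n) F (x + i%:Z).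
Proof.
elim: n => [|n IH]; first by rewrite addr0 subrr big_ord0.
have -> : x + n.+1%:Z = x + n%:Z + 1 by lia.
by rewrite primS big_ord_recr /= -IH; ring.
Qed.

Lemma prim_ge F x z : x <= z -> (forall k, x <= k < z -> 0 <= F k) ->
  prim F x <= prim F z.
Proof.
move=> xz F0; have -> : z = x + `|z - x|%N by lia.
rewrite -subr_ge0 primB; apply: sumr_ge0 => i _; apply: F0; move: (ltn_ord i); lia.
Qed.

Lemma prim_le F x z (n : nat) M : x <= z -> z - x <= n%:Z -> 0 <= M ->
  (forall k, x <= k < z -> F k <= M) -> prim F z - prim F x <= n%:R * M.
Proof.
move=> xz zxn M0 FM; have -> : z = x + `|z - x|%N by lia.
rewrite primB.
apply: (@le_trans _ _ (\sum_(i < `|z - x|%N) M)); last first.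
  by rewrite sumr_const card_ord -[M *+ _]mulr_natl; apply: ler_wpM2r => //; rewrite ler_nat; lia.
by apply: ler_sum => i _; apply: FM; move: (ltn_ord i); lia.
Qed.

Lemma prim_ge1 F x z k : x <= k < z -> (forall j, x <= j < z -> 0 <= F j) ->
  F k <= prim F z - prim F x.
Proof.
move=> /andP[xk kz] F0.
have h1 : prim F x <= prim F k by apply: prim_ge => // j hj; apply: F0; lia.
have h2 : prim F (k + 1) <= prim F z by apply: prim_ge => [|j hj]; [lia|apply: F0; lia].
move: h2; rewrite primS; lra.
Qed.

End Primitive.

(** * Transition probabilities and reversibility *)

Section Kernel.
Variables (R : realType) (w : int -> R).
Hypothesis w01 : forall x, 0 < w x < 1.

Definition gen (f : int -> R) (x : int) : R :=
  w x * f (x + 1) + (1 - w x) * f (x - 1).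

(** Probability of being at [z] at time [n] for the walk started at [x]; the starting point comes
    last, since [gen] acts on it. *)
Definition kern (n : nat) (z x : int) : R :=
  iter n gen (fun x => (x == z)%:R) x.

Lemma gen_le (f g : int -> R) (x : int) : f (x + 1) <= g (x + 1) -> f (x - 1) <= g (x - 1) ->
  gen f x <= gen g x.
Proof.
move=> h1 h2; have /andP[w0 w1] := w01 x.
by apply: lerD; apply: ler_wpM2l => //; [exact: ltW|rewrite subr_ge0; exact: ltW].
Qed.

Lemma iter_gen_le n f g : (forall x, f x <= g x) ->
  forall x, iter n gen f x <= iter n gen g x.
Proof. by move=> fg; elim: n => //= n IH x; apply: gen_le. Qed.

Lemma iter_gen_comb n (s : seq int) (a : int -> R) (F : int -> int -> R) x :
  iter n gen (fun x => \sum_(i <- s) a i * F i x) x =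
  \sum_(i <- s) a i * iter n gen (F i) x.
Proof.
elim: n x => //= n IH x; rewrite /gen !IH !mulr_sumr -big_split /=.
by apply: eq_bigr => i _; ring.
Qed.

Lemma kernS n z x : kern n.+1 z x = gen (kern n z) x.
Proof. by []. Qed.

Lemma kern_ge0 n z x : 0 <= kern n z x.
Proof.
elim: n x => [|n IH] x; first by rewrite /kern /= ler0n.
have /andP[w0 w1] := w01 x.
by rewrite kernS /gen addr_ge0 ?mulr_ge0// ?subr_ge0 ltW.
Qed.

(** Decomposition at the last step instead of the first. The first step acts on the starting point
    and the last one on the target, so the two operations commute and the induction only rearranges
    terms. *)
Lemma kern_forward n z x :
  kern n.+1 z x = w (z - 1) * kern n (z - 1) x + (1 - w (z + 1)) * kern n (z + 1) x.
Proof.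
elim: n x => [|n IH] x; last first.
  by rewrite kernS /gen !IH !kernS /gen; ring.
rewrite /kern /= /gen; have -> : (x + 1 == z) = (x == z - 1) by lia.
have -> : (x - 1 == z) = (x == z + 1) by lia.
by congr (_ + _); have [->|_] := eqVneq x _; rewrite ?mulr0.
Qed.

Lemma kern_reversible (pi : int -> R) :
  (forall x, pi x * w x = pi (x + 1) * (1 - w (x + 1))) ->
  forall n x z, pi x * kern n z x = pi z * kern n x z.
Proof.
move=> rev; elim=> [|n IH] x z.
  by rewrite /kern /= (eq_sym z); have [->|_] := eqVneq x z; rewrite ?mulr0.
rewrite kernS /gen (kern_forward n x z).
have e1 := IH (x + 1) z; have e2 := IH (x - 1) z.
have r1 := rev x; have := rev (x - 1); rewrite subrK => r2.
transitivity ((pi x * w x) * kern n z (x + 1) + (pi x * (1 - w x)) * kern n z (x - 1)).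
  by ring.
rewrite r1 -r2.
transitivity ((1 - w (x + 1)) * (pi (x + 1) * kern n z (x + 1)) +
    w (x - 1) * (pi (x - 1) * kern n z (x - 1))); first by ring.
by rewrite e1 e2; ring.
Qed.

(** Chapman-Kolmogorov restricted to intermediate sites in [s]: the function [kern m b] is replaced
    by its restriction to [s], which is smaller, before the remaining [m] steps. *)
Lemma kern_add_ge m (s : seq int) b : uniq s ->
  \sum_(x <- s) kern m b x * kern m x b <= kern (m + m) b b.
Proof.
move=> us; rewrite /kern iterD -iter_gen_comb.
apply: iter_gen_le => x.
have [xs|xs] := boolP (x \in s).
  rewrite (bigD1_seq x)//= eqxx mulr1 big1 ?addr0// => i ix.
  by rewrite eq_sym (negbTE ix) mulr0.
rewrite big_seq big1 ?kern_ge0 // => i si.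
by case: eqVneq xs => [->|]; rewrite ?si ?mulr0.
Qed.

(* Cauchy-Schwarz, linearized as [q^2 / p >= 2 t q - t^2 p], combined with
   reversibility [kern m b x = pi b / pi x * kern m x b]. *)
Lemma kern_return_ge (pi : int -> R) (K : R) (s : seq int) m b : uniq s ->
  (forall x, 0 < pi x) ->
  (forall x, pi x * w x = pi (x + 1) * (1 - w (x + 1))) ->
  0 < K -> \sum_(x <- s) pi x <= K * pi b ->
  1 / 2 <= \sum_(x <- s) kern m x b ->
  1 / (4 * K) <= kern (m + m) b b.
Proof.
move=> us pi0 rev K0 sK half; apply: le_trans (kern_add_ge m b us).
(* [t] maximizes [t - t ^+ 2 * K], the lower bound that remains after summation over [s]; the
   maximum is [1 / (4 * K)]. *)
pose t := (2 * K)^-1.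
have t0 : 0 < t by rewrite invr_gt0 mulr_gt0.
have tK : t * K = 1 / 2 by rewrite /t; field; rewrite gt_eqF.
apply: (@le_trans _ _ (\sum_(x <- s) (2 * t * kern m x b - t ^+ 2 * (pi x / pi b)))).
  rewrite big_split /= -mulr_sumr sumrN -mulr_sumr -mulr_suml.
  have h1 : 2 * t * (1 / 2) <= 2 * t * (\sum_(x <- s) kern m x b).
    by apply: ler_wpM2l => //; lra.
  have h2 : t ^+ 2 * ((\sum_(x <- s) pi x) / pi b) <= t ^+ 2 * K.
    by apply: ler_wpM2l; [rewrite exprn_ge0// ltW|rewrite ler_pdivrMr].
  have -> : 1 / (4 * K) = t - t ^+ 2 * K by rewrite /t; field; rewrite gt_eqF.
  lra.
apply: ler_sum => x _.
have e : kern m b x = pi b / pi x * kern m x b.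
  by rewrite mulrAC -(kern_reversible rev) mulrC mulKf// gt_eqF.
rewrite e -subr_ge0.
have -> : pi b / pi x * kern m x b * kern m x b -
    (2 * t * kern m x b - t ^+ 2 * (pi x / pi b)) =
    pi b / pi x * (kern m x b - t * (pi x / pi b)) ^+ 2.
  by field; rewrite !gt_eqF.
by rewrite mulr_ge0 ?sqr_ge0// divr_ge0// ltW.
Qed.

(** [f] vanishes at [b] and grows in mean by at most [p] per step, and [1 - f] lies below the
    indicator of [s]. *)
Lemma kern_stay (f : int -> R) (p : R) (s : seq int) m b :
  uniq s -> f b = 0 -> (forall x, 0 <= f x) ->
  (forall x, gen f x <= f x + p) ->
  (forall x, x \notin s -> 1 <= f x) ->
  1 - m%:R * p <= \sum_(x <- s) kern m x b.
Proof.
move=> us fb f0 fp fs.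
have up : forall n x, iter n gen (fun x => 1 - f x) x >= 1 - f x - n%:R * p.
  elim=> [|n IH] x /=; first by rewrite mul0r subr0.
  apply: (@le_trans _ _ (gen (fun x => 1 - f x - n%:R * p) x)); last exact: gen_le.
  by move: (fp x); rewrite /gen -[n.+1]addn1 natrD => h; lra.
have := up m b; rewrite fb subr0 => /le_trans; apply.
have -> : \sum_(x <- s) kern m x b = \sum_(x <- s) 1 * kern m x b.
  by apply: eq_bigr => x _; rewrite mul1r.
rewrite -(iter_gen_comb m s (fun=> 1) (fun z x => (x == z)%:R)).
apply: iter_gen_le => x.
have [xs|xs] := boolP (x \in s).
  rewrite (bigD1_seq x)//= eqxx mulr1 big1 ?addr0 => [|i ix]; last first.
    by rewrite eq_sym (negbTE ix) mulr0.
  by rewrite lerBlDr lerDl.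
rewrite big_seq big1 => [|i si]; first by rewrite subr_le0 fs.
by case: eqVneq xs => [->|]; rewrite ?si ?mulr0.
Qed.

End Kernel.

(** * Confinement in a valley and hitting of its bottom *)

Section Valley.
Variables (R : realType) (w E : int -> R).
Hypothesis w01 : forall x, 0 < w x < 1.
Hypothesis E0 : forall x, 0 < E x.
Hypothesis wE : forall x, (1 - w x) * E (x - 1) = w x * E x.

(** With [E = exp V], [(E x)^-1] is the conductance of the edge between [x] and [x + 1]; the
    reversible measure of a site is the sum of the conductances of its two edges. *)
Definition revm (x : int) : R := (E x)^-1 + (E (x - 1))^-1.

Lemma revm_gt0 x : 0 < revm x.
Proof. by rewrite addr_gt0// invr_gt0. Qed.

Lemma revm_right x : revm x * w x = (E x)^-1.
Proof.
have Ex := E0 x; have Ex1 := E0 (x - 1); have e := wE x.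
rewrite /revm.
have -> : (E (x - 1))^-1 = (E x * E (x - 1))^-1 * E x.
  by field; rewrite !gt_eqF.
have -> : (E x)^-1 = (E x * E (x - 1))^-1 * E (x - 1).
  by field; rewrite !gt_eqF.
rewrite -mulrDr -mulrA; congr (_ * _); lra.
Qed.

Lemma revm_left x : revm x * (1 - w x) = (E (x - 1))^-1.
Proof. by rewrite mulrBr revm_right mulr1 /revm addrAC subrr add0r. Qed.

Lemma revm_balance x : revm x * w x = revm (x + 1) * (1 - w (x + 1)).
Proof. by rewrite revm_right revm_left addrK. Qed.

Lemma prim_harmonic x : gen w (prim E) x = prim E x.
Proof.
rewrite /gen primS; have := primS E (x - 1); rewrite subrK => ->.
have := wE x; lra.
Qed.

Definition sites (a c : int) : seq int :=
  [seq a + 1 + i%:Z | i <- iota 0 `|c - a|%N].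

Lemma mem_sites (a c x : int) : a <= c -> (x \in sites a c) = (a < x <= c).
Proof.
move=> ac; apply/mapP/idP => [[i]|h].
  by rewrite mem_iota => hi ->; lia.
exists (absz (x - a - 1)%R); first by rewrite mem_iota; lia.
lia.
Qed.

Lemma uniq_sites (a c : int) : uniq (sites a c).
Proof. by rewrite map_inj_uniq ?iota_uniq// => i j; lia. Qed.

Lemma valley_return (a b c : int) (q K : R) (m : nat) :
  a < b -> b <= c -> E b <= q * E a -> E b <= q * E c ->
  0 < K -> \sum_(x <- sites a c) revm x <= K * revm b ->
  m%:R * (2 * q) <= 1 / 2 ->
  1 / (4 * K) <= kern w (m + m) b b.
Proof.
move=> ab bc qa qc K0 sK mq.
apply: (kern_return_ge w01 (uniq_sites a c) revm_gt0 revm_balance K0 sK).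
(* The scale function measured from [b] and normalized on each side by the last edge of the wall,
   hence at least 1 beyond the walls. It is harmonic except at [b], where its mean increase is
   [w b * (E b / E c + E b / E a)], at most [2 * q]. *)
pose f x := if b <= x then (prim E x - prim E b) / E c
            else (prim E b - prim E x) / E a.
have mono x z : x <= z -> prim E x <= prim E z.
  by move=> xz; apply: prim_ge => // k _; exact: ltW.
have q0 : 0 <= q.
  by rewrite -(pmulr_lge0 _ (E0 a)); apply: le_trans qa; exact: ltW.
apply: (@le_trans _ _ (1 - m%:R * (2 * q))); first lra.
apply: (@kern_stay _ _ w01 f) => //; first exact: uniq_sites.
- by rewrite /f lexx subrr mul0r.
- move=> x; rewrite /f; case: ifPn => h; apply: divr_ge0; rewrite ?subr_ge0 ?(ltW (E0 _))//.
    exact: mono.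
  by apply: mono; lia.
- move=> x; have e := prim_harmonic x; rewrite /gen in e.
  have [xb|xb|xb] := ltgtP x b.
  + have -> : gen w f x = f x; last lra.
    rewrite /gen /f; have -> : (b <= x) = false by lia.
    have -> : (b <= x - 1) = false by lia.
    case: ifPn => h.
      have -> : x + 1 = b by lia.
      rewrite -e; have -> : x + 1 = b by lia.
      by rewrite subrr mul0r mulr0 add0r; field; rewrite gt_eqF.
    by rewrite -e; field; rewrite gt_eqF.
  + have -> : gen w f x = f x; last lra.
    rewrite /gen /f; have -> : (b <= x) = true by lia.
    have -> : (b <= x - 1) = true by lia.
    have -> : (b <= x + 1) = true by lia.
    by rewrite -e; field; rewrite gt_eqF.
  + rewrite {x}xb in e *; rewrite /gen /f lexx.
    have -> : (b <= b + 1) = true by lia.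
    have -> : (b <= b - 1) = false by lia.
    have s1 := primS E b; have := primS E (b - 1); rewrite subrK => s2.
    rewrite s1 {3}s2 subrr mul0r add0r.
    have /andP[wb0 wb1] := w01 b.
    have h1 : E b / E c <= q by rewrite ler_pdivrMr.
    have h2 : E b / E a <= q by rewrite ler_pdivrMr.
    have h1p : 0 <= E b / E c by rewrite divr_ge0 ?ltW.
    have h2p : 0 <= E b / E a by rewrite divr_ge0 ?ltW.
    have -> : w b * ((prim E b + E b - prim E b) / E c) +
       (1 - w b) * ((prim E (b - 1) + E (b - 1) - prim E (b - 1)) / E a) =
       w b * (E b / E c) + (1 - w b) * E (b - 1) / E a.
      by field; rewrite !gt_eqF.
    rewrite wE -mulrA; nra.
- move=> x; rewrite mem_sites; last lia.
  move=> hx; rewrite /f; case: ifPn => h.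
    rewrite ler_pdivlMr// mul1r; apply: prim_ge1; first lia.
    by move=> j _; exact: ltW.
  rewrite ler_pdivlMr// mul1r; apply: prim_ge1; first lia.
  by move=> j _; exact: ltW.
Qed.

(** Probability that the walk started at [x] avoids [b] at all times up to [n], both ends
    included. *)
Fixpoint surv (b : int) (n : nat) (x : int) : R :=
  if x == b then 0 else if n is m.+1 then gen w (surv b m) x else 1.

Lemma surv_b b n : surv b n b = 0.
Proof. by case: n => [|n] /=; rewrite eqxx. Qed.

Lemma survS b n x : x != b -> surv b n.+1 x = gen w (surv b n) x.
Proof. by move=> /negbTE /= ->. Qed.

Lemma survS_le b n x : surv b n.+1 x <= surv b n x.
Proof.
elim: n x => [|n IH] x; have [->|xb] := eqVneq x b; rewrite ?surv_b//.
  rewrite survS//= (negbTE xb).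
  have h z : surv b 0 z <= 1 by rewrite /=; case: ifP.
  have := @gen_le _ _ w01 (surv b 0) (fun=> 1) x (h _) (h _); rewrite {2}/gen /=; lra.
by rewrite survS// [leRHS]survS//; apply: gen_le.
Qed.

Lemma surv_le b (m n : nat) x : (m <= n)%N -> surv b n x <= surv b m x.
Proof.
move=> /subnK <-; elim: (n - m)%N => // k IH.
by rewrite addSn; apply: le_trans IH; exact: survS_le.
Qed.

(** Strong Markov property at the first visit to [b], unrolled as an induction on [n]: by parity the
    time left after this visit is even, so the return bound [c] applies to it. *)
Lemma kern_ge_surv (b : int) (N : nat) (c : R) : 0 <= c ->
  (forall m : nat, (m + m <= N)%N -> c <= kern w (m + m) b b) ->
  forall (n : nat) x, (n <= N)%N -> (2 %| x - b + n%:Z)%Z ->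
    c * (1 - surv b n x) <= kern w n b x.
Proof.
move=> c0 ret; elim=> [|n IH] x nN par.
  have [->|xb] := eqVneq x b.
    by rewrite surv_b subr0 mulr1 (ret 0%N).
  by rewrite [surv b 0 x]/= (negbTE xb) subrr mulr0 kern_ge0.
have [xb|xb] := eqVneq x b.
  rewrite xb surv_b subr0 mulr1; have -> : n.+1 = (n.+1./2 + n.+1./2)%N by lia.
  by apply: ret; lia.
rewrite survS// kernS.
apply: (@le_trans _ _ (gen w (fun x => c * (1 - surv b n x)) x)).
  by rewrite /gen; lra.
by apply: gen_le => //; apply: IH; lia.
Qed.

(* [h] is the probability of hitting [a] before [b], and [T] is the primitive
   of [D], chosen such that [gen (T b - T) = (T b - T) - 1]; the sum over time
   is at most the mean exit time from the interval, bounded by [T b - T y]. *)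
Lemma surv_bound (a b y : int) (W : nat) (B g : R) (n : nat) :
  a <= y < b -> b - a <= W%:Z -> 0 <= B -> 0 <= g ->
  (forall l k, a <= l -> l <= k -> k < b -> E k <= B * E l) ->
  (forall k, y <= k < b -> E k <= g * E a) ->
  n%:R * (surv b n y - W%:R * g) <= 2 * W%:R ^+ 2 * B.
Proof.
move=> ayb baW B0 g0 climb gap.
have ab : a < b by lia.
pose S := prim E; pose h x := (S b - S x) / (S b - S a).
have Sab : 0 < S b - S a.
  apply: lt_le_trans (E0 a) _; apply: prim_ge1; first lia.
  by move=> j _; exact: ltW.
have Smono x z : x <= z -> S x <= S z.
  by move=> xz; apply: prim_ge => // k _; exact: ltW.
pose C := prim (fun x => revm (x + 1)).
have Cmono x z : x <= z -> C x <= C z.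
  by move=> xz; apply: prim_ge => // k _; exact/ltW/revm_gt0.
pose D x := E x * (C x - C a).
pose T := prim D.
have genT x : gen w (fun x => T b - T x) x = T b - T x - 1.
  have s1 : T (x + 1) = T x + D x := primS D x.
  have s2 : T (x - 1) = T x - D (x - 1).
    by have := primS D (x - 1); rewrite subrK -/T => ->; rewrite addrK.
  have Cx : C x = C (x - 1) + revm x.
    by have := primS (fun x => revm (x + 1)) (x - 1); rewrite subrK.
  have r : w x * E x * revm x = 1.
    have -> : w x * E x * revm x = E x * (revm x * w x) by ring.
    by rewrite revm_right mulfV// gt_eqF.
  have wD : w x * D x = (1 - w x) * D (x - 1) + 1.
    rewrite /D Cx !mulrA wE.
    have -> : w x * E x * (C (x - 1) + revm x - C a) =
              w x * E x * (C (x - 1) - C a) + w x * E x * revm x by ring.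
    by rewrite r.
  rewrite /gen s1 s2.
  have -> : w x * (T b - (T x + D x)) + (1 - w x) * (T b - (T x - D (x - 1))) =
    T b - T x - w x * D x + (1 - w x) * D (x - 1) by ring.
  by rewrite wD; ring.
have Tpos x : a <= x <= b -> 0 <= T b - T x.
  move=> axb; rewrite subr_ge0; apply: prim_ge; first lia.
  move=> k hk; rewrite /D mulr_ge0// ?(ltW (E0 _))// subr_ge0; apply: Cmono; lia.
have genh x : gen w h x = h x.
  have e : w x * S (x + 1) + (1 - w x) * S (x - 1) = S x := prim_harmonic x.
  by rewrite /gen /h -[in RHS]e; field; rewrite gt_eqF.
(* Subtracting [h] replaces stopping at [a]: there [h] equals 1, every summand is nonpositive, and
   the behaviour after reaching [a] does not matter. *)
have sum_le : forall m x, a <= x <= b ->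
    \sum_(k < m) (surv b k x - h x) <= T b - T x.
  elim=> [|m IH] x axb; first by rewrite big_ord0 Tpos.
  have [->|xb] := eqVneq x b.
    rewrite subrr; apply: sumr_le0 => k _.
    by rewrite surv_b /h subrr mul0r subrr.
  have [->|xa] := eqVneq x a.
    apply: (@le_trans _ _ 0); last by apply: Tpos; lia.
    apply: sumr_le0 => k _; rewrite /h divff ?gt_eqF// subr_le0.
    apply: le_trans (surv_le b a (leq0n k)) _.
    by rewrite /=; case: ifP.
  have hx : 0 <= h x by rewrite /h divr_ge0 ?subr_ge0 ?Smono ?ltW//; lia.
  rewrite big_ord_recl.
  have -> : surv b (@ord0 m) x = 1 by rewrite /= (negbTE xb).
  have -> : \sum_(i < m) (surv b (lift ord0 i) x - h x) =
      gen w (fun x => \sum_(k < m) (surv b k x - h x)) x.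
    rewrite [in RHS]/gen !mulr_sumr -big_split /=; apply: eq_bigr => i _.
    by rewrite (negbTE xb) add0n -[in LHS]genh /gen; ring.
  have l1 : \sum_(k < m) (surv b k (x + 1) - h (x + 1)) <= T b - T (x + 1).
    by apply: IH; lia.
  have l2 : \sum_(k < m) (surv b k (x - 1) - h (x - 1)) <= T b - T (x - 1).
    by apply: IH; lia.
  have := @gen_le _ _ w01 (fun x => \sum_(k < m) (surv b k x - h x))
     (fun x => T b - T x) x l1 l2.
  rewrite genT; lra.
have hy : h y <= W%:R * g.
  rewrite /h ler_pdivrMr//.
  have h1 : S b - S y <= W%:R * (g * E a).
    apply: prim_le => //; try lia.
    by rewrite mulr_ge0// ltW.
  apply: le_trans h1 _; rewrite mulrA; apply: ler_wpM2l.
    by rewrite mulr_ge0.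
  apply: prim_ge1; first lia.
  by move=> j _; exact: ltW.
(* Since no climb exceeds the factor [B], each of the at most [W] terms of [C k - C a] is at most
   [2 * B / E k], so that [D k] is at most [2 * W * B]. *)
have Ty : T b - T y <= 2 * W%:R ^+ 2 * B.
  have -> : 2 * W%:R ^+ 2 * B = W%:R * (W%:R * (2 * B)) by ring.
  apply: prim_le; try lia.
    by rewrite !mulr_ge0.
  move=> k hk; rewrite /D.
  have h1 : C k - C a <= W%:R * (2 * B / E k).
    apply: prim_le; try lia.
      by rewrite divr_ge0 ?mulr_ge0// ltW.
    move=> j hj; rewrite /revm addrK.
    have c1 : (E (j + 1))^-1 <= B / E k.
      rewrite ler_pdivlMr// mulrC ler_pdivrMr//; apply: climb; lia.
    have c2 : (E j)^-1 <= B / E k.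
      rewrite ler_pdivlMr// mulrC ler_pdivrMr//; apply: climb; lia.
    have -> : 2 * B / E k = B / E k + B / E k by field; rewrite gt_eqF.
    exact: lerD.
  apply: le_trans (ler_wpM2l (ltW (E0 k)) h1) _.
  by rewrite le_eqVlt; apply/orP; left; apply/eqP; field; rewrite gt_eqF.
apply: le_trans (le_trans _ Ty); last by apply: (sum_le n); lia.
apply: (@le_trans _ _ (\sum_(k < n) (surv b n y - h y))).
  rewrite sumr_const card_ord -[leRHS]mulr_natl; apply: ler_wpM2l => //.
  lra.
by apply: ler_sum => k _; rewrite lerD2r; apply: surv_le; exact: ltnW.
Qed.

(** [a] and [c] are the walls that confine the walk until time [N], while [a'] only has to turn it
    back before its first visit to [b]. The last two bounds make [surv] at most [1/4 + 1/4], and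
    half of the return bound survives. *)
Lemma valley_bound (a a' b c y : int) (W N n0 : nat) (q B g K : R) :
  a < b -> b <= c -> E b <= q * E a -> E b <= q * E c ->
  0 < K -> \sum_(x <- sites a c) revm x <= K * revm b ->
  N%:R * q <= 1 / 2 ->
  a' <= y < b -> b - a' <= W%:Z -> 0 <= B -> 0 <= g ->
  (forall l k, a' <= l -> l <= k -> k < b -> E k <= B * E l) ->
  (forall k, y <= k < b -> E k <= g * E a') ->
  W%:R * g <= 1 / 4 -> 8 * W%:R ^+ 2 * B <= n0%:R ->
  forall n : nat, (0 < n)%N -> (n0 <= n <= N)%N -> (2 %| y - b + n%:Z)%Z ->
    1 / (8 * K) <= kern w n b y.
Proof.
move=> ab bc qa qc K0 sK Nq ayb baW B0 g0 climb gap Wg WB n n1 /andP[n0n nN] par.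
have q0 : 0 <= q.
  by rewrite -(pmulr_lge0 _ (E0 a)); apply: le_trans qa; exact: ltW.
have ret m : (m + m <= N)%N -> 1 / (4 * K) <= kern w (m + m) b b.
  move=> mN; apply: (valley_return ab bc qa qc K0 sK).
  apply: le_trans Nq; rewrite mulrA; apply: ler_wpM2r => //.
  by rewrite -natrM ler_nat; lia.
have c0 : 0 <= 1 / (4 * K) by rewrite divr_ge0 ?mulr_ge0// ltW.
apply: le_trans (kern_ge_surv c0 ret nN par).
have half : surv b n y <= 1 / 2.
  have := surv_bound n ayb baW B0 g0 climb gap.
  have n0' : n0%:R <= n%:R :> R by rewrite ler_nat.
  have np : 0 < n%:R :> R by rewrite ltr0n.
  move=> h; rewrite leNgt; apply/negP => h2.
  have : n%:R * (1 / 4) < n%:R * (surv b n y - W%:R * g).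
    by rewrite ltr_pM2l//; lra.
  lra.
have -> : 1 / (8 * K) = 1 / (4 * K) * (1 / 2) by field; rewrite gt_eqF.
by apply: ler_wpM2l => //; lra.
Qed.

End Valley.

(** * From the kernel to the law of a walk *)

Section WalkLaw.
Context (R : realType) (w : int -> R) (y : int) (d : measure_display)
  (T : measurableType d) (Q : probability T R) (Z : nat -> T -> int).
Hypothesis w01 : forall x, 0 < w x < 1.
Hypothesis walk : walk_in_environment w y Q Z.

Let past n (s : nat -> int) := [set u | forall k, (k <= n)%N -> Z k u = s k].

Let pastS n s (z : int) :
  past n.+1 (fun k => if k == n.+1 then z else s k) =
  past n s `&` Z n.+1 @^-1` [set z].
Proof.
apply/seteqP; split=> u /=.
  move=> h; split=> [k kn|]; last by have := h n.+1 (leqnn _); rewrite eqxx.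
  by have := h k (leqW kn); rewrite ltn_eqF.
move=> [h1 h2] k; rewrite leq_eqVlt => /orP[/eqP ->|]; first by rewrite eqxx.
by rewrite ltnS => kn; rewrite ltn_eqF// h1.
Qed.

Let measurable_past n s : measurable (past n s).
Proof.
elim: n => [|n IH].
  have -> : past 0 s = Z 0%N @^-1` [set s 0%N].
    apply/seteqP; split=> u /= h; first exact: h.
    by move=> k; rewrite leqn0 => /eqP ->.
  exact: walk_measurable walk _ _.
have -> : past n.+1 s = past n s `&` Z n.+1 @^-1` [set s n.+1].
  rewrite -pastS; congr past; apply/funext => k.
  by case: eqP => [->|].
by apply: measurableI => //; exact: walk_measurable walk _ _.
Qed.

(** The given trajectory is extended by its two possible moves, one step at a time. Only a lower
    bound is claimed, so it is enough to add the probabilities of these two disjoint extensions. *)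
Let past_kern_le m n s z :
  (Q (past n s) * (kern w m z (s n))%:E <=
   Q (past n s `&` Z (n + m)%N @^-1` [set z]))%E.
Proof.
elim: m n s => [|m IH] n s.
  rewrite /kern /= addn0; case: eqP => [e|_]; last by rewrite mule0 measure_ge0.
  rewrite mule1 (_ : past n s `&` _ = past n s)//.
  by apply/setIidl => u h /=; rewrite h.
pose s1 (k : nat) : int := if k == n.+1 then s n + 1 else s k.
pose s2 (k : nat) : int := if k == n.+1 then s n - 1 else s k.
have mZ (s' : nat -> int) : measurable (past n.+1 s' `&` Z (n + m.+1)%N @^-1` [set z]).
  by apply: measurableI => //; exact: walk_measurable walk _ _.
apply: (@le_trans _ _ (Q ((past n.+1 s1 `&` Z (n + m.+1)%N @^-1` [set z]) `|`
                 (past n.+1 s2 `&` Z (n + m.+1)%N @^-1` [set z])))); last first.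
  apply: le_measure; rewrite ?inE.
  - exact: measurableU (mZ s1) (mZ s2).
  - by apply: measurableI => //; exact: walk_measurable walk _ _.
  - by rewrite /s1 /s2 !pastS => u /= [[[h1 _] h2]|[[h1 _] h2]].
rewrite (measureU _ (mZ s1) (mZ s2)); last first.
  rewrite /s1 /s2 !pastS -subset0 => u /= [[[_ h1] _] [[_ h2] _]].
  by move: h1; rewrite h2; lia.
have q1 : Q (past n.+1 s1) = (Q (past n s) * (w (s n))%:E)%E.
  by rewrite pastS (walk_right walk).
have q2 : Q (past n.+1 s2) = (Q (past n s) * (1 - w (s n))%:E)%E.
  by rewrite pastS (walk_left walk).
have := IH n.+1 s1; have := IH n.+1 s2.
rewrite addSnnS q1 q2 {1}/s1 {1}/s2 eqxx.
have -> : Q (past n s) = (fine (Q (past n s)))%:E.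
  by rewrite fineK// fin_num_measure.
set r := fine _; rewrite -!EFinM => h2 h1.
rewrite kernS /gen; apply: le_trans (leeD h1 h2).
by rewrite -EFinD lee_fin; lra.
Qed.

Lemma walk_law_ge n z : ((kern w n z y)%:E <= Q [set u | Z n u = z])%E.
Proof.
have := past_kern_le n 0 (fun=> y) z.
have -> : past 0 (fun=> y) = Z 0%N @^-1` [set y].
  by apply/seteqP; split=> u /= h; [exact: h|move=> k; rewrite leqn0 => /eqP ->].
rewrite (walk_start walk) mul1e add0n => /le_trans; apply.
apply: le_measure; rewrite ?inE.
- by apply: measurableI; exact: walk_measurable walk _ _.
- exact: (walk_measurable walk n z).
- by move=> u [].
Qed.

End WalkLaw.

Section Reflection.
Variables (R : realType) (w : int -> R).

(** The environment seen by the walk with reversed sign; it turns statements about the left side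
    into statements about the right side. *)
Definition reflect_env (x : int) : R := 1 - w (- x).

Lemma kern_reflect n z x : kern reflect_env n z x = kern w n (- z) (- x).
Proof.
elim: n z x => [|n IH] z x; first by rewrite /kern /= eqr_opp.
rewrite !kernS /gen !IH /reflect_env.
have -> : - (x + 1) = - x - 1 by lia.
have -> : - (x - 1) = - x + 1 by lia.
by ring.
Qed.

End Reflection.

(** * Paths and bets *)

Section Betting.
Variables (R : realType) (x : nat -> R) (al be : nat -> bool).

Fixpoint fresh (k : nat) : bool := if k is j.+1 then fresh j && ~~ al j else true.

(** A single unit stake, placed at the first time when [al] holds and withdrawn at the first time
    from then on when [be] holds; it is never placed again. Holding it at time [k] depends on [al]
    and [be] up to [k] only, and it is paid the increment after [k]: the bet is predictable. *)
Fixpoint bet (k : nat) : bool :=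
  ~~ be k && (fresh k && al k || (if k is j.+1 then bet j else false)).

Definition gain (n : nat) : R := \sum_(k < n) (bet k)%:R * (x k.+1 - x k).

Lemma fresh_before k j : fresh k -> (j < k)%N -> al j = false.
Proof.
elim: k => //= k IH /andP[fk /negbTE ak]; rewrite ltnS leq_eqVlt.
by case/orP => [/eqP ->//|]; exact: IH.
Qed.

Lemma freshP k : (forall j, (j < k)%N -> ~~ al j) -> fresh k.
Proof.
elim: k => //= k IH h; rewrite h// andbT; apply: IH => j jk; apply: h.
exact: ltnW.
Qed.

Lemma betE s e k : fresh s -> al s -> (s <= e)%N ->
  (forall j, (s <= j < e)%N -> ~~ be j) -> (k < e)%N || be e ->
  bet k = (s <= k < e)%N.
Proof.
move=> fs as_ se nb.
have nfs j : (s < j)%N -> fresh j = false.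
  by move=> sj; apply/negP => /fresh_before/(_ sj); rewrite as_.
elim: k => [|k IH] ke /=.
  rewrite orbF; case: s fs as_ se nb nfs => [|s] fs as_ se nb nfs.
    rewrite as_ andbT leq0n /=; case: e nb ke {se} => [|e] nb ke; last by rewrite nb.
    by move: ke => /= ->.
  by rewrite (fresh_before fs)// andbF.
have ke' : (k < e)%N || be e.
  by case/orP: ke => [/ltnW ->//|->]; rewrite orbT.
rewrite IH//; have [ks|[sk|ks]] : (k.+1 < s)%N \/ (k.+1 = s) \/ (s < k.+1)%N by lia.
- rewrite (fresh_before fs ks) andbF /=.
  have -> : (s <= k)%N = false by lia.
  have -> : (s <= k.+1)%N = false by lia.
  by rewrite andbF.
- rewrite -/(fresh k.+1) sk fs as_ /= andbT leqnn.
  have [ke2|ek] := ltnP s e; first by rewrite nb// leqnn.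
  have es : e = s by apply/eqP; rewrite eqn_leq ek se.
  by move: ke; rewrite sk es ltnn /= => ->.
- rewrite -/(fresh k.+1) nfs//.
  have -> : (s <= k)%N by lia.
  rewrite (ltnW ks) /=.
  have [ke2|ek] := ltnP k.+1 e; first by rewrite nb ?(ltnW ks)// ltnW.
  have [ke3|ek3] := ltnP k e; last by rewrite andbF.
  have es : e = k.+1 by lia.
  by move: ke; rewrite es ltnn /= => ->.
Qed.

Lemma gain_window s e n : (s <= e)%N -> (e <= n)%N ->
  (forall k, (k < n)%N -> bet k = (s <= k < e)%N) -> gain n = x e - x s.
Proof.
move=> se en betk; rewrite /gain.
have -> : \sum_(k < n) (bet k)%:R * (x k.+1 - x k) =
          \sum_(0 <= k < n | (s <= k < e)%N) (x k.+1 - x k).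
  rewrite big_mkord [RHS]big_mkcond /=; apply: eq_bigr => k _.
  by rewrite betk//; case: ifP; rewrite ?mul1r ?mul0r.
rewrite -(telescope_sumr x se) (big_nat_widen _ _ _ _ _ en) /=.
rewrite (big_nat_widenl s 0)//; apply: eq_bigl => k /=.
by rewrite andbC.
Qed.

Lemma gain_stop s e n : fresh s -> al s -> (s <= e <= n)%N ->
  (forall j, (s <= j < e)%N -> ~~ be j) -> be e -> gain n = x e - x s.
Proof.
move=> fs as_ /andP[se en] nb bee; apply: gain_window => // k kn.
by apply: betE => //; rewrite bee orbT.
Qed.

Lemma gain_ind (P : R -> Prop) n : P 0 ->
  (forall s e, fresh s -> al s -> (s <= e <= n)%N ->
    (forall j, (s <= j < e)%N -> ~~ be j) -> P (x e - x s)) ->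
  P (gain n).
Proof.
move=> P0 Pse.
have bet0 k : (forall j, (j <= k)%N -> ~~ al j) -> bet k = false.
  elim: k => [|k IH] nal /=; rewrite (negbTE (nal _ (leqnn _))) !andbF//= IH ?andbF//.
  by move=> j jk; apply/nal/leqW.
have [exs|nexs] := pselect (exists s, (s < n)%N && al s); last first.
  suff -> : gain n = 0 by [].
  rewrite /gain big1// => k _; rewrite bet0 ?mul0r// => j jk.
  by apply/negP => aj; apply: nexs; exists j; rewrite aj (leq_ltn_trans jk).
have [s /andP[sn as_] smin] := ex_minnP exs.
have fs : fresh s.
  apply: freshP => j js; apply/negP => aj.
  by have := smin j; rewrite aj (ltn_trans js sn) leqNgt js; move/(_ isT).
have exe : exists e, (s <= e)%N && ((n <= e)%N || be e).
  by exists n; rewrite leqnn (ltnW sn).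
have [e /andP[se ne] emin] := ex_minnP exe.
have nbe j : (s <= j < e)%N -> ~~ be j.
  move=> /andP[sj je]; apply/negP => bj.
  by have := emin j; rewrite sj bj orbT leqNgt je; move/(_ isT).
have en : (e <= n)%N by apply: emin; rewrite leqnn (ltnW sn).
rewrite (@gain_window s e n)//; first by apply: Pse => //; rewrite se.
move=> k kn; apply: betE => //.
by case/orP: ne => [ne|->]; rewrite ?orbT// (leq_trans kn ne).
Qed.

End Betting.

(** * State of a path stopped at its first high climb *)

Section PathState.
Variable R : realType.

(* Position, running minimum [low], weight [\sum_i expR (low - x i)], running
   maximum, and maximum up to the last time of the running minimum. *)
Record pstate := PState
  { pos : R; low : R; wgt : R; top : R; pretop : R }.

Definition pstart (x0 : R) := PState x0 x0 1 x0 x0.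

(** The weights are relative to the current minimum, so a new minimum first rescales the old sum.
    Only a strictly lower point moves the time of the minimum, and with it [pretop]. *)
Definition pstep (s : pstate) (z : R) : pstate :=
  let l := Num.min (low s) z in
  PState z l (wgt s * expR (l - low s) + expR (l - z)) (Num.max (top s) z)
    (if z < low s then top s else pretop s).

Definition climbing (h : R) (s : pstate) : bool := pos s - low s < h.

Fixpoint run (h : R) (x : nat -> R) (k : nat) : pstate :=
  if k is j.+1 then
    if climbing h (run h x j) then pstep (run h x j) (x j.+1) else run h x j
  else pstart (x 0).

(* [t] is the minimum of [k] and the first time of a climb of height [h]. *)
Record run_data (h : R) (x : nat -> R) (k : nat) (s : pstate) (t b : nat) : Prop :=
  RunData {
  rd_bt : (b <= t)%N;
  rd_tk : (t <= k)%N;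
  rd_stop : climbing h s -> t = k;
  rd_pos : pos s = x t;
  rd_low : low s = x b;
  rd_lowE : forall i, (i <= t)%N -> low s <= x i;
  rd_climb : forall i j, (i <= j < t)%N -> x j - x i < h;
  rd_top : forall i, (i <= t)%N -> x i <= top s;
  rd_topE : exists2 i, (i <= t)%N & x i = top s;
  rd_pre : forall i, (i <= b)%N -> x i <= pretop s;
  rd_preE : exists2 i, (i <= b)%N & x i = pretop s;
  rd_wgt : wgt s = \sum_(i < t.+1) expR (low s - x i) }.

Lemma runP h x k : exists t b, run_data h x k (run h x k) t b.
Proof.
elim: k => [|k [t [b rd]]].
  exists 0%N, 0%N; split=> //=.
  - by move=> i; rewrite leqn0 => /eqP ->.
  - by move=> i j /andP[_]; rewrite ltn0.
  - by move=> i; rewrite leqn0 => /eqP ->.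
  - by exists 0%N.
  - by move=> i; rewrite leqn0 => /eqP ->.
  - by exists 0%N.
  - by rewrite big_ord1 subrr expR0.
rewrite /=; case: ifPn => [cl|ncl]; last first.
  exists t, b; case: rd => *; split=> //; first by apply: leqW.
  by move=> c; rewrite c in ncl.
have tk := rd_stop rd cl; subst t.
set s := run h x k in rd cl *.
have climb' i j : (i <= j < k.+1)%N -> x j - x i < h.
  move=> /andP[ij]; rewrite ltnS leq_eqVlt => /orP[/eqP jk|jk].
    move: cl; rewrite /climbing (rd_pos rd) jk; apply: le_lt_trans.
    by rewrite lerD2l lerN2; apply: (rd_lowE rd); rewrite -jk.
  by apply: (rd_climb rd); rewrite ij jk.
have wgt' l : \sum_(i < k.+2) expR (l - x i) =
    wgt s * expR (l - low s) + expR (l - x k.+1).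
  rewrite big_ord_recr /= (rd_wgt rd) mulr_suml; congr (_ + _).
  by apply: eq_bigr => i _; rewrite -expRD; congr expR; ring.
exists k.+1, (if x k.+1 < low s then k.+1 else b); split=> //=.
- by case: ifP => // _; apply: leqW; exact: rd_bt rd.
- by case: ltP => // _; exact: rd_low rd.
- move=> i; rewrite leq_eqVlt => /orP[/eqP ->|]; first by rewrite ge_min lexx orbT.
  by rewrite ltnS => ik; rewrite ge_min (rd_lowE rd).
- move=> i; rewrite leq_eqVlt => /orP[/eqP ->|]; first by rewrite le_max lexx orbT.
  by rewrite ltnS => ik; rewrite le_max (rd_top rd).
- rewrite maxEle; case: ifP => _; first by exists k.+1.
  by have [i ik <-] := rd_topE rd; exists i => //; exact: leqW.
- case: ifP => [low'|_] i; last by move=> ib; exact: (rd_pre rd).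
  rewrite leq_eqVlt => /orP[/eqP ->|]; last by rewrite ltnS => ik; exact: (rd_top rd).
  (* A new minimum lies below the starting point, so it does not exceed the old maximum. *)
  apply: (le_trans (ltW low')); apply: (@le_trans _ _ (x 0%N)).
    exact: (rd_lowE rd).
  exact: (rd_top rd).
- case: ifP => [_|_]; last exact: rd_preE rd.
  by have [i ik <-] := rd_topE rd; exists i => //; exact: leqW.
Qed.

Lemma run_low_le h x k : low (run h x k) <= pos (run h x k).
Proof.
by have [t [b rd]] := runP h x k; rewrite (rd_pos rd); exact: (rd_lowE rd).
Qed.

End PathState.

(** * The bets on one side and what they exclude *)

Section Side.
Variables (R : realType) (x : nat -> R) (W : nat) (L : R).
Hypothesis x0 : x 0%N = 0.
Hypothesis xL : forall k, `|x k.+1 - x k| <= L.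
Variables (h1 h2 q2 q3 K : R).
Hypotheses (h1_gt0 : 0 < h1) (h12 : h1 <= h2) (q2_gt0 : 0 < q2) (q3_gt0 : 0 < q3)
  (q23 : q2 + q3 + L < h1).

(** Four bets. [deepen] begins at the first climb [h1] and is lost if the minimum is improved before
    the level [h2] above it. [rise] begins at once and is lost if [- q3] comes before [q2]. [drop]
    begins at [q2]; its unwanted outcome is the win, [h1 - q3] before [- q3]. [window] begins at the
    level [z] and is lost if the path comes down to [z - q] before exceeding [z + l]. *)
Definition deepen_start (k : nat) := ~~ climbing h1 (run h1 x k).
Definition deepen_stop (k : nat) :=
  (x k < low (run h1 x k)) || (low (run h1 x k) + h2 <= x k).
Definition rise_stop (k : nat) := (q2 <= x k) || (x k <= - q3).
Definition drop_start (k : nat) := q2 <= x k.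
Definition drop_stop (k : nat) := (h1 - q3 <= x k) || (x k <= - q3).
Definition window_start (z q : R) (k : nat) := (q <= z) && (z <= x k).
Definition window_stop (z q l : R) (k : nat) := (z + l < x k) || (x k <= z - q).

Let L0 : 0 <= L.
Proof. exact: le_trans (normr_ge0 _) (xL 0%N). Qed.

Let xup k : x k.+1 <= x k + L.
Proof. by have := xL k; rewrite ler_norml; lra. Qed.

Let xdn k : x k - L <= x k.+1.
Proof. by have := xL k; rewrite ler_norml; lra. Qed.

Lemma run_stopped h k m : (k <= m)%N ->
  ~~ climbing h (run h x k) -> run h x m = run h x k.
Proof.
move=> /subnK <- ncl; elim: (m - k)%N => // i IH.
by rewrite addSn /= IH (negbTE ncl).
Qed.

Lemma climbing_rd h k t b : run_data h x k (run h x k) t b ->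
  climbing h (run h x k) = (x t - x b < h).
Proof. by move=> rd; rewrite /climbing (rd_pos rd) (rd_low rd). Qed.

Lemma climb_before h k t b i j : run_data h x k (run h x k) t b ->
  (i <= j < k)%N -> climbing h (run h x k) -> x j - x i < h.
Proof. by move=> rd ijk cl; apply: (rd_climb rd); rewrite (rd_stop rd cl). Qed.

Lemma climb_at h k t b i : run_data h x k (run h x k) t b ->
  (i <= k)%N -> climbing h (run h x k) -> x k - x i < h.
Proof.
move=> rd ik cl; have tk := rd_stop rd cl; subst t.
move: (cl); rewrite /climbing (rd_pos rd); apply: le_lt_trans.
by rewrite lerD2l lerN2; exact: (rd_lowE rd).
Qed.

Lemma deepen_startE t b k : run_data h1 x W (run h1 x W) t b ->
  ~~ climbing h1 (run h1 x W) -> (k <= W)%N ->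
  deepen_start k = (t <= k)%N.
Proof.
move=> rd ncl kW; rewrite /deepen_start; have [tk [bk rdk]] := runP h1 x k.
have bt := rd_bt rd.
have [tk'|kt] := leqP t k.
  apply/negP => cl; move: ncl; rewrite (climbing_rd rd) => /negP; apply.
  move: tk'; rewrite leq_eqVlt => /orP[/eqP tk'|tk'].
    by rewrite tk' in bt *; exact: (climb_at rdk).
  by apply: (climb_before rdk) => //; rewrite bt.
apply/negbTE; rewrite negbK; apply: contraT => ncl'.
have e : run h1 x W = run h1 x k := run_stopped kW ncl'.
move: ncl'; rewrite (climbing_rd rdk) => /negP[].
by apply: (rd_climb rd); rewrite (rd_bt rdk) (leq_ltn_trans (rd_tk rdk) kt).
Qed.

Lemma gain_deepen_le n : gain x deepen_start deepen_stop n <= h2 - h1 + L.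
Proof.
apply: (@gain_ind R x _ _ (fun g => g <= h2 - h1 + L)) => [|s e fs ds /andP[se en] ns]; first by move: L0 h12; lra.
have [t [b rd]] := runP h1 x s.
(* The path was still climbing one step before the bet, so the bet begins exactly at the first climb
   [h1]. *)
have ts : t = s.
  case: s fs ds se ns rd => [|s] fs ds se ns rd.
    by have := rd_tk rd; rewrite leqn0 => /eqP.
  have tk := rd_tk rd; apply/eqP; rewrite eqn_leq tk leqNgt; apply/negP => ts.
  have ncl : climbing h1 (run h1 x s).
    by have := fresh_before fs (ltnSn s) => /negbT; rewrite negbK.
  have [t' [b' rd']] := runP h1 x s.
  move: (ds); rewrite /deepen_start (climbing_rd rd) => /negP; apply.
  have bt := rd_bt rd; rewrite ltnS in ts.
  move: ts; rewrite leq_eqVlt => /orP[/eqP ts|ts].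
    by rewrite ts in bt *; exact: (climb_at rd').
  by apply: (climb_before rd') => //; rewrite bt.
have xs : low (run h1 x s) + h1 <= x s.
  move: ds; rewrite /deepen_start /climbing (rd_pos rd) ts -leNgt; lra.
case: e se en ns => [|e] se en ns.
  move: se; rewrite leqn0 => /eqP ->; move: L0 h12; lra.
move: se; rewrite leq_eqVlt => /orP[/eqP <-|se]; first by move: L0 h12; lra.
have := ns e; rewrite -ltnS se leqnn => /(_ isT).
rewrite /deepen_stop negb_or -!ltNge (run_stopped _ ds)// => /andP[_ xe].
have := xup e; lra.
Qed.

(** A point below the minimum [v] before the climb [h2] would come after the end of the bet. The bet
    would have ended either below [v], at a loss of more than [h1], or above [v + h2], which would
    already be a climb [h2]. *)
Lemma low_deepen :
  ~~ climbing h2 (run h2 x W) ->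
  - h1 < gain x deepen_start deepen_stop W ->
  [/\ ~~ climbing h1 (run h1 x W), low (run h2 x W) = low (run h1 x W) &
    forall t1 b1 t2 b2, run_data h1 x W (run h1 x W) t1 b1 ->
      run_data h2 x W (run h2 x W) t2 b2 -> (t1 <= t2)%N].
Proof.
move=> ncl2 g.
have [t1 [b1 rd1]] := runP h1 x W; have [t2 [b2 rd2]] := runP h2 x W.
have bt1 := rd_bt rd1; have bt2 := rd_bt rd2.
have tW1 := rd_tk rd1; have tW2 := rd_tk rd2.
move: (ncl2); rewrite (climbing_rd rd2) -leNgt => c2.
have ncl1 : ~~ climbing h1 (run h1 x W).
  apply/negP => cl; move: c2; apply/negP; rewrite -ltNge; apply: lt_le_trans h12.
  move: tW2; rewrite leq_eqVlt => /orP[/eqP e|tW2'].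
    by rewrite e in bt2 *; exact: (climb_at rd1).
  by apply: (climb_before rd1) => //; rewrite bt2.
have t12 u1 v1 u2 v2 : run_data h1 x W (run h1 x W) u1 v1 ->
    run_data h2 x W (run h2 x W) u2 v2 -> (u1 <= u2)%N.
  move=> r1 r2; rewrite leqNgt; apply/negP => lt.
  move: (ncl2); rewrite (climbing_rd r2) => /negP; apply; apply: lt_le_trans h12.
  by apply: (rd_climb r1); rewrite (rd_bt r2).
split=> //; have tt := t12 _ _ _ _ rd1 rd2.
move: (ncl1); rewrite (climbing_rd rd1) -leNgt => c1.
set v := low (run h1 x W).
have vb : v = x b1 := rd_low rd1.
have ds k : (k <= W)%N -> deepen_start k = (t1 <= k)%N.
  by move=> kW; exact: deepen_startE rd1 ncl1 kW.
have runE k : (t1 <= k <= W)%N -> run h1 x k = run h1 x W.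
  move=> /andP[tk kW]; have [t' [b' rd']] := runP h1 x k.
  by rewrite (run_stopped kW)//; have := ds k kW; rewrite tk.
have above j : (j <= t2)%N -> v <= x j.
  move=> jt2; have [jt1|tj] := leqP j t1; first exact: (rd_lowE rd1).
  rewrite leNgt; apply/negP => xj.
  have jW : (j <= W)%N := leq_trans jt2 tW2.
  have sj : deepen_stop j by rewrite /deepen_stop runE ?xj// ltnW.
  have [|e /andP[te se] emin] := ex_minnP (P := fun e => (t1 <= e)%N && deepen_stop e).
    by exists j; rewrite (ltnW tj).
  have ej : (e <= j)%N by apply: emin; rewrite (ltnW tj).
  have eW := leq_trans ej jW.
  have ge : gain x deepen_start deepen_stop W = x e - x t1.
    apply: gain_stop => //.
    - apply: freshP => i it; rewrite (ds _ (leq_trans (ltnW it) tW1)).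
      by rewrite -ltnNge.
    - by rewrite ds.
    - by rewrite te.
    - move=> i /andP[ti ie]; apply/negP => si.
      by have := emin i; rewrite ti si leqNgt ie => /(_ isT).
  move: se; rewrite /deepen_stop runE ?te// -/v => /orP[h|h].
    by move: g; rewrite ge; lra.
  have ej' : (e < j)%N.
    rewrite ltn_neqAle ej andbT; apply/eqP => e1; move: h xj; rewrite e1.
    move: h12 h1_gt0; lra.
  have := rd_climb rd2 (i := b1) (j := e).
  rewrite (leq_trans bt1 te) (leq_trans ej' jt2) => /(_ isT).
  by move: h; rewrite vb; lra.
apply/eqP; rewrite eq_le; apply/andP; split.
  rewrite vb; apply: (rd_lowE rd2); exact: leq_trans bt1 tt.
by rewrite (rd_low rd2) above.
Qed.

Lemma gain_rise_le n : gain x xpredT rise_stop n <= q2 + L.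
Proof.
apply: (@gain_ind R x _ _ (fun g => g <= q2 + L)) => [|s e fs _ /andP[se en] ns]; first by move: L0 q2_gt0; lra.
have s0 : s = 0%N by case: s fs se ns => //= s /andP[].
subst s; rewrite x0 subr0; case: e se en ns => [|e] se en ns.
  by rewrite x0; move: L0 q2_gt0; lra.
have := ns e; rewrite leq0n ltnS leqnn => /(_ isT).
rewrite /rise_stop negb_or -!ltNge => /andP[xe _]; have := xup e; lra.
Qed.

Let first_drop s : fresh drop_start s -> drop_start s -> q2 <= x s <= q2 + L.
Proof.
case: s => [|s] fs ds.
  by move: ds; rewrite /drop_start x0; move: q2_gt0; lra.
have := fresh_before fs (ltnSn s); move: ds; rewrite /drop_start => -> /negbT.
by rewrite -ltNge => h; have := xup s; lra.
Qed.

Lemma gain_drop_ge n : - (q2 + q3 + 2 * L) <= gain x drop_start drop_stop n.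
Proof.
apply: (@gain_ind R x _ _ (fun g => - (q2 + q3 + 2 * L) <= g)) => [|s e fs ds /andP[se en] ns].
  by move: L0 q2_gt0 q3_gt0; lra.
have xs := first_drop fs ds; case: e se en ns => [|e] se en ns.
  by move: se; rewrite leqn0 => /eqP ->; rewrite subrr; move: L0 q2_gt0 q3_gt0; lra.
move: se; rewrite leq_eqVlt => /orP[/eqP <-|se].
  by rewrite subrr; move: L0 q2_gt0 q3_gt0; lra.
have := ns e; rewrite -ltnS se leqnn => /(_ isT).
rewrite /drop_stop negb_or -!ltNge => /andP[_ xe]; have := xdn e; lra.
Qed.

(** Otherwise [q2], which the path reaches before [- q3], is reached only after the bottom. The
    bottom then lies above [- q3], and the path goes on from [q2] to [h1 - q3] without meeting
    [- q3]: the [drop] bet is won. *)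
Lemma pretop_ge :
  ~~ climbing h1 (run h1 x W) ->
  - q3 < gain x xpredT rise_stop W ->
  gain x drop_start drop_stop W < h1 - q3 - q2 - L ->
  q2 <= pretop (run h1 x W).
Proof.
move=> ncl g1 g2; rewrite leNgt; apply/negP => Mq.
have [t [b rd]] := runP h1 x W; have bt := rd_bt rd; have tW := rd_tk rd.
move: (ncl); rewrite (climbing_rd rd) -leNgt => c.
have [|e se emin] := ex_minnP (P := rise_stop).
  have [h|h] := ltP (x b) (- q3); first by exists b; rewrite /rise_stop (ltW h) orbT.
  by exists t; rewrite /rise_stop; apply/orP; left; move: q23 L0; lra.
have et : (e <= t)%N.
  have [h|h] := leP (x b) (- q3).
    by apply: leq_trans bt; apply: emin; rewrite /rise_stop h orbT.
  by apply: emin; rewrite /rise_stop; apply/orP; left; move: q23 L0; lra.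
have ge : gain x xpredT rise_stop W = x e.
  rewrite (@gain_stop _ _ _ _ 0 e)//; first by rewrite x0 subr0.
    by rewrite (leq_trans et tW).
  move=> j /= je; apply/negP => sj.
  by have := emin j sj; rewrite leqNgt je.
have qe : q2 <= x e.
  by move: se; rewrite /rise_stop => /orP[//|h]; move: g1; rewrite ge; lra.
have nstop j : (j < e)%N -> x j < q2 /\ - q3 < x j.
  move=> je; have : ~~ rise_stop j.
    by apply/negP => sj; have := emin j sj; rewrite leqNgt je.
  by rewrite /rise_stop negb_or -!ltNge => /andP[].
have be : (b < e)%N.
  rewrite ltnNge; apply/negP => eb.
  by have := rd_pre rd eb; lra.
have xb := (nstop _ be).2.
have xl j : (j <= t)%N -> - q3 < x j.
  by move=> jt; apply: lt_le_trans xb _; rewrite -(rd_low rd); exact: (rd_lowE rd).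
have [|f /andP[ef sf] fmin] := ex_minnP (P := fun f => (e <= f)%N && drop_stop f).
  by exists t; rewrite et /drop_stop; apply/orP; left; lra.
have ft : (f <= t)%N.
  by apply: fmin; rewrite et /drop_stop; apply/orP; left; lra.
have fe : fresh drop_start e.
  by apply: freshP => j je; rewrite /drop_start -ltNge; have [] := nstop _ je.
have gf : gain x drop_start drop_stop W = x f - x e.
  apply: gain_stop => //; first by rewrite ef (leq_trans ft tW).
  move=> j /andP[ej jf]; apply/negP => sj.
  by have := fmin j; rewrite ej sj leqNgt jf => /(_ isT).
have := first_drop fe qe; have := xl f ft.
by move: sf g2; rewrite gf /drop_stop => /orP[]; lra.
Qed.

Lemma gain_window_le z q l n : 0 <= l ->
  gain x (window_start z q) (window_stop z q l) n <= l + L.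
Proof.
move=> l0; apply: (@gain_ind R x _ _ (fun g => g <= l + L)) => [|s e fs ds /andP[se en] ns]; first by move: L0; lra.
move: ds; rewrite /window_start => /andP[_ zs].
case: e se en ns => [|e] se en ns.
  by move: se; rewrite leqn0 => /eqP ->; rewrite subrr; move: L0; lra.
move: se; rewrite leq_eqVlt => /orP[/eqP <-|se].
  by rewrite subrr; move: L0; lra.
have := ns e; rewrite -ltnS se leqnn => /(_ isT).
rewrite /window_stop negb_or -!leNgt => /andP[xe _]; have := xup e; lra.
Qed.

(** The bottom is at a level at most 0, hence at most [z - q]. With a maximum between [z] and
    [z + l] before it, the bet opened at [z] would end no later than the bottom, at a loss of at
    least [q]. *)
Lemma pretop_window z q l : 0 < q -> q <= z ->
  - q < gain x (window_start z q) (window_stop z q l) W ->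
  z <= pretop (run h1 x W) -> z + l < pretop (run h1 x W).
Proof.
move=> q0 qz g zM; rewrite ltNge; apply/negP => Mz.
have [t [b rd]] := runP h1 x W; have bt := rd_bt rd; have tW := rd_tk rd.
have [i ib xi] := rd_preE rd.
have [|s ss smin] := ex_minnP (P := window_start z q).
  by exists i; rewrite /window_start qz xi.
have si : (s <= i)%N by apply: smin; rewrite /window_start qz xi.
have stop_b : window_stop z q l b.
  rewrite /window_stop; apply/orP; right; rewrite -(rd_low rd).
  by have := rd_lowE rd (leq0n t); rewrite x0; lra.
have [|e /andP[se be] emin] := ex_minnP (P := fun e => (s <= e)%N && window_stop z q l e).
  by exists b; rewrite stop_b (leq_trans si ib).
have eb : (e <= b)%N by apply: emin; rewrite stop_b (leq_trans si ib).
have ge : gain x (window_start z q) (window_stop z q l) W = x e - x s.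
  apply: gain_stop => //.
  - by apply: freshP => j js; apply/negP => sj; have := smin j sj; rewrite leqNgt js.
  - by rewrite se (leq_trans eb (leq_trans bt tW)).
  - move=> j /andP[sj je]; apply/negP => bj.
    by have := emin j; rewrite sj bj leqNgt je => /(_ isT).
move: g; rewrite ge; move: ss; rewrite /window_start => /andP[_ zs].
move: be; rewrite /window_stop => /orP[h|h]; last lra.
by have := rd_pre rd eb; lra.
Qed.

(* [v] is the depth of the valley with bottom [b], which is first climbed to
   the height [h1] at [t1] and to the height [h2] at [t2]. *)
Record side_valley (v M : R) (t1 t2 b : nat) : Prop := SideValley {
  sv_bt1 : (b <= t1)%N;
  sv_t12 : (t1 <= t2)%N;
  sv_t2W : (t2 <= W)%N;
  sv_v : x b = v;
  sv_low : forall i, (i <= t2)%N -> v <= x i;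
  sv_h1 : v + h1 <= x t1;
  sv_h2 : v + h2 <= x t2;
  sv_climb : forall i j, (i <= j < t1)%N -> x j - x i < h1;
  sv_M : forall i, (i <= b)%N -> x i <= M;
  sv_ME : exists2 i, (i <= b)%N & x i = M;
  sv_M0 : q2 <= M;
  sv_sum : \sum_(i < t2.+1) expR (v - x i) <= K }.

Lemma side_valleyP :
  ~~ climbing h2 (run h2 x W) ->
  wgt (run h2 x W) <= K ->
  - h1 < gain x deepen_start deepen_stop W ->
  - q3 < gain x xpredT rise_stop W ->
  gain x drop_start drop_stop W < h1 - q3 - q2 - L ->
  exists t1 t2 b, side_valley (low (run h1 x W)) (pretop (run h1 x W)) t1 t2 b.
Proof.
move=> ncl2 wK g1 g2 g3.
have [ncl1 lowE t12] := low_deepen ncl2 g1.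
have [t1 [b1 rd1]] := runP h1 x W; have [t2 [b2 rd2]] := runP h2 x W.
exists t1, t2, b1; split.
- exact: rd_bt rd1.
- exact: t12 rd1 rd2.
- exact: rd_tk rd2.
- by rewrite (rd_low rd1).
- by move=> i it; rewrite -lowE; exact: (rd_lowE rd2).
- by move: ncl1; rewrite (climbing_rd rd1) -leNgt (rd_low rd1); lra.
- by move: ncl2; rewrite (climbing_rd rd2) -leNgt -lowE (rd_low rd2); lra.
- exact: rd_climb rd1.
- by move=> i ib; exact: (rd_pre rd1).
- exact: rd_preE rd1.
- exact: pretop_ge.
- by rewrite -lowE -(rd_wgt rd2).
Qed.

End Side.

(** * From the potential to the walk *)

Section Potential.
Variables (R : realType) (w : int -> R).
Hypothesis w01 : forall x, 0 < w x < 1.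

Definition xi (w : int -> R) (x : int) : R := ln (rho w x).

Definition side_path (w : int -> R) (k : nat) : R := \sum_(i < k) xi w i.+1%:Z.

Definition potential : int -> R := prim (fun x => xi w (x + 1)).

Lemma reflect_env01 x : 0 < reflect_env w x < 1.
Proof. by rewrite /reflect_env; have := w01 (- x); lra. Qed.

Lemma reflect_envK : reflect_env (reflect_env w) = w.
Proof. by apply/funext => x; rewrite /reflect_env opprK subKr. Qed.

Lemma rho_gt0 x : 0 < rho w x.
Proof. by have /andP[h1 h2] := w01 x; rewrite divr_gt0// subr_gt0. Qed.

Lemma xi_reflect x : xi (reflect_env w) x = - xi w (- x).
Proof.
rewrite /xi -lnV ?posrE ?rho_gt0//; congr ln.
by rewrite /rho /reflect_env subKr invf_div.
Qed.

Lemma side_pathS w' k : side_path w' k.+1 = side_path w' k + xi w' k.+1%:Z.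
Proof. by rewrite /side_path big_ord_recr. Qed.

Lemma potential_pos k : potential (Posz k) = side_path w k.
Proof. by rewrite /potential /side_path /=; apply: eq_bigr => i _; rewrite -PoszD addn1. Qed.

Lemma potentialE x : potential (x + 1) = potential x + xi w (x + 1).
Proof. exact: primS. Qed.

(** [potential x] belongs to the edge between [x] and [x + 1]. The mirror image of the edge starting
    at [k] starts at [- k - 1], that is at [Negz k]. The increment of the site 0 belongs to neither
    side path; it is the source of the terms [L] in the estimates that compare both sides. *)
Lemma potential_neg k : potential (Negz k) = side_path (reflect_env w) k - xi w 0.
Proof.
elim: k => [|k IH].
  by rewrite /potential /side_path /= big_ord0 big_ord1 /= add0r.
have := potentialE (Negz k.+1); have -> : Negz k.+1 + 1 = Negz k by rewrite !NegzE; lia.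
rewrite IH side_pathS xi_reflect => /eqP; rewrite -subr_eq => /eqP <-.
have -> : - k.+1%:Z = Negz k by rewrite NegzE.
by ring.
Qed.

Lemma expR_potential x :
  (1 - w x) * expR (potential (x - 1)) = w x * expR (potential x).
Proof.
have := potentialE (x - 1); rewrite subrK => ->.
rewrite expRD /xi lnK ?posrE ?rho_gt0// /rho.
have /andP[w0 _] := w01 x; field; by rewrite gt_eqF.
Qed.

End Potential.

(** * The walk to the bottom of the right side *)

Section RightTarget.
Variables (R : realType) (w : int -> R) (L : R).
Hypothesis w01 : forall x, 0 < w x < 1.
Hypothesis xiL : forall x, `|xi w x| <= L.
Variables (W : nat) (h1 h2 q2 K eta : R).
Hypotheses (q2_gt0 : 0 < q2) (K_gt0 : 0 < K) (etaL : 2 * L <= eta).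
Variables (v M : R) (t1 t2 b : nat).
Hypothesis sv : side_valley (side_path w) W h1 h2 q2 K v M t1 t2 b.
Variables (N n0 : nat).
Hypotheses (Nh2 : N%:R * expR (L - h2) <= 1 / 2)
  (Weta : (2 * W).+1%:R * expR (- (eta / 2)) <= 1 / 4)
  (Wh1 : 8 * (2 * W).+1%:R ^+ 2 * expR (h1 + L) <= n0%:R).

Let V := potential w.
Let E x := expR (V x).
Let xl := side_path (reflect_env w).
Let L0 : 0 <= L.
Proof. exact: le_trans (normr_ge0 _) (xiL 0). Qed.

Let Vneg i : V (Negz i) = xl i - xi w 0.
Proof. exact: potential_neg. Qed.

Let Vpos i : V (Posz i) = side_path w i.
Proof. exact: potential_pos. Qed.

Let xi0 : - L <= xi w 0 <= L.
Proof. by rewrite -ler_norml. Qed.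

Let path_le k : side_path w k <= k%:R * L.
Proof.
elim: k => [|k IH]; first by rewrite /side_path big_ord0 mul0r.
have := xiL k.+1%:Z; rewrite side_pathS ler_norml.
have -> : k.+1%:R * L = k%:R * L + L by rewrite -addn1 natrD mulrDl mul1r.
by move: IH; lra.
Qed.

Let xl_le k : xl k <= k%:R * L.
Proof.
elim: k => [|k IH]; first by rewrite /xl /side_path big_ord0 mul0r.
have := xiL (- k.+1%:Z); rewrite /xl side_pathS xi_reflect// ler_norml -/xl.
have -> : k.+1%:R * L = k%:R * L + L by rewrite -addn1 natrD mulrDl mul1r.
by move: IH; lra.
Qed.

Let V_le (k : int) : V k <= `|k|%N%:R * L.
Proof.
case: k => [k|k]; first by rewrite Vpos; exact: path_le.
have -> : `|Negz k|%N%:R * L = k%:R * L + L by rewrite /= -addn1 natrD mulrDl mul1r.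
by rewrite Vneg; have := xl_le k; move: xi0; lra.
Qed.

(* [-1 - ia] is the barrier that keeps the walk from going left before it hits
   [b], and [-1 - ja] is the left wall of the valley. *)
Lemma right_target (ia ja : nat) (y : int) :
  (ia <= W)%N ->
  M + eta <= xl ia ->
  (forall i, (i <= ia)%N -> M - h1 <= xl i) ->
  (forall i j, (i <= j <= ia)%N -> xl i - xl j <= h1) ->
  v + h2 <= xl ja ->
  \sum_(i < ja.+1) expR (v - xl i) <= K ->
  `|y|%N%:R * L <= eta / 2 - L -> `|y|%N%:R * L < q2 ->
  forall n : nat, (0 < n)%N -> (n0 <= n <= N)%N -> (2 %| y - b%:Z + n%:Z)%Z ->
    1 / (16 * K * (expR L + 1)) <= kern w n b%:Z y.
Proof.
move=> iaW Mia Mlow climbl vja sumja yeta yq2.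
have [bt1 t12 t2W xb low xt1 xt2 climb Mge [im imb imM] M0 sumK] := sv.
have bW : (b <= W)%N := leq_trans bt1 (leq_trans t12 t2W).
have Mpos : 0 <= M by rewrite (le_trans (ltW q2_gt0)).
have E0 x : 0 < E x by exact: expR_gt0.
have wE : forall x, (1 - w x) * E (x - 1) = w x * E x := expR_potential w01.
have Vb : V b%:Z = v by rewrite Vpos.
have aV : M + eta - L <= V (Negz ia) by rewrite Vneg; move: xi0; lra.
(* The path reaches the height [M >= q2] within [b] steps of size at most [L], whereas
   [|y| L < q2]. *)
have yb : y < b%:Z.
  rewrite ltNge; apply/negP => byy.
  have : side_path w im <= b%:R * L.
    apply: (le_trans (path_le im)); apply: ler_wpM2r => //.
    by rewrite ler_nat.
  rewrite imM => Mb; have : b%:R * L <= `|y|%N%:R * L.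
    by apply: ler_wpM2r => //; rewrite ler_nat; move: byy; clear; lia.
  by move: Mb yq2 M0; lra.
have ay : Negz ia <= y.
  rewrite leNgt; apply/negP => ya.
  have : `|Negz ia|%N%:R * L <= `|y|%N%:R * L.
    by apply: ler_wpM2r => //; rewrite ler_nat; move: ya; rewrite NegzE; clear; lia.
  by have := V_le (Negz ia); move: aV M0 q2_gt0 yeta etaL L0; lra.
(* Up to [expR (- v)], the conductances add up to at most [K] on the right and [expR L * K] on the
   left; [revm] counts each edge at both of its ends, which gives the factor 2. *)
have -> : 1 / (16 * K * (expR L + 1)) = 1 / (8 * (2 * (expR L * K + K))).
  by congr (_ / _); ring.
apply: (@valley_bound R w E w01 E0 wE (Negz ja) (Negz ia) b%:Z t2%:Z y
   (2 * W).+1 N n0 (expR (L - h2)) (expR (h1 + L)) (expR (- (eta / 2)))) => //.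
- by rewrite lez_nat; exact: leq_trans bt1 t12.
- rewrite /E -expRD ler_expR Vb Vneg; move: xi0; lra.
- rewrite /E -expRD ler_expR Vb Vpos; move: L0; lra.
- by rewrite mulr_gt0// addr_gt0// mulr_gt0// expR_gt0.
- pose F x := (E x)^-1.
  have F0 x : 0 <= F x by rewrite /F invr_ge0 ltW.
  have FE x : F x = expR (- v) * expR (v - V x).
    by rewrite /F /E -expRN -expRD; congr expR; ring.
  have tot : prim F (t2%:Z + 1) - prim F (Negz ja) <= expR (- v) * (expR L * K + K).
    rewrite -PoszD addn1 /= opprK addrC mulrDr; apply: lerD.
      have -> : expR (- v) * (expR L * K) = expR (- v) * expR L * K by rewrite mulrA.
      apply: le_trans (ler_wpM2l _ sumja); last by rewrite mulr_ge0 ?expR_ge0.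
      rewrite mulr_sumr; apply: ler_sum => i _.
      rewrite FE -mulrA; apply: ler_wpM2l; first exact: expR_ge0.
      by rewrite -expRD ler_expR Vneg; move: xi0; lra.
    apply: le_trans (ler_wpM2l (expR_ge0 _) sumK).
    by rewrite mulr_sumr; apply: ler_sum => i _; rewrite FE Vpos.
  have sitesE (G : int -> R) : \sum_(x <- sites (Negz ja) t2%:Z) G x =
      prim G (t2%:Z + 1) - prim G (Negz ja + 1).
    have -> : t2%:Z + 1 = Negz ja + 1 + `|t2%:Z - Negz ja|%N%:Z.
      by rewrite NegzE; clear; lia.
    rewrite primB /sites big_map -[X in iota 0 X]subn0 -/(index_iota _ _) big_mkord.
    by [].
  have -> : \sum_(x <- sites (Negz ja) t2%:Z) revm E x =
     \sum_(x <- sites (Negz ja) t2%:Z) F x + \sum_(x <- sites (Negz ja) t2%:Z) F (x - 1).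
    by rewrite -big_split.
  (* The second sum is the first one moved by one site, so their primitives agree up to a
     constant. *)
  have shift x : prim (fun x => F (x - 1)) (x + 1) - prim F x =
      prim (fun x => F (x - 1)) 1 - prim F 0.
    have st z : prim (fun x => F (x - 1)) (z + 1 + 1) - prim F (z + 1) =
                prim (fun x => F (x - 1)) (z + 1) - prim F z.
      by rewrite primS [prim F (z + 1)]primS addrK; ring.
    case: x => k; elim: k => [|k IH].
    + by rewrite add0r.
    + by rewrite -[k.+1]addn1 PoszD st.
    + by have := st (Negz 0); have -> : Negz 0 + 1 = 0 by []; move=> <-; rewrite add0r.
    + rewrite -IH -st; have -> : Negz k.+1 + 1 = Negz k by rewrite !NegzE; clear; lia.
      by [].
  rewrite !sitesE.
  have m1 : prim F (Negz ja) <= prim F (Negz ja + 1) by rewrite primS lerDl.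
  have m2 : prim F t2%:Z <= prim F (t2%:Z + 1) by rewrite primS lerDl.
  have s1 := shift t2%:Z; have s2 := shift (Negz ja).
  have rb : expR (- v) <= revm E b%:Z.
    by rewrite /revm /E -!expRN Vb lerDl expR_ge0.
  apply: (@le_trans _ _ (2 * (expR (- v) * (expR L * K + K)))); first lra.
  rewrite mulrCA [leRHS]mulrC; apply: ler_wpM2r => //.
  by rewrite mulr_ge0// addr_ge0 ?mulr_ge0 ?expR_ge0// ltW.
- by rewrite ay.
- by move: iaW bW; rewrite NegzE; clear; lia.
(* A climb that crosses the origin is at most [M] minus the lowest value of the left path up to the
   barrier, which [Mlow] bounds from below. *)
- move=> l k al lk kb; rewrite /E -expRD ler_expR.
  case: l al lk => [l|l] al; case: k kb => [k|k] kb lk.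
  + rewrite !Vpos; have := climb l k; rewrite -lez_nat lk.
    have -> : (k < t1)%N by move: kb bt1; clear; lia.
    by move=> /(_ isT); move: L0; lra.
  + by move: lk; rewrite NegzE; clear; lia.
  + rewrite Vpos Vneg; have := Mge k; have -> : (k <= b)%N by move: kb; clear; lia.
    move=> /(_ isT); have := Mlow l; have -> : (l <= ia)%N by move: al; rewrite !NegzE; clear; lia.
    by move=> /(_ isT); move: xi0; lra.
  + rewrite !Vneg; have := climbl k l.
    have -> : (k <= l <= ia)%N by move: al lk; rewrite !NegzE; clear; lia.
    by move=> /(_ isT); move: L0; lra.
(* Between [y] and [b] the potential is at most [M] on the right and [eta / 2 - L] on the left,
   while the barrier is at least [M + eta - L]. *)
- move=> k /andP[yk kb]; rewrite /E -expRD ler_expR.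
  case: k yk kb => [k|k] yk kb.
    rewrite Vpos; have := Mge k; have -> : (k <= b)%N by move: kb; clear; lia.
    by move=> /(_ isT); move: aV etaL; lra.
  have : `|Negz k|%N%:R * L <= `|y|%N%:R * L.
    by apply: ler_wpM2r => //; rewrite ler_nat; move: yk; rewrite NegzE; clear; lia.
  by have := V_le (Negz k); move: aV; lra.
Qed.

End RightTarget.

(** * Choice between the two bottoms *)

Section Target.
Variables (R : realType) (L : R) (W : nat) (h1 h2 q2 K eta : R) (N n0 : nat).
Hypotheses (h1_gt0 : 0 < h1) (q2_gt0 : 0 < q2) (K_gt0 : 0 < K) (L_ge0 : 0 <= L)
  (etaL : 2 * L <= eta)
  (Nh2 : N%:R * expR (L - h2) <= 1 / 2)
  (Weta : (2 * W).+1%:R * expR (- (eta / 2)) <= 1 / 4)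
  (Wh1 : 8 * (2 * W).+1%:R ^+ 2 * expR (h1 + L) <= n0%:R)
  (Wh12 : W.+1%:R * expR (h1 - h2) <= K).

Definition target (w : int -> R) (b : int) : Prop :=
  forall y : int, `|y|%N%:R * L <= eta / 2 - L -> `|y|%N%:R * L < q2 ->
  forall n : nat, (0 < n)%N -> (n0 <= n <= N)%N -> (2 %| y - b + n%:Z)%Z ->
    1 / (16 * K * (expR L + 1)) <= kern w n b y.

Lemma target_reflect w b : target (reflect_env w) b -> target w (- b).
Proof.
move=> tb y y1 y2 n n1 n2 par.
have := tb (- y); rewrite abszN => /(_ y1 y2 n n1 n2).
rewrite kern_reflect opprK; apply; move: par; clear; lia.
Qed.

(* The left maximum [M'] exceeds the right one, so the walk descends first to
   the right bottom; it stays there unless the left bottom is deeper and [M']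
   too low to hold it, in which case it moves on to the left bottom. *)
Lemma target_half (w : int -> R) v M t1 t2 b v' M' u1 u2 b' :
  (forall x, 0 < w x < 1) -> (forall x, `|xi w x| <= L) ->
  side_valley (side_path w) W h1 h2 q2 K v M t1 t2 b ->
  side_valley (side_path (reflect_env w)) W h1 h2 q2 K v' M' u1 u2 b' ->
  M + eta <= M' -> (M' <= v + h1 - eta) || (v + h2 <= M') ->
  exists b0, target w b0.
Proof.
move=> w01 xiL sv sl MM alt.
have eta0 : 0 <= eta by move: etaL L_ge0; lra.
have [bt1 t12 t2W xb low xt1 xt2 climb Mge [im imb imM] M0 sumK] := sv.
have [bu1 u12 u2W xb' low' xu1 xu2 climb' Mge' [ia iab iaM] M0' sumK'] := sl.
have bu1' : (b' < u1)%N.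
  by rewrite ltn_neqAle bu1 andbT; apply/eqP => e; move: xu1; rewrite -e xb'; move: h1_gt0; lra.
have bt1' : (b < t1)%N.
  by rewrite ltn_neqAle bt1 andbT; apply/eqP => e; move: xt1; rewrite -e xb; move: h1_gt0; lra.
have iaW : (ia <= W)%N by move: iab bu1 u12 u2W; clear; lia.
(* The maximum [M'] is attained before the first climb [h1], so no earlier point lies [h1] below
   it. *)
have near_top i : (i <= ia)%N -> M' - h1 <= side_path (reflect_env w) i.
  move=> iia; have := climb' i ia; rewrite iia (leq_ltn_trans iab bu1') => /(_ isT).
  by rewrite iaM; lra.
have A1 i : (i <= ia)%N -> M - h1 <= side_path (reflect_env w) i.
  by move=> /near_top; move: MM eta0; lra.
have A2 i j : (i <= j <= ia)%N ->
    side_path (reflect_env w) i - side_path (reflect_env w) j <= h1.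
  move=> /andP[ij jia]; have := near_top j jia.
  by have := Mge' i (leq_trans ij (leq_trans jia iab)); lra.
have MM1 : M + eta <= side_path (reflect_env w) ia by rewrite iaM.
(* If the right bottom is at least as deep, the end of the left climb [h2] is the left wall, and the
   sum over the left path only decreases when [v'] is replaced by [v]. *)
have [vv|vv] := leP v v'.
  exists b%:Z => y y1 y2.
  apply: (right_target w01 xiL q2_gt0 K_gt0 etaL sv Nh2 Weta Wh1 (ia := ia) (ja := u2)) => //.
    by move: xu2 vv; lra.
  apply: le_trans sumK'; apply: ler_sum => i _.
  by rewrite ler_expR lerD2r.
(* If [M'] is high enough, its place is the left wall, and each term of the sum up to it is at most
   [expR (h1 - h2)]. *)
have [vM|vM] := leP (v + h2) M'.
  exists b%:Z => y y1 y2.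
  apply: (right_target w01 xiL q2_gt0 K_gt0 etaL sv Nh2 Weta Wh1 (ia := ia) (ja := ia)) => //.
    by rewrite iaM.
  apply: le_trans Wh12; apply: (@le_trans _ _ (\sum_(i < ia.+1) expR (h1 - h2))).
    apply: ler_sum => i _; rewrite ler_expR.
    by have := near_top i (ltn_ord i); move: vM; lra.
  rewrite sumr_const card_ord -[leLHS]mulr_natl; apply: ler_wpM2r.
    exact: expR_ge0.
  by rewrite ler_nat.
have {}alt : M' <= v + h1 - eta.
  by case/orP: alt => // h; move: vM; rewrite ltNge h.
(* In the mirror the barrier is the end [t1] of the climb [h1] on the right, and the wall is the end
   [t2] of the climb [h2]. The right path is run backwards, so [climb1] bounds its descents. *)
exists (- b'%:Z); apply: target_reflect => y y1 y2.
have xiL' x : `|xi (reflect_env w) x| <= L by rewrite xi_reflect// normrN.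
have climb1 i j : (i <= j <= t1)%N -> side_path w i - side_path w j <= h1.
  move=> /andP[ij jt]; have lowj : v <= side_path w j := low j (leq_trans jt t12).
  have [ib|bi] := leqP i b.
    by have := Mge i ib; move: MM alt lowj; lra.
  move: jt; rewrite leq_eqVlt => /orP[/eqP jt|jt].
    move: ij; rewrite leq_eqVlt => /orP[/eqP ->|ij]; first by rewrite subrr ltW.
    have := climb b i; rewrite (ltnW bi) -jt ij => /(_ isT).
    by rewrite xb; move: lowj; lra.
  have := climb b i; rewrite (ltnW bi) (leq_ltn_trans ij jt) => /(_ isT).
  by rewrite xb; move: lowj; lra.
apply: (right_target (reflect_env01 w01) xiL' q2_gt0 K_gt0 etaL sl Nh2 Weta Wh1
   (ia := t1) (ja := t2)) => //; rewrite ?reflect_envK//.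
- exact: leq_trans t12 t2W.
- by move: xt1 alt; lra.
- by move=> i it; have := low i (leq_trans it t12); move: alt eta0; lra.
- by move: xt2 vv; lra.
- apply: le_trans sumK; apply: ler_sum => i _.
  by rewrite ler_expR lerD2r ltW.
Qed.

Lemma target_exists (w : int -> R) v M t1 t2 b v' M' u1 u2 b' :
  (forall x, 0 < w x < 1) -> (forall x, `|xi w x| <= L) ->
  side_valley (side_path w) W h1 h2 q2 K v M t1 t2 b ->
  side_valley (side_path (reflect_env w)) W h1 h2 q2 K v' M' u1 u2 b' ->
  (M + eta <= M') || (M' + eta <= M) ->
  (M' <= v + h1 - eta) || (v + h2 <= M') ->
  (M <= v' + h1 - eta) || (v' + h2 <= M) ->
  exists b0, target w b0.
Proof.
move=> w01 xiL sv sl /orP[MM|MM] alt alt'; first exact: (target_half w01 xiL sv sl MM alt).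
have xiL' x : `|xi (reflect_env w) x| <= L by rewrite xi_reflect// normrN.
rewrite -(reflect_envK w) in sv.
have [b0 tb] := target_half (reflect_env01 w01) xiL' sl sv MM alt'.
by exists (- b0); exact: target_reflect.
Qed.

End Target.

(** * Independence and fair games *)

Section BoundedExpectation.
Context (R : realType) (d : measure_display) (Omega : measurableType d)
  (P : probability Omega R).

(** Bounded measurable functions: stable under the operations below and integrable, so the rules for
    expectations hold without further side conditions. *)
Definition bmf (f : Omega -> R) : Prop :=
  measurable_fun setT f /\ exists M, forall t, `|f t| <= M.

Definition Ex (f : Omega -> R) : R := \int[P]_t f t.

Lemma bmf_integrable f : bmf f -> P.-integrable setT (EFin \o f).
Proof.
move=> [mf [M fM]]; apply: measurable_bounded_integrable => //.
  by apply: (le_lt_trans (probability_le1 P measurableT)); rewrite ltry.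
exists M; split; first exact: num_real.
by move=> x Mx y _; apply: le_trans (fM y) (ltW Mx).
Qed.

Lemma bmf_cst c : bmf (fun=> c).
Proof. by split; [exact: measurable_cst|exists `|c|]. Qed.

Lemma bmfD f g : bmf f -> bmf g -> bmf (fun t => f t + g t).
Proof.
move=> [mf [M fM]] [mg [N gN]]; split; first exact: measurable_funD.
by exists (M + N) => t; apply: le_trans (ler_normD _ _) (lerD _ _).
Qed.

Lemma bmfM f g : bmf f -> bmf g -> bmf (fun t => f t * g t).
Proof.
move=> [mf [M fM]] [mg [N gN]]; split; first exact: measurable_funM.
by exists (M * N) => t; rewrite normrM; apply: ler_pM.
Qed.

Lemma bmfZ c f : bmf f -> bmf (fun t => c * f t).
Proof. by move=> bf; apply: bmfM => //; exact: bmf_cst. Qed.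

Lemma bmfN f : bmf f -> bmf (fun t => - f t).
Proof.
by move=> bf; have := bmfZ (-1) bf; under eq_fun do rewrite mulN1r.
Qed.

Lemma bmfB f g : bmf f -> bmf g -> bmf (fun t => f t - g t).
Proof. by move=> bf bg; apply: bmfD => //; exact: bmfN. Qed.

Lemma bmf_sum n (f : nat -> Omega -> R) : (forall k, bmf (f k)) ->
  bmf (fun t => \sum_(k < n) f k t).
Proof.
move=> bf; elim: n => [|n IH].
  by under eq_fun do rewrite big_ord0; exact: bmf_cst.
by under eq_fun do rewrite big_ord_recr /=; exact: bmfD.
Qed.

Lemma bmf_bool (b : Omega -> bool) : measurable_fun setT b ->
  bmf (fun t => (b t)%:R).
Proof.
move=> mb; split; last by exists 1 => t; case: (b t); rewrite ?normr1 ?normr0.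
have -> : (fun t => (b t)%:R : R) = (fun t => if b t then 1 else 0).
  by apply/funext => t; case: (b t).
by apply: measurable_fun_ifT => //; exact: measurable_cst.
Qed.

Lemma Ex_le f g : bmf f -> bmf g -> (forall t, f t <= g t) -> Ex f <= Ex g.
Proof. by move=> bf bg fg; apply: le_Rintegral => //; exact: bmf_integrable. Qed.

Lemma ExD f g : bmf f -> bmf g -> Ex (fun t => f t + g t) = Ex f + Ex g.
Proof. by move=> bf bg; rewrite /Ex RintegralD//; exact: bmf_integrable. Qed.

Lemma ExB f g : bmf f -> bmf g -> Ex (fun t => f t - g t) = Ex f - Ex g.
Proof. by move=> bf bg; rewrite /Ex RintegralB//; exact: bmf_integrable. Qed.

Lemma ExZ c f : bmf f -> Ex (fun t => c * f t) = c * Ex f.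
Proof. by move=> bf; rewrite /Ex RintegralZl//; exact: bmf_integrable. Qed.

Lemma Ex_cst c : Ex (fun=> c) = c.
Proof. by rewrite /Ex Rintegral_cst//= probability_setT mulr1. Qed.

Lemma Ex_sum n (f : nat -> Omega -> R) : (forall k, bmf (f k)) ->
  Ex (fun t => \sum_(k < n) f k t) = \sum_(k < n) Ex (f k).
Proof.
move=> bf; elim: n => [|n IH].
  by under eq_fun do rewrite big_ord0; rewrite big_ord0 Ex_cst.
under eq_fun do rewrite big_ord_recr /=.
by rewrite ExD ?big_ord_recr /= ?IH//; exact: bmf_sum.
Qed.

Lemma Ex_bool (b : Omega -> bool) : measurable_fun setT b ->
  (Ex (fun t => (b t)%:R))%:E = P [set t | b t].
Proof.
move=> mb; have mB : measurable [set t | b t].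
  by have := mb measurableT [set true] I; rewrite setTI.
have -> : (fun t => (b t)%:R : R) = \1_[set t | b t].
  by apply/funext => t; rewrite indicE mem_setE.
have bi : bmf (\1_[set t | b t] : Omega -> R).
  split; first exact: measurable_indic.
  by exists 1 => t; rewrite indicE; case: (_ \in _); rewrite ?normr1 ?normr0.
rewrite /Ex /Rintegral fineK; first by rewrite integral_indic// setIT.
by apply: integrable_fin_num => //; exact: bmf_integrable.
Qed.

Lemma Ex_markov (b : Omega -> bool) (f : Omega -> R) c :
  measurable_fun setT b -> bmf f -> (forall t, (b t)%:R * c <= f t) ->
  0 < c -> (P [set t | b t] <= (Ex f / c)%:E)%E.
Proof.
move=> mb bf bcf c0; rewrite -Ex_bool// lee_fin ler_pdivlMr// mulrC -ExZ.
  apply: Ex_le => //; first exact/bmfZ/bmf_bool.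
  by move=> t; rewrite mulrC.
exact: bmf_bool.
Qed.

(** Markov's inequality for [A - g], a nonnegative variable of mean [A] that is at least [A + B]
    when [B] is lost. *)
Lemma fair_game (g : Omega -> R) (A B : R) : bmf g -> Ex g = 0 ->
  (forall t, g t <= A) -> 0 <= A -> 0 < B ->
  (P [set t | (g t <= - B)%R] <= (A / (A + B))%:E)%E.
Proof.
move=> bg Eg gA A0 B0.
have -> : A / (A + B) = Ex (fun t => A - g t) / (A + B).
  by rewrite ExB ?Eg ?subr0 ?Ex_cst//; exact: bmf_cst.
have mb : measurable_fun setT (fun t => g t <= - B).
  by apply: measurable_fun_ler => //; exact: bg.1.
apply: (@Ex_markov (fun t => g t <= - B)) => //; last lra.
  by apply: bmfB => //; exact: bmf_cst.
by move=> t; have [h|h] := leP (g t) (- B); have := gA t; rewrite ?mul1r ?mul0r; lra.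
Qed.

End BoundedExpectation.

(** * Independence of a new site from the known ones *)

Section Independence.
Context (R : realType) (d : measure_display) (Omega : measurableType d)
  (P : probability Omega R).

(** The joint law is the product of the laws, since a product measure is determined by rectangles;
    Tonelli then splits the integral. The absolute values in [F] make it nonnegative on the whole
    plane. *)
Lemma ge0_Ex_indep (f g : {RV P >-> R}) :
  (forall A B : set R, measurable A -> measurable B ->
    P (f @^-1` A `&` g @^-1` B) = (P (f @^-1` A) * P (g @^-1` B))%E) ->
  (forall t, 0 <= f t) -> (forall t, 0 <= g t) ->
  (\int[P]_t (f t * g t)%:E = (\int[P]_t (f t)%:E) * (\int[P]_t (g t)%:E))%E.
Proof.
move=> ind f0 g0.
pose h t := (f t, g t).
have mh : measurable_fun setT h.
  by apply: measurable_fun_pair; exact: measurable_funP.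
pose hm := isMeasurableFun.Build _ _ _ _ _ mh.
pose H : {mfun Omega >-> (R * R)%type} := HB.pack h hm.
pose m1 := distribution P f; pose m2 := distribution P g.
pose F (z : R * R) : \bar R := (`|z.1| * `|z.2|)%:E.
have mF : measurable_fun setT F.
  apply/measurable_EFinP; apply: measurable_funM.
    exact: measurableT_comp measurable_fst.
  exact: measurableT_comp measurable_snd.
have F0 z : (0 <= F z)%E by rewrite lee_fin mulr_ge0.
have -> : (\int[P]_t (f t * g t)%:E = \int[distribution P H]_z F z)%E.
  rewrite (ge0_integral_distribution H mF F0); apply: eq_integral => t _ /=.
  by rewrite /F /= !ger0_norm.
have -> : (\int[distribution P H]_z F z = \int[m1 \x m2]_z F z)%E.
  apply: eq_measure_integral => A mA _; apply/esym/product_measure_unique => //.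
rewrite fubini_tonelli1//= /fubini_F /=.
have i2 : (\int[m2]_y (`|y|)%:E = \int[P]_t (g t)%:E)%E.
  rewrite ge0_integral_distribution; [|exact/measurable_EFinP|by move=> y; rewrite lee_fin].
  by apply: eq_integral => t _ /=; rewrite ger0_norm.
have i1 : (\int[m1]_x (`|x|)%:E = \int[P]_t (f t)%:E)%E.
  rewrite ge0_integral_distribution; [|exact/measurable_EFinP|by move=> y; rewrite lee_fin].
  by apply: eq_integral => t _ /=; rewrite ger0_norm.
transitivity (\int[m1]_x ((`|x|)%:E * \int[m2]_y (`|y|)%:E))%E.
  apply: eq_integral => x _; rewrite -ge0_integralZl//.
  - exact/measurable_EFinP.
rewrite i2 ge0_integralZr ?i1//.
- exact/measurable_EFinP.
- by apply: integral_ge0 => t _; rewrite lee_fin.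
Qed.

(** Adding the bounds makes both factors nonnegative; translations preserve independence, and the
    additional terms cancel by linearity. *)
Lemma Ex_indep (f g : Omega -> R) : bmf f -> bmf g ->
  (forall A B : set R, measurable A -> measurable B ->
    P (f @^-1` A `&` g @^-1` B) = (P (f @^-1` A) * P (g @^-1` B))%E) ->
  Ex P (fun t => f t * g t) = Ex P f * Ex P g.
Proof.
move=> bf bg ind.
have [mf [M fM]] := bf; have [mg [N gN]] := bg.
pose f1 t := f t + M; pose g1 t := g t + N.
have bf1 : bmf f1 by apply: bmfD => //; exact: bmf_cst.
have bg1 : bmf g1 by apply: bmfD => //; exact: bmf_cst.
pose F : {RV P >-> R} := HB.pack f1 (isMeasurableFun.Build _ _ _ _ _ bf1.1).
pose G : {RV P >-> R} := HB.pack g1 (isMeasurableFun.Build _ _ _ _ _ bg1.1).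
have f0 t : 0 <= F t by have := fM t; rewrite ler_norml /= /f1; lra.
have g0 t : 0 <= G t by have := gN t; rewrite ler_norml /= /g1; lra.
have sh (c : R) (A : set R) : measurable A -> measurable [set x | A (x + c)].
  move=> mA; rewrite -[X in measurable X]setTI.
  have : measurable_fun setT (fun x : R => x + c).
    by apply: measurable_funD => //; exact: measurable_cst.
  by apply.
have e := ge0_Ex_indep (f := F) (g := G) _ f0 g0.
have {e} : Ex P (fun t => f1 t * g1 t) = Ex P f1 * Ex P g1.
  rewrite /Ex /Rintegral e ?fineM//.
  - by apply: integrable_fin_num => //; exact: bmf_integrable.
  - by apply: integrable_fin_num => //; exact: bmf_integrable.
  - by move=> A B mA mB; exact: ind (sh M A mA) (sh N B mB).
have bc c : bmf (fun=> c : R) by exact: bmf_cst.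
rewrite /f1 /g1 !ExD// !Ex_cst.
have -> : (fun t => (f t + M) * (g t + N)) =
    (fun t => f t * g t + (N * f t + (M * g t + M * N))).
  by apply/funext => t; ring.
rewrite ExD; [|exact: bmfM|by do 2 (apply: bmfD; first exact: bmfZ); exact: bmf_cst].
rewrite ExD; [|exact: bmfZ|by apply: bmfD; first exact: bmfZ; exact: bmf_cst].
rewrite ExD; [|exact: bmfZ|exact: bmf_cst].
rewrite !ExZ// Ex_cst; lra.
Qed.

Variable (X : int -> {RV P >-> R}).
Hypothesis indX : mutually_independent P
  (fun i => preimage_set_system [set: Omega] (X i) measurable).

Definition gens (I : set int) : set_system Omega :=
  \bigcup_(i in I) preimage_set_system [set: Omega] (X i) measurable.

(** A copy of [Omega] with the sigma-algebra generated by the sites in [I]: measurability with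
    respect to these sites is then an instance of the general notion and inherits its closure
    properties. *)
Definition known (I : set int) := g_sigma_algebraType (gens I).

Lemma known_measurable (I : set int) (A : set Omega) :
  <<s gens I >> A -> measurable A.
Proof.
apply: smallest_sub; first exact: sigma_algebra_measurable.
move=> B [i _ [C mC <-]]; rewrite setTI.
by have := measurable_funP (X i) measurableT C mC; rewrite setTI.
Qed.

Lemma known_sub (I J : set int) : I `<=` J -> <<s gens I >> `<=` <<s gens J >>.
Proof.
move=> IJ; apply: sub_smallest2r; first exact: smallest_sigma_algebra.
by move=> A [i Ii GA]; exists i => //; exact: IJ.
Qed.

Definition cylinder (I : set int) : set_system Omega :=
  [set A | exists (J : {fset int}) (C : int -> set R),
    [/\ forall i, i \in J -> I i, forall i, measurable (C i) &
        A = \bigcap_(i in [set` J]) (X i @^-1` C i)]].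

Lemma measurable_preX i (C : set R) : measurable C -> measurable (X i @^-1` C).
Proof. by move=> mC; have := measurable_funP (X i) measurableT C mC; rewrite setTI. Qed.

Lemma cylinderI (I : set int) : setI_closed (cylinder I).
Proof.
move=> A1 A2 [J1 [C1 [IJ1 mC1 ->]]] [J2 [C2 [IJ2 mC2 ->]]].
exists (J1 `|` J2)%fset, (fun i => (if i \in J1 then C1 i else setT) `&`
  (if i \in J2 then C2 i else setT)); split.
- by move=> i; rewrite in_fsetU => /orP[]; [exact: IJ1|exact: IJ2].
- by move=> i; apply: measurableI; case: ifP.
- apply/seteqP; split=> t /=.
    move=> [h1 h2] i /=; rewrite in_fsetU => ij; split; case: ifP => // iJ.
      exact: h1.
    exact: h2.
  move=> h; split=> i /= iJ; have := h i; rewrite /= in_fsetU iJ ?orbT => /(_ isT) [].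
    by [].
  by [].
Qed.

Lemma gens_cylinder (I : set int) : <<s gens I >> `<=` <<s cylinder I >>.
Proof.
apply: sub_smallest2r; first exact: smallest_sigma_algebra.
move=> A [i Ii [C mC <-]]; exists [fset i]%fset, (fun=> C); split=> //.
  by move=> j; rewrite in_fset1 => /eqP ->.
rewrite setTI; apply/seteqP; split=> t /= h.
  by move=> j /=; rewrite in_fset1 => /eqP ->.
by apply: h => /=; rewrite in_fset1.
Qed.

Lemma cylinder_measurable (I : set int) : cylinder I `<=` measurable.
Proof.
move=> A [J [C [_ mC ->]]]; apply: fin_bigcap_measurable => // i _.
exact: measurable_preX.
Qed.

(** Restricting [P] to the event on [X x] and multiplying [P] by its probability give two finite
    measures. They agree on cylinders, which generate the sigma-algebra and are stable under
    intersection. *)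
Lemma known_indep (I : set int) (x : int) (A : set Omega) (B : set R) :
  ~ I x -> <<s gens I >> A -> measurable B ->
  P (A `&` X x @^-1` B) = (P A * P (X x @^-1` B))%E.
Proof.
move=> nIx /gens_cylinder sA mB; have mXB := measurable_preX x mB.
pose m1 : {measure set Omega -> \bar R} := mrestr P mXB.
pose r : {nonneg R} := NngNum (fine_ge0 (measure_ge0 P (X x @^-1` B))).
pose m2 : {measure set Omega -> \bar R} := mscale r P.
have rE : (r%:num)%:E = P (X x @^-1` B) by rewrite /= fineK// fin_num_measure.
suff : m1 A = m2 A by rewrite /m1 /m2 /= /mrestr /mscale rE muleC.
have cT : cylinder I setT.
  exists fset0, (fun=> setT); split=> //; apply/seteqP; split=> //.
apply: (@g_sigma_algebra_measure_unique _ _ _ (cylinder I) _ (fun=> setT) _ _ m1 m2) => //.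
- exact: cylinder_measurable.
- by rewrite bigcup_const.
- exact: cylinderI.
- move=> _ [J [C [IJ mC ->]]]; rewrite /m1 /m2 /= /mrestr /mscale rE.
  have xJ : x \notin J by apply/negP => /IJ.
  pose D i := if i == x then B else C i.
  have DC i : i \in J -> D i = C i.
    by move=> iJ; rewrite /D; case: eqP => // e; rewrite -e iJ in xJ.
  have Dx : D x = B by rewrite /D eqxx.
  have fam (J' : {fset int}) : forall i, i \in J' ->
      preimage_set_system [set: Omega] (X i) measurable (X i @^-1` D i).
    move=> i _; exists (D i); last by rewrite setTI.
    by rewrite /D; case: eqP.
  have -> : \bigcap_(i in [set` J]) (X i @^-1` C i) =
            \bigcap_(i in [set` J]) (X i @^-1` D i).
    by apply: eq_bigcapr => i /= iJ; rewrite DC.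
  have -> : (\bigcap_(i in [set` J]) (X i @^-1` D i)) `&` X x @^-1` B =
            \bigcap_(i in [set` (x |` J)%fset]) (X i @^-1` D i).
    apply/seteqP; split=> t /=.
      move=> [h1 h2] i /=; rewrite in_fset1U => /orP[/eqP ->|iJ]; first by rewrite Dx.
      exact: h1.
    move=> h; split=> [i /= iJ|]; first by apply: h; rewrite /= in_fset1U iJ orbT.
    by rewrite -Dx; apply: h; rewrite /= in_fset1U eqxx.
  have indJ (J' : {fset int}) : P (\bigcap_(i in [set` J']) (X i @^-1` D i)) =
      (\prod_(i <- J') P (X i @^-1` D i))%E := indX (fam J').
  by rewrite indJ big_fsetU1//= Dx indJ.
- move=> _; rewrite /m1 /= /mrestr setTI.
  by apply: (le_lt_trans (probability_le1 P _)) => //; rewrite ltry.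
Qed.

Definition adapted d' (T : measurableType d') (I : set int) (f : Omega -> T) : Prop :=
  @measurable_fun _ _ (known I) T setT f.

Lemma adapted_measurable d' (T : measurableType d') (I : set int) (f : Omega -> T) :
  adapted I f -> measurable_fun setT f.
Proof.
move=> af _ A mA; apply: (@known_measurable I).
exact: (af measurableT A mA).
Qed.

Lemma adapted_sub d' (T : measurableType d') (I J : set int) (f : Omega -> T) :
  I `<=` J -> adapted I f -> adapted J f.
Proof.
move=> IJ af _ A mA; apply: (known_sub IJ).
exact: (af measurableT A mA).
Qed.

Lemma adapted_X (I : set int) i : I i -> adapted I (X i).
Proof.
move=> Ii _ A mA; apply: sub_gen_smallest; exists i => //.
by exists A.
Qed.

Lemma adapted_and (I : set int) (f g : Omega -> bool) :
  adapted I f -> adapted I g -> adapted I (fun t => f t && g t).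
Proof. by move=> mf mg; exact: (@measurable_and _ (known I)). Qed.

Lemma adapted_or (I : set int) (f g : Omega -> bool) :
  adapted I f -> adapted I g -> adapted I (fun t => f t || g t).
Proof. by move=> mf mg; exact: (@measurable_or _ (known I)). Qed.

Lemma adapted_neg (I : set int) (f : Omega -> bool) :
  adapted I f -> adapted I (fun t => ~~ f t).
Proof. by move=> mf; exact: (@measurable_neg _ (known I)). Qed.

Lemma Ex_adaptedM (I : set int) (x : int) (f : Omega -> R) (phi : R -> R) :
  ~ I x -> adapted I f -> (exists M, forall t, `|f t| <= M) ->
  measurable_fun setT phi -> (exists M, forall u, `|phi u| <= M) ->
  Ex P (fun t => f t * phi (X x t)) = Ex P f * Ex P (fun t => phi (X x t)).
Proof.
move=> nIx af bf mphi bphi.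
have mg : measurable_fun setT (fun t => phi (X x t)).
  exact: measurableT_comp.
apply: Ex_indep.
- by split => //; exact: adapted_measurable af.
- by split => //; have [M h] := bphi; exists M => t; exact: h.
- move=> A B mA mB.
  have -> : (fun t => phi (X x t)) @^-1` B = X x @^-1` (phi @^-1` B) by [].
  apply: (@known_indep I) => //.
    by have := af measurableT A mA; rewrite setTI.
  by rewrite -[X in measurable X]setTI; exact: mphi.
Qed.

End Independence.

Section ExpBounds.
Variable R : realType.

Lemma expR_le_linear (u : R) : 0 <= u <= 1 / 2 -> expR u <= 1 + 2 * u.
Proof.
move=> u01; have h1 : 0 < 1 - u by lra.
have h2 : expR u * (1 - u) <= 1.
  have e : expR u * expR (- u) = 1 by rewrite -expRD subrr expR0.
  rewrite -[leRHS]e.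
  by apply: ler_wpM2l; [exact: expR_ge0|exact: expR_ge1Dx].
have h3 : 1 <= (1 + 2 * u) * (1 - u) by nra.
by rewrite -(ler_pM2r h1); apply: le_trans h2 h3.
Qed.

Lemma expRN_le_frac (u : R) : 0 <= u -> expR (- u) <= (1 + u)^-1.
Proof.
move=> u0; rewrite expRN lef_pV2 ?posrE ?expR_gt0//; first exact: expR_ge1Dx.
lra.
Qed.

End ExpBounds.

Section OneSide.
Context (R : realType) (d : measure_display) (Omega : measurableType d)
  (P : probability Omega R) (X : int -> {RV P >-> R}).
Hypothesis indX : mutually_independent P
  (fun i => preimage_set_system [set: Omega] (X i) measurable).
Variables (site : nat -> int) (I : nat -> set int) (phi : R -> R) (L : R).
Hypotheses (siteI : forall k, ~ I k (site k)) (siteS : forall k, I k.+1 (site k))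
  (IS : forall k, I k `<=` I k.+1)
  (mphi : measurable_fun setT phi) (phiL : forall u, `|phi u| <= L)
  (phi0 : forall k, Ex P (fun t => phi (X (site k) t)) = 0).

Definition step (k : nat) (t : Omega) : R := phi (X (site k) t).

Definition walk (t : Omega) (k : nat) : R := \sum_(i < k) step i t.

Let L0 : 0 <= L. Proof. exact: le_trans (normr_ge0 _) (phiL 0). Qed.

Lemma walk0 t : walk t 0 = 0. Proof. by rewrite /walk big_ord0. Qed.

Lemma walkS t k : walk t k.+1 = walk t k + step k t.
Proof. by rewrite /walk big_ord_recr. Qed.

Lemma walk_step t k : walk t k.+1 - walk t k = step k t.
Proof. by rewrite walkS addrAC subrr add0r. Qed.

Lemma walkL t k : `|walk t k.+1 - walk t k| <= L.
Proof. by rewrite walk_step; exact: phiL. Qed.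

Lemma walk_bound t k : `|walk t k| <= k%:R * L.
Proof.
elim: k => [|k IH]; first by rewrite walk0 normr0 mul0r.
rewrite walkS -addn1 natrD mulrDl mul1r; apply: le_trans (ler_normD _ _) _.
by apply: lerD => //; exact: phiL.
Qed.

Lemma I_sub j k : (j <= k)%N -> I j `<=` I k.
Proof.
move=> /subnK <-; elim: (k - j)%N => // n IH.
exact: subset_trans IH (@IS _).
Qed.

Lemma adapted_step j k : (j < k)%N -> adapted X (I k) (step j).
Proof.
move=> jk; rewrite /adapted; apply: (@measurableT_comp _ _ _ _ _ _ phi) => //.
by apply: adapted_X; exact: I_sub jk _ (siteS j).
Qed.

Lemma adapted_walk j k : (j <= k)%N -> adapted X (I k) (walk^~ j).
Proof.
elim: j => [|j IH] jk.
  by rewrite (_ : walk^~ 0%N = fun=> 0); [exact: measurable_cst|exact/funext/walk0].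
rewrite (_ : walk^~ j.+1 = walk^~ j \+ step j); last by apply/funext => t; rewrite walkS.
by apply: measurable_funD; [exact: IH (ltnW jk)|exact: adapted_step].
Qed.

Lemma adaptedS k d' (T : measurableType d') (f : Omega -> T) :
  adapted X (I k) f -> adapted X (I k.+1) f.
Proof. by apply: adapted_sub; exact: IS. Qed.

Lemma bmf_mul_step k (f : Omega -> R) (psi : R -> R) :
  adapted X (I k) f -> (exists M, forall t, `|f t| <= M) ->
  measurable_fun setT psi -> (exists M, forall u, `|psi u| <= M) ->
  bmf (fun t => f t * psi (X (site k) t)).
Proof.
move=> af bf mpsi [M hM]; apply: bmfM; first by split=> //; exact: adapted_measurable af.
by split; [exact: measurableT_comp|exists M => t; exact: hM].
Qed.

Lemma Ex_mul_step k (f : Omega -> R) :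
  adapted X (I k) f -> (exists M, forall t, `|f t| <= M) ->
  Ex P (fun t => f t * step k t) = 0.
Proof.
move=> af bf; rewrite /step (Ex_adaptedM indX (siteI (k := k)) af bf mphi).
  by rewrite phi0 mulr0.
by exists L.
Qed.

Lemma adapted_run h k :
  [/\ adapted X (I k) (fun t => pos (run h (walk t) k)),
      adapted X (I k) (fun t => low (run h (walk t) k)),
      adapted X (I k) (fun t => wgt (run h (walk t) k)),
      adapted X (I k) (fun t => top (run h (walk t) k)) &
      adapted X (I k) (fun t => pretop (run h (walk t) k))].
Proof.
elim: k => [|k [/adaptedS mp /adaptedS ml /adaptedS mw /adaptedS mt /adaptedS mpt]].
  by split=> /=; try exact: adapted_walk; exact: measurable_cst.
have mx : adapted X (I k.+1) (fun t => walk t k.+1) by exact: adapted_walk.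
have mc : adapted X (I k.+1) (fun t => climbing h (run h (walk t) k)).
  by apply: measurable_fun_ltr; [exact: measurable_funB|exact: measurable_cst].
have mml : adapted X (I k.+1)
    (fun t => Num.min (low (run h (walk t) k)) (walk t k.+1)).
  exact: measurable_minr.
have mif (f g : Omega -> R) : adapted X (I k.+1) f -> adapted X (I k.+1) g ->
    adapted X (I k.+1) (fun t => if climbing h (run h (walk t) k) then f t else g t).
  by move=> mf mg; apply: measurable_fun_ifT.
have fE (pr : pstate R -> R) : (fun t => pr (run h (walk t) k.+1)) =
    (fun t => if climbing h (run h (walk t) k) then
       pr (pstep (run h (walk t) k) (walk t k.+1)) else pr (run h (walk t) k)).
  by apply/funext => t /=; case: ifP.
split; rewrite fE; apply: mif => //=.
- apply: measurable_funD.
    apply: measurable_funM => //; apply: measurableT_comp => //.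
    exact: measurable_funB.
  by apply: measurableT_comp => //; exact: measurable_funB.
- exact: measurable_maxr.
- by apply: measurable_fun_ifT => //; exact: measurable_fun_ltr.
Qed.

Section Bets.
Variables (al be : Omega -> nat -> bool).
Hypotheses (mal : forall k, adapted X (I k) (fun t => al t k))
  (mbe : forall k, adapted X (I k) (fun t => be t k)).

Lemma adapted_fresh k : adapted X (I k) (fun t => fresh (al t) k).
Proof.
elim: k => [|k IH]; first exact: measurable_cst.
exact: adaptedS (adapted_and IH (adapted_neg (@mal k))).
Qed.

Lemma adapted_bet k : adapted X (I k) (fun t => bet (al t) (be t) k).
Proof.
elim: k => [|k IH].
  have h1 := adapted_or (adapted_and (@adapted_fresh 0) (@mal 0))
    (@measurable_cst _ _ (known X (I 0%N)) _ setT false).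
  exact: (adapted_and (adapted_neg (@mbe 0)) h1).
exact: (adapted_and (adapted_neg (@mbe k.+1)) (adapted_or
    (adapted_and (@adapted_fresh k.+1) (@mal k.+1)) (adaptedS IH))).
Qed.

Let betR k t : R := (bet (al t) (be t) k)%:R.

Let adapted_betR k : adapted X (I k) (betR k).
Proof.
rewrite /betR (_ : (fun t => _) = fun t => if bet (al t) (be t) k then 1 else 0); last first.
  by apply/funext => t; case: bet.
apply: measurable_fun_ifT; [exact: adapted_bet|exact: measurable_cst|exact: measurable_cst].
Qed.

Let betR_bound k : exists M, forall t, `|betR k t| <= M.
Proof. by exists 1 => t; rewrite /betR; case: bet; rewrite ?normr1 ?normr0. Qed.

Let gainE n : (fun t => gain (walk t) (al t) (be t) n) =
  (fun t => \sum_(k < n) (fun k t => betR k t * step k t) k t).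
Proof. by apply/funext => t; apply: eq_bigr => k _; rewrite walk_step. Qed.

Let bmf_bet k : bmf (fun t => betR k t * step k t).
Proof. by apply: (bmf_mul_step (@adapted_betR k)) => //; exists L. Qed.

Lemma bmf_gain n : bmf (fun t => gain (walk t) (al t) (be t) n).
Proof.
rewrite gainE.
exact: (@bmf_sum _ _ _ n (fun k t => betR k t * step k t) bmf_bet).
Qed.

Lemma Ex_gain n : Ex P (fun t => gain (walk t) (al t) (be t) n) = 0.
Proof.
rewrite gainE (Ex_sum P n bmf_bet) big1// => k _; exact: (Ex_mul_step (@adapted_betR k) (betR_bound k)).
Qed.

End Bets.

(** * Duration of a climb and weight of its valley *)

Section Drift.
Variables (h lam theta : R).
Hypotheses (h_ge0 : 0 < h) (lam_gt0 : 0 < lam) (lamL : lam * L <= 1 / 2)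
  (lam_half : lam <= 1 / 2) (theta_gt0 : 0 < theta)
  (drift : forall k, theta <= Ex P (fun t => expR (- lam * phi (X (site k) t)) - 1)).

Let s k t := run h (walk t) k.
Let Y k t := pos (s k t) - low (s k t).
Let c k t : R := (climbing h (s k t))%:R.
Let A k t := c k t * expR (- lam * Y k t).

Let Y_ge0 k t : 0 <= Y k t.
Proof. by rewrite subr_ge0 run_low_le. Qed.

Let sS k t : s k.+1 t =
  if climbing h (s k t) then pstep (s k t) (pos (s k t) + step k t) else s k t.
Proof.
rewrite /s /=; case: ifP => // cl; congr pstep; rewrite walkS.
have [u [b rd]] := runP h (walk t) k.
by rewrite (rd_pos rd) (rd_stop rd cl).
Qed.

Let Y_le k t : Y k t <= h + L.
Proof.
elim: k => [|k IH]; first by rewrite /Y /s /= subrr; move: L0 h_ge0; lra.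
rewrite /Y sS; case: ifPn => // cl /=.
have := phiL (X (site k) t); rewrite -/(step k t) ler_norml => /andP[_ st].
move: cl; rewrite /climbing; have := Y_ge0 k t; rewrite /Y minEle => y0 cl.
by case: ifP => _; move: L0 h_ge0; lra.
Qed.

Let bmf_pos k : bmf (fun t => pos (s k t)).
Proof.
split; first by have [m _ _ _ _] := adapted_run h k; exact: adapted_measurable m.
exists (k%:R * L) => t; have [u [b rd]] := runP h (walk t) k.
rewrite /s (rd_pos rd); apply: le_trans (walk_bound _ _) _.
by apply: ler_wpM2r => //; rewrite ler_nat; exact: rd_tk rd.
Qed.

Let bmf_low k : bmf (fun t => low (s k t)).
Proof.
split; first by have [_ m _ _ _] := adapted_run h k; exact: adapted_measurable m.
exists (k%:R * L) => t; have [u [b rd]] := runP h (walk t) k.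
rewrite /s (rd_low rd); apply: le_trans (walk_bound _ _) _.
apply: ler_wpM2r => //; rewrite ler_nat; apply: leq_trans (rd_tk rd).
exact: rd_bt rd.
Qed.

Let wgt_bound k t : 0 <= wgt (s k t) <= k.+1%:R.
Proof.
elim: k => [|k /andP[w0 wk]]; first by rewrite /s /= ler01 lexx.
rewrite sS; case: ifP => _ /=; last by rewrite w0 (le_trans wk)// ler_nat.
have e1 (u v : R) : expR (Num.min u v - u) <= 1.
  by rewrite -[leRHS]expR0 ler_expR subr_le0 ge_min lexx.
have e2 (u v : R) : expR (Num.min u v - v) <= 1.
  by rewrite -[leRHS]expR0 ler_expR subr_le0 ge_min lexx orbT.
rewrite addr_ge0 ?mulr_ge0 ?expR_ge0//= -[k.+2]addn1 natrD; apply: lerD => //.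
by rewrite -[k.+1%:R]mulr1; apply: ler_pM => //; exact: expR_ge0.
Qed.

Let bmf_wgt k : bmf (fun t => wgt (s k t)).
Proof.
split; first by have [_ _ m _ _] := adapted_run h k; exact: adapted_measurable m.
by exists k.+1%:R => t; have /andP[w0 w1] := wgt_bound k t; rewrite ger0_norm.
Qed.

Let adapted_c k : adapted X (I k) (c k).
Proof.
rewrite /c (_ : (fun t => _) = fun t => if climbing h (s k t) then 1 else 0); last first.
  by apply/funext => t; case: climbing.
have [mp ml _ _ _] := adapted_run h k.
apply: measurable_fun_ifT; [|exact: measurable_cst|exact: measurable_cst].
by apply: measurable_fun_ltr; [exact: measurable_funB|exact: measurable_cst].
Qed.

Let c01 k t : 0 <= c k t <= 1.
Proof. by rewrite /c; case: climbing; rewrite ?lexx ?ler01. Qed.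

Let adapted_A k : adapted X (I k) (A k).
Proof.
have [mp ml _ _ _] := adapted_run h k.
apply: measurable_funM; first exact: adapted_c.
apply: measurableT_comp => //; apply: measurable_funM; first exact: measurable_cst.
exact: measurable_funB.
Qed.

Let A01 k t : 0 <= A k t <= 1.
Proof.
have /andP[c0 c1] := c01 k t; have e0 := expR_ge0 (- lam * Y k t).
have e1 : expR (- lam * Y k t) <= 1.
  rewrite -[leRHS]expR0 ler_expR mulNr oppr_le0.
  by rewrite mulr_ge0// ltW.
by rewrite mulr_ge0//= -[leRHS]mul1r; apply: ler_pM.
Qed.

Let A_bound k : exists M, forall t, `|A k t| <= M.
Proof. by exists 1 => t; have /andP[a0 a1] := A01 k t; rewrite ger0_norm. Qed.

Let bmf_A k : bmf (A k).
Proof. by split; [exact: adapted_measurable (@adapted_A k)|exact: A_bound]. Qed.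

Let psi (u : R) := expR (- lam * phi u) - 1.

Let mpsi : measurable_fun setT psi.
Proof.
apply: measurable_funB; last exact: measurable_cst.
apply: measurableT_comp => //; apply: measurable_funM => //; exact: measurable_cst.
Qed.

Let psi_bound : exists M, forall u, `|psi u| <= M.
Proof.
exists (expR (lam * L) + 1) => u; apply: le_trans (ler_normB _ _) _.
rewrite normr1 lerD2r ger0_norm ?expR_ge0// ler_expR.
have := phiL u; rewrite ler_norml => /andP[h1 _]; rewrite mulNr -mulrN.
by apply: ler_wpM2l; [exact: ltW|lra].
Qed.

Let Phi k t := expR (- lam * Y k t) - 2 * lam * low (s k t).

(* [expR (- lam * _)] is a strict submartingale of the unreflected walk; the
   reflection at the minimum costs at most [2 * lam] times the drop of [low]. *)
Let Phi_drift k t : A k t * psi (X (site k) t) <= Phi k.+1 t - Phi k t.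
Proof.
rewrite /Phi /A /c /Y sS /psi; case: ifPn => [cl|ncl] /=; last by rewrite !mul0r subrr.
rewrite mul1r -/(step k t); have := Y_ge0 k t; rewrite /Y.
set p := pos _; set l := low _ => y0.
have := phiL (X (site k) t); rewrite -/(step k t) ler_norml => /andP[st _].
have -> : expR (- lam * (p - l)) * (expR (- lam * step k t) - 1) =
    expR (- lam * (p + step k t - l)) - expR (- lam * (p - l)).
  by rewrite mulrBr mulr1 -expRD; congr (expR _ - _); ring.
rewrite minEle; case: ifPn => [lp|]; first lra.
rewrite -ltNge => lp; rewrite subrr mulr0 expR0.
have := @expR_le_linear R (- lam * (p + step k t - l)) _.
have -> : 0 <= - lam * (p + step k t - l) <= 1 / 2.
  have -> : - lam * (p + step k t - l) = lam * (l - (p + step k t)) by ring.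
  apply/andP; split; first by rewrite mulr_ge0 ?ltW// subr_gt0.
  apply: le_trans lamL; apply: ler_wpM2l; [exact: ltW|lra].
by move=> /(_ isT); lra.
Qed.

Let Y_bound k t : `|expR (- lam * Y k t)| <= 1.
Proof.
rewrite ger0_norm ?expR_ge0// -[leRHS]expR0 ler_expR mulNr oppr_le0.
by rewrite mulr_ge0// ltW.
Qed.

Let bmf_Phi k : bmf (Phi k).
Proof.
apply: bmfB; last exact: bmfZ.
split; last by exists 1.
apply: measurableT_comp => //; apply: measurable_funM; first exact: measurable_cst.
by apply: measurable_funB; [exact: (bmf_pos k).1|exact: (bmf_low k).1].
Qed.

Let Ex_pos n : Ex P (fun t => pos (s n t)) = 0.
Proof.
elim: n => [|n IH].
  by rewrite (_ : (fun t => _) = fun=> 0) ?Ex_cst//; apply/funext => t; rewrite /s /= walk0.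
have -> : (fun t => pos (s n.+1 t)) = (fun t => pos (s n t) + c n t * step n t).
  apply/funext => t; rewrite sS /c; case: ifP => _ /=; first by rewrite mul1r.
  by rewrite mul0r addr0.
have bc : exists M, forall t, `|c n t| <= M.
  by exists 1 => t; have /andP[a0 a1] := c01 n t; rewrite ger0_norm.
rewrite ExD ?IH ?add0r//; first exact: Ex_mul_step.
by apply: bmf_mul_step => //; exists L.
Qed.

(** [Phi] is telescoped. As [pos] has mean zero, [- low] may be traded for [pos - low], which is at
    most [h + L]; the bound is therefore uniform in [n]. *)
Let sum_A n : \sum_(k < n) Ex P (A k) <= (h + L) / theta.
Proof.
rewrite ler_pdivlMr// mulr_suml.
have step1 k : Ex P (A k) * theta <= Ex P (Phi k.+1) - Ex P (Phi k).
  rewrite -ExB//; apply: (@le_trans _ _ (Ex P (fun t => A k t * psi (X (site k) t)))).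
    rewrite (Ex_adaptedM indX (siteI (k := k)) (@adapted_A k) (A_bound k) mpsi psi_bound).
    apply: ler_wpM2l; last exact: drift.
    rewrite -(Ex_cst P 0); apply: Ex_le => //; first exact: bmf_cst.
    by move=> t; have /andP[] := A01 k t.
  apply: Ex_le => //; last by apply: bmfB.
  by apply: bmf_mul_step.
apply: (@le_trans _ _ (\sum_(k < n) (Ex P (Phi k.+1) - Ex P (Phi k)))).
  by apply: ler_sum => k _.
rewrite -(big_mkord xpredT (fun k => Ex P (Phi k.+1) - Ex P (Phi k))) telescope_sumr//.
have -> : Ex P (Phi 0) = 1.
  rewrite (_ : Phi 0 = fun=> 1) ?Ex_cst//; apply/funext => t.
  by rewrite /Phi /Y /s /= walk0 subrr !mulr0 expR0 subr0.
suff : Ex P (Phi n) <= Ex P (fun t => (1 + (h + L)) - 2 * lam * pos (s n t)).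
  have -> : Ex P (fun t => (1 + (h + L)) - 2 * lam * pos (s n t)) = 1 + (h + L).
    rewrite (ExB P (bmf_cst _ _) (bmfZ (2 * lam) (bmf_pos n))).
    by rewrite (ExZ P _ (bmf_pos n)) Ex_pos Ex_cst mulr0 subr0.
  by move: (Ex P (Phi n)) => e; lra.
apply: Ex_le => //; first by apply: bmfB; [exact: bmf_cst|exact: bmfZ].
move=> t; have := Y_bound n t; rewrite ler_norml => /andP[_ yb].
have := Y_le n t; have := Y_ge0 n t; rewrite /Phi /Y in yb * => y0 yl.
have l2 : 2 * lam * (pos (s n t) - low (s n t)) <= 1 * (h + L).
  have l1 : 2 * lam <= 1 by move: lam_half; lra.
  by apply: ler_pM => //; rewrite mulr_ge0// ltW.
have l3 : 2 * lam * (pos (s n t) - low (s n t)) =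
    2 * lam * pos (s n t) - 2 * lam * low (s n t) by ring.
rewrite l3 in l2; move: l2 yb.
set a := 2 * lam * pos _; set b := 2 * lam * low _; set e := expR _.
lra.
Qed.

(** As long as the climb [h] is not achieved, each [A k] is at least [expR (- lam * h)]; the bound
    on the mean of their sum leaves little room for [n] such terms. *)
Lemma prob_climbing (n : nat) : (0 < n)%N ->
  (P [set t | climbing h (run h (walk t) n)] <=
   ((h + L) * expR (lam * h) / (theta * n%:R))%:E)%E.
Proof.
move=> n0.
have mb : measurable_fun setT (fun t => climbing h (run h (walk t) n)).
  have [mp ml _ _ _] := adapted_run h n.
  apply: (@adapted_measurable _ _ _ _ X _ _ (I n)).
  by apply: measurable_fun_ltr; [exact: measurable_funB|exact: measurable_cst].
have -> : (h + L) * expR (lam * h) / (theta * n%:R) =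
    ((h + L) / theta) / (n%:R * expR (- lam * h)).
  rewrite mulNr expRN; field; rewrite ?gt_eqF ?expR_gt0 ?ltr0n//.
have bS := @bmf_sum _ _ _ n A bmf_A.
have c0 : 0 < n%:R * expR (- lam * h) by rewrite mulr_gt0 ?expR_gt0// ltr0n.
apply: (le_trans (@Ex_markov _ _ _ P _ _ _ mb bS _ c0)).
  move=> t; case: (boolP (climbing h (run h (walk t) n))) => cl; last first.
    by rewrite mul0r sumr_ge0// => k _; have /andP[] := A01 k t.
  rewrite mul1r -[n in n%:R]card_ord -sum1_card natr_sum mulr_suml.
  apply: ler_sum => k _; rewrite mul1r.
  have clk : climbing h (s k t).
    apply: contraT => ncl; move: cl; have [u [b rd]] := runP h (walk t) k.
    by rewrite (run_stopped (ltnW (ltn_ord k)) ncl) (negbTE ncl).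
  rewrite /A /c clk mul1r ler_expR; move: clk; rewrite /climbing -/(Y k t) => clk.
  by rewrite !mulNr lerN2; apply: ler_wpM2l; exact: ltW.
rewrite lee_fin; apply: ler_wpM2r; first by rewrite invr_ge0 ltW.
by rewrite Ex_sum.
Qed.

(** Away from a new minimum, [Psi] changes by [wgt] times the step, a fair game, plus a term
    exponentially small in [Y]. At a new minimum, lower by [dd], the rescaling of the weight must
    compensate the reflection: [expR (- dd) * (1 + L) <= 1 + L - dd], which holds for [0 <= dd <= L]
    and dictates the constant [1 + L]. *)
Let Psi k t := wgt (s k t) * (Y k t + (1 + L)).

Let Psi_drift k t : Psi k.+1 t <=
  Psi k t + c k t * wgt (s k t) * step k t + 2 * (3 + L) * A k t.
Proof.
have /andP[w0 _] := wgt_bound k t.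
rewrite /Psi /A /c {1 2}/Y sS; case: ifPn => [cl|ncl] /=; last first.
  by rewrite !mul0r mulr0 !addr0.
rewrite !mul1r -/(step k t); have := Y_ge0 k t; rewrite /Y.
move: w0; set p := pos _; set l := low _; set u := wgt _ => w0 y0.
have := phiL (X (site k) t); rewrite -/(step k t); set z := step k t.
rewrite ler_norml => /andP[z1 z2].
(* One half of the exponent absorbs the linear factor; the other half is at most
   [2 * expR (- lam * (p - l))] because [lam <= 1 / 2]. *)
have tail y : 0 <= y -> p - l - L <= y ->
    expR (- y) * (y + (1 + L)) <= 2 * (3 + L) * expR (- lam * (p - l)).
  move=> yp yl.
  have e1 : expR (- (y / 2)) * (y + (1 + L)) <= 3 + L.
    apply: (@le_trans _ _ ((1 + y / 2)^-1 * (y + (1 + L)))).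
      by apply: ler_wpM2r; [move: L0; lra|apply: expRN_le_frac; lra].
    by rewrite mulrC ler_pdivrMr; [move: L0; nra|lra].
  have e2 : expR (- (y / 2)) <= 2 * expR (- lam * (p - l)).
    have e3 : expR (lam * L) <= 2.
      have lL0 : 0 <= lam * L by rewrite mulr_ge0// ltW.
      by have := @expR_le_linear R (lam * L); rewrite lL0 lamL => /(_ isT); move: lamL; lra.
    apply: (@le_trans _ _ (expR (lam * L) * expR (- lam * (p - l)))); last first.
      by apply: ler_wpM2r => //; exact: expR_ge0.
    rewrite -expRD ler_expR.
    have -> : lam * L + - lam * (p - l) = - (lam * (p - l - L)) by ring.
    rewrite lerN2; apply: (@le_trans _ _ (lam * y)).
      by apply: ler_wpM2l => //; exact: ltW.
    by rewrite mulrC; apply: ler_wpM2l => //; move: lam_half; lra.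
  have -> : expR (- y) = expR (- (y / 2)) * expR (- (y / 2)).
    by rewrite -expRD; congr expR; field.
  rewrite -mulrA; apply: (@le_trans _ _ (expR (- (y / 2)) * (3 + L))).
    by apply: ler_wpM2l => //; exact: expR_ge0.
  rewrite mulrC mulrAC; apply: (@le_trans _ _ ((3 + L) * (2 * expR (- lam * (p - l))))).
    by apply: ler_wpM2l => //; move: L0; lra.
  lra.
rewrite minEle; case: ifPn => [lp|].
  rewrite subrr expR0 mulr1.
  have := tail (p + z - l) _ _; rewrite opprB => t1.
  have {}t1 := t1 _ _.
  have : 0 <= p + z - l by lra.
  have : p - l - L <= p + z - l by lra.
  move=> a1 a2; have := t1 a2 a1.
  have -> : (u + expR (l - (p + z))) * (p + z - l + (1 + L)) =
   u * (p - l + (1 + L)) + u * z + expR (l - (p + z)) * (p + z - l + (1 + L)) by ring.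
  lra.
rewrite -ltNge => lp; rewrite subrr expR0 add0r.
have := tail 0 (lexx 0); rewrite oppr0 expR0 mul1r add0r => t1.
have {}t1 : 1 + L <= 2 * (3 + L) * expR (- lam * (p - l)) by apply: t1; lra.
set dd := l - (p + z).
have dd0 : 0 < dd by rewrite /dd; lra.
have ddL : dd <= L by rewrite /dd; lra.
have e1 : expR (p + z - l) * (1 + L) <= 1 + L - dd.
  have -> : p + z - l = - dd by rewrite /dd opprB.
  apply: (@le_trans _ _ ((1 + dd)^-1 * (1 + L))).
    by apply: ler_wpM2r; [move: L0; lra|apply: expRN_le_frac; lra].
  by rewrite mulrC ler_pdivrMr; [nra|lra].
have e2 : u * (expR (p + z - l) * (1 + L)) <= u * (1 + L - dd) by apply: ler_wpM2l.
have -> : (u * expR (p + z - l) + 1) * (1 + L) =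
   u * (expR (p + z - l) * (1 + L)) + (1 + L) by ring.
have e3 : u * (1 + L - dd) = u * (p - l + (1 + L)) + u * z by rewrite /dd; ring.
lra.
Qed.

Let bmf_Psi k : bmf (Psi k).
Proof.
apply: bmfM => //; apply: bmfD; last exact: bmf_cst.
by apply: bmfB.
Qed.

Let Ex_Psi n : Ex P (Psi n) <= (1 + L) + 2 * (3 + L) * ((h + L) / theta).
Proof.
apply: (@le_trans _ _ ((1 + L) + 2 * (3 + L) * (\sum_(k < n) Ex P (A k)))); last first.
  by rewrite lerD2l; apply: ler_wpM2l => //; move: L0; lra.
elim: n => [|n IH].
  rewrite big_ord0 mulr0 addr0 (_ : Psi 0 = fun=> 1 + L) ?Ex_cst//.
  by apply/funext => t; rewrite /Psi /Y /s /= walk0 subrr add0r mul1r.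
have acw : adapted X (I n) (fun t => c n t * wgt (s n t)).
  have [_ _ mw _ _] := adapted_run h n.
  by apply: measurable_funM; [exact: (@adapted_c n)|exact: mw].
have bcw : exists M, forall t, `|c n t * wgt (s n t)| <= M.
  exists (1 * n.+1%:R) => t; rewrite normrM.
  have /andP[c0 c1] := c01 n t; have /andP[w0 w1] := wgt_bound n t.
  by apply: ler_pM => //; rewrite ger0_norm.
have b2 : bmf (fun t => c n t * wgt (s n t) * step n t).
  by apply: (bmf_mul_step acw bcw mphi); exists L.
apply: (@le_trans _ _ (Ex P (fun t => Psi n t + c n t * wgt (s n t) * step n t +
    2 * (3 + L) * A n t))).
  apply: Ex_le => //; apply: bmfD; last exact: bmfZ.
  exact: bmfD.
rewrite (ExD P (bmfD (bmf_Psi n) b2) (bmfZ _ (bmf_A n))) (ExD P (bmf_Psi n) b2).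
rewrite (Ex_mul_step acw bcw) addr0 (ExZ P _ (bmf_A n)) big_ord_recr /=.
by set cc := 2 * (3 + L) in IH *; rewrite mulrDr addrA lerD2r.
Qed.

(** Once the climb [h] is achieved, [Psi] is at least [wgt * h], while its mean is bounded by an
    affine function of [h]. The quotient stays bounded as [h] grows, so one constant [K] serves at
    all scales. *)
Lemma prob_weight (n : nat) (K : R) : 0 < K ->
  (P [set t | ~~ climbing h (run h (walk t) n) && (K < wgt (run h (walk t) n))%R] <=
   (((1 + L) + 2 * (3 + L) * ((h + L) / theta)) / (K * h))%:E)%E.
Proof.
move=> K0; have [mp ml mw _ _] := adapted_run h n.
have mb : measurable_fun setT (fun t => ~~ climbing h (run h (walk t) n) &&
    (K < wgt (run h (walk t) n))).
  apply: (@adapted_measurable _ _ _ _ X _ _ (I n)).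
  apply: adapted_and.
    apply: adapted_neg.
    by apply: measurable_fun_ltr; [exact: measurable_funB|exact: measurable_cst].
  by apply: measurable_fun_ltr; [exact: measurable_cst|].
have c0 : 0 < K * h by rewrite mulr_gt0.
apply: (le_trans (@Ex_markov _ _ _ P _ _ _ mb (bmf_Psi n) _ c0)).
  move=> t; have /andP[w0 _] := wgt_bound n t; have y0 := Y_ge0 n t.
  case: (boolP (_ && _)) => [/andP[cl wK]|_]; last first.
    by rewrite mul0r mulr_ge0// addr_ge0//; move: L0; lra.
  rewrite mul1r; apply: ler_pM; try exact: ltW.
  by move: cl; rewrite /climbing -leNgt -/(Y n t) => cl; move: L0; lra.
rewrite lee_fin; apply: ler_wpM2r; first by rewrite invr_ge0 ltW.
exact: Ex_Psi.
Qed.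

End Drift.
End OneSide.

Section Unlikely.
Context (R : realType) (d : measure_display) (Omega : measurableType d)
  (P : probability Omega R).

Definition unlikely (b : Omega -> bool) (p : R) : Prop :=
  measurable_fun setT b /\ (P [set t | b t] <= p%:E)%E.

Lemma unlikely_or b1 b2 p1 p2 : unlikely b1 p1 -> unlikely b2 p2 ->
  unlikely (fun t => b1 t || b2 t) (p1 + p2).
Proof.
move=> [m1 l1] [m2 l2]; split; first exact: measurable_or.
have -> : [set t | b1 t || b2 t] = [set t | b1 t] `|` [set t | b2 t].
  by apply/seteqP; split=> t /= /orP.
have mset (b : Omega -> bool) : measurable_fun setT b -> measurable [set t | b t].
  by move=> mb; have := mb measurableT [set true] I; rewrite setTI.
apply: (@le_trans _ _ (P [set t | b1 t] + P [set t | b2 t])%E).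
  by apply: measureU2; exact: mset.
by rewrite EFinD; apply: leeD.
Qed.

Lemma unlikely_le b p q : unlikely b p -> p <= q -> unlikely b q.
Proof. by move=> [mb bp] pq; split => //; apply: le_trans bp _; rewrite lee_fin. Qed.

End Unlikely.

Section OneSideEvents.
Context (R : realType) (d : measure_display) (Omega : measurableType d)
  (P : probability Omega R) (X : int -> {RV P >-> R}).
Hypothesis indX : mutually_independent P
  (fun i => preimage_set_system [set: Omega] (X i) measurable).
Variables (site : nat -> int) (I : nat -> set int) (phi : R -> R) (L : R).
Hypotheses (siteI : forall k, ~ I k (site k)) (siteS : forall k, I k.+1 (site k))
  (IS : forall k, I k `<=` I k.+1)
  (mphi : measurable_fun setT phi) (phiL : forall u, `|phi u| <= L)
  (phi0 : forall k, Ex P (fun t => phi (X (site k) t)) = 0).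

Let x := walk X site phi.
Let L0 : 0 <= L. Proof. exact: le_trans (normr_ge0 _) (phiL 0). Qed.
Let xL t k : `|x t k.+1 - x t k| <= L. Proof. exact: walkL. Qed.
Let x0 t : x t 0%N = 0. Proof. exact: walk0. Qed.

Let ax k : adapted X (I k) (fun t => x t k).
Proof. exact: (adapted_walk siteS IS mphi (leqnn k)). Qed.

Let acst d' (T : measurableType d') k (z : T) : adapted X (I k) (fun=> z).
Proof. exact: measurable_cst. Qed.

Let aler k (f g : Omega -> R) : adapted X (I k) f -> adapted X (I k) g ->
  adapted X (I k) (fun t => f t <= g t).
Proof. by move=> af ag; exact: measurable_fun_ler. Qed.

Let altr k (f g : Omega -> R) : adapted X (I k) f -> adapted X (I k) g ->
  adapted X (I k) (fun t => f t < g t).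
Proof. by move=> af ag; exact: measurable_fun_ltr. Qed.

Let aD k (f g : Omega -> R) : adapted X (I k) f -> adapted X (I k) g ->
  adapted X (I k) (fun t => f t + g t).
Proof. by move=> af ag; exact: measurable_funD. Qed.

Let aB k (f g : Omega -> R) : adapted X (I k) f -> adapted X (I k) g ->
  adapted X (I k) (fun t => f t - g t).
Proof. by move=> af ag; exact: measurable_funB. Qed.

Let unlikely_gain al be n A B : (forall k, adapted X (I k) (fun t => al t k)) ->
  (forall k, adapted X (I k) (fun t => be t k)) ->
  (forall t, gain (x t) (al t) (be t) n <= A) -> 0 <= A -> 0 < B ->
  unlikely P (fun t => gain (x t) (al t) (be t) n <= - B) (A / (A + B)).
Proof.
move=> ma mb gA A0 B0.
have bg := bmf_gain site IS mphi phiL ma mb n.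
split; first by apply: measurable_fun_ler; [exact: bg.1|exact: measurable_cst].
exact: (fair_game bg (Ex_gain indX siteI IS mphi phiL phi0 ma mb n) gA A0 B0).
Qed.

Let unlikely_loss al be n A B : (forall k, adapted X (I k) (fun t => al t k)) ->
  (forall k, adapted X (I k) (fun t => be t k)) ->
  (forall t, - A <= gain (x t) (al t) (be t) n) -> 0 <= A -> 0 < B ->
  unlikely P (fun t => B <= gain (x t) (al t) (be t) n) (A / (A + B)).
Proof.
move=> ma mb gA A0 B0.
have bg := bmf_gain site IS mphi phiL ma mb n.
have E0 := Ex_gain indX siteI IS mphi phiL phi0 ma mb n.
split; first by apply: measurable_fun_ler; [exact: measurable_cst|exact: bg.1].
have -> : [set t | B <= gain (x t) (al t) (be t) n] =
          [set t | - gain (x t) (al t) (be t) n <= - B].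
  by apply/seteqP; split=> t /=; rewrite lerN2.
apply: (@fair_game _ _ _ P _ A B (bmfN bg)) => //.
  have -> : (fun t => - gain (x t) (al t) (be t) n) =
            (fun t => (-1) * gain (x t) (al t) (be t) n).
    by apply/funext => t; rewrite mulN1r.
  by rewrite (ExZ P _ bg) E0 mulr0.
by move=> t; rewrite lerNl.
Qed.

Variables (W : nat) (h1 h2 q2 q3 : R).
Hypotheses (h1_gt0 : 0 < h1) (h12 : h1 <= h2) (q2_gt0 : 0 < q2) (q3_gt0 : 0 < q3)
  (q23 : q2 + q3 + L < h1).

Lemma unlikely_deepen :
  unlikely P (fun t => gain (x t) (deepen_start (x t) h1) (deepen_stop (x t) h1 h2) W <= - h1)
    ((h2 - h1 + L) / (h2 + L)).
Proof.
have -> : h2 + L = h2 - h1 + L + h1 by ring.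
have run1 k := adapted_run X siteS IS mphi h1 k.
apply: unlikely_gain => //.
- move=> k; have [mp ml _ _ _] := run1 k.
  exact: (adapted_neg (altr (aB mp ml) (@acst _ _ k h1))).
- move=> k; have [mp ml _ _ _] := run1 k.
  exact: (adapted_or (altr (@ax k) ml) (aler (aD ml (@acst _ _ k h2)) (@ax k))).
- by move=> t; exact: (gain_deepen_le (xL t)).
- by move: L0 h12; lra.
Qed.

Lemma unlikely_rise :
  unlikely P (fun t => gain (x t) xpredT (rise_stop (x t) q2 q3) W <= - q3)
    ((q2 + L) / (q2 + L + q3)).
Proof.
apply: (@unlikely_gain (fun=> xpredT)) => //.
- move=> k; exact: (adapted_or (aler (@acst _ _ k q2) (@ax k))
    (aler (@ax k) (@acst _ _ k (- q3)))).
- by move=> t; exact: (gain_rise_le (x0 t) (xL t) q3 q2_gt0 W).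
- by move: L0 q2_gt0; lra.
Qed.

(** The fair game with opposite sign: losses are at most [q2 + q3 + 2 * L], so large gains are
    rare. *)
Lemma unlikely_drop :
  unlikely P (fun t => h1 - q3 - q2 - L <=
      gain (x t) (drop_start (x t) q2) (drop_stop (x t) h1 q3) W)
    ((q2 + q3 + 2 * L) / (h1 + L)).
Proof.
have -> : h1 + L = q2 + q3 + 2 * L + (h1 - q3 - q2 - L) by ring.
apply: unlikely_loss => //.
- by move=> k; exact: aler (@acst _ _ k q2) (@ax k).
- move=> k; exact: (adapted_or (aler (@acst _ _ k (h1 - q3)) (@ax k))
    (aler (@ax k) (@acst _ _ k (- q3)))).
- by move=> t; exact: (gain_drop_ge (x0 t) (xL t)).
- by move: L0 q2_gt0 q3_gt0; lra.
- by move: q23; lra.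
Qed.

(** The level may be random, provided that it is known before the first step. *)
Lemma unlikely_window (z : Omega -> R) (q l : R) : adapted X (I 0) z ->
  0 < q -> 0 <= l ->
  unlikely P (fun t => gain (x t) (window_start (x t) (z t) q)
     (window_stop (x t) (z t) q l) W <= - q) ((l + L) / (l + L + q)).
Proof.
move=> az q0 l0.
have azk k : adapted X (I k) z by apply: adapted_sub az; exact: I_sub.
apply: (@unlikely_gain (fun t => window_start (x t) (z t) q)
    (fun t => window_stop (x t) (z t) q l)) => //.
- move=> k; exact: (adapted_and (aler (@acst _ _ k q) (@azk k)) (aler (@azk k) (@ax k))).
- move=> k; exact: (adapted_or (altr (aD (@azk k) (@acst _ _ k l)) (@ax k))
    (aler (@ax k) (aB (@azk k) (@acst _ _ k q)))).
- by move=> t; exact: (gain_window_le (xL t)).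
- by move: L0; lra.
Qed.

Lemma adapted_low_run h k (J : set int) : I k `<=` J ->
  adapted X J (fun t => low (run h (x t) k)).
Proof.
move=> IJ; have [_ m _ _ _] := adapted_run X siteS IS mphi h k.
exact: adapted_sub IJ m.
Qed.

Lemma adapted_pretop_run h k (J : set int) : I k `<=` J ->
  adapted X J (fun t => pretop (run h (x t) k)).
Proof.
move=> IJ; have [_ _ _ _ m] := adapted_run X siteS IS mphi h k.
exact: adapted_sub IJ m.
Qed.

Variables (lam theta K : R).
Hypotheses (lam_gt0 : 0 < lam) (lamL : lam * L <= 1 / 2) (lam_half : lam <= 1 / 2)
  (theta_gt0 : 0 < theta) (K_gt0 : 0 < K) (W_gt0 : (0 < W)%N)
  (drift : forall k, theta <= Ex P (fun t => expR (- lam * phi (X (site k) t)) - 1)).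

Definition bad_side (t : Omega) : bool :=
  [|| climbing h2 (run h2 (x t) W),
      ~~ climbing h2 (run h2 (x t) W) && (K < wgt (run h2 (x t) W)),
      gain (x t) (deepen_start (x t) h1) (deepen_stop (x t) h1 h2) W <= - h1,
      gain (x t) xpredT (rise_stop (x t) q2 q3) W <= - q3 |
      h1 - q3 - q2 - L <= gain (x t) (drop_start (x t) q2) (drop_stop (x t) h1 q3) W].

Lemma unlikely_bad_side : unlikely P bad_side
  ((h2 + L) * expR (lam * h2) / (theta * W%:R) +
   ((1 + L + 2 * (3 + L) * ((h2 + L) / theta)) / (K * h2) +
   ((h2 - h1 + L) / (h2 + L) +
   ((q2 + L) / (q2 + L + q3) + (q2 + q3 + 2 * L) / (h1 + L))))).
Proof.
have h2_gt0 : 0 < h2 by apply: lt_le_trans h12.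
have [mp ml mw _ _] := adapted_run X siteS IS mphi h2 W.
have ac := altr (aB mp ml) (@acst _ _ W h2).
apply: unlikely_or.
  split; first exact: adapted_measurable ac.
  exact: (prob_climbing indX siteI siteS IS mphi phiL phi0 h2_gt0 lam_gt0 lamL lam_half
    theta_gt0 drift W_gt0).
apply: unlikely_or.
  split; last exact: (prob_weight indX siteI siteS IS mphi phiL phi0 h2_gt0 lam_gt0 lamL
    lam_half theta_gt0 drift W K_gt0).
  apply: (@adapted_measurable _ _ _ _ X _ _ (I W)).
  exact: adapted_and (adapted_neg ac) (altr (@acst _ _ W K) mw).
apply: unlikely_or; first exact: unlikely_deepen.
by apply: unlikely_or; [exact: unlikely_rise|exact: unlikely_drop].
Qed.

Lemma good_side t : ~~ bad_side t ->
  exists t1 t2 b, side_valley (x t) W h1 h2 q2 K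
    (low (run h1 (x t) W)) (pretop (run h1 (x t) W)) t1 t2 b.
Proof.
rewrite /bad_side !negb_or -!ltNge => /and5P[ncl wK g1 g2 g3].
have {}wK : wgt (run h2 (x t) W) <= K by move: wK; rewrite ncl /= -leNgt.
exact: (side_valleyP (x0 t) (xL t) h1_gt0 h12 q2_gt0 q23 ncl wK g1 g2 g3).
Qed.

End OneSideEvents.

(** * The law of the increments *)

Section Environment.
Context (R : realType) (d : measure_display) (Omega : measurableType d)
  (P : probability Omega R) (omega : int -> {RV P >-> R}).
Hypotheses (omega01 : forall x t, 0 < omega x t < 1) (omega_iid : iid omega).
Variable eps0 : R.
Hypotheses (eps0_gt0 : 0 < eps0) (eps0_lt : eps0 < 1 / 2)
  (elliptic : P [set t | eps0 <= omega 0 t <= 1 - eps0] = 1%E)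
  (mean0 : ('E_P[fun t => ln (rho (fun x => omega x t) 0)%R] = 0)%E)
  (var_gt0 : (0 < 'E_P[fun t => (ln (rho (fun x => omega x t) 0) ^+ 2)%R])%E).

(** Cut off outside the ellipticity interval, so that the increments are bounded everywhere and not
    only almost surely. *)
Definition log_ratio (u : R) : R :=
  if (eps0 <= u) && (u <= 1 - eps0) then ln (1 - u) - ln u else 0.

Definition log_bound : R := ln (1 - eps0) - ln eps0.

Lemma log_bound_ge0 : 0 <= log_bound.
Proof. by rewrite subr_ge0 ler_ln ?posrE; move: eps0_gt0 eps0_lt; lra. Qed.

Lemma log_ratio_bound u : `|log_ratio u| <= log_bound.
Proof.
rewrite /log_ratio; case: ifP => [/andP[u1 u2]|_]; last by rewrite normr0 log_bound_ge0.
have a1 : ln eps0 <= ln u by rewrite ler_ln ?posrE//; move: eps0_gt0; lra.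
have a2 : ln u <= ln (1 - eps0) by rewrite ler_ln ?posrE//; move: eps0_gt0; lra.
have a3 : ln eps0 <= ln (1 - u) by rewrite ler_ln ?posrE//; move: eps0_gt0; lra.
have a4 : ln (1 - u) <= ln (1 - eps0) by rewrite ler_ln ?posrE//; move: eps0_gt0; lra.
by rewrite /log_bound ler_norml; apply/andP; split; lra.
Qed.

Lemma measurable_log_ratio : measurable_fun setT log_ratio.
Proof.
apply: measurable_fun_ifT; last exact: measurable_cst.
  by apply: measurable_and; apply: measurable_fun_ler => //; exact: measurable_cst.
apply: measurable_funB => //; apply: measurableT_comp => //.
by apply: measurable_funB => //; exact: measurable_cst.
Qed.

Let elliptic_set : set R := [set u | eps0 <= u <= 1 - eps0].

Let measurable_elliptic : measurable elliptic_set.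
Proof.
have mb : measurable_fun setT (fun u : R => (eps0 <= u) && (u <= 1 - eps0)).
  by apply: measurable_and; apply: measurable_fun_ler => //; exact: measurable_cst.
by have := mb measurableT [set true] I; rewrite setTI.
Qed.

Lemma elliptic_all : P.-negligible [set t | ~ forall x, eps0 <= omega x t <= 1 - eps0].
Proof.
have sub : [set t | ~ forall x, eps0 <= omega x t <= 1 - eps0] `<=`
    \bigcup_n (if (@choice.unpickle int n) is Some x then omega x @^-1` (~` elliptic_set) else set0).
  move=> t /= /existsNP[x nx]; exists (choice.pickle x) => //.
  by rewrite choice.pickleK.
apply: (negligibleS sub); apply: negligible_bigcup => n.
case: (@choice.unpickle int n) => [x|]; last exact: negligible_set0.
apply/negligibleP; first by apply: measurable_preX; exact: measurableC.
have mE := measurable_preX omega x measurable_elliptic.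
have e1 : P (omega x @^-1` elliptic_set) = 1%E.
  by rewrite (omega_iid.2 x 0 _ measurable_elliptic); exact: elliptic.
have := probability_setC P mE; rewrite e1 subee// => <-.
Qed.

Lemma log_ratioE (t : Omega) x : (forall x, eps0 <= omega x t <= 1 - eps0) ->
  log_ratio (omega x t) = xi (omega ^~ t) x.
Proof.
move=> ell; rewrite /log_ratio ell /xi /rho ln_div// posrE.
  by rewrite subr_gt0; case/andP: (omega01 x t).
by case/andP: (omega01 x t).
Qed.

Let bmf_comp (psi : R -> R) x : measurable_fun setT psi ->
  (exists M, forall u, `|psi u| <= M) -> bmf (fun t => psi (omega x t)).
Proof.
move=> mpsi [M hM]; split; first exact: measurableT_comp.
by exists M => t; exact: hM.
Qed.

Lemma Ex_identical (psi : R -> R) x : measurable_fun setT psi ->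
  (exists M, forall u, `|psi u| <= M) ->
  Ex P (fun t => psi (omega x t)) = Ex P (fun t => psi (omega 0 t)).
Proof.
move=> mpsi bpsi; rewrite /Ex /Rintegral; congr fine.
have h y : (\int[P]_t (psi (omega y t))%:E =
            \int[distribution P (omega y)]_u (psi u)%:E)%E.
  rewrite integral_distribution//; first exact/measurable_EFinP.
  exact: bmf_integrable (bmf_comp y mpsi bpsi).
rewrite !h; apply: eq_measure_integral => A mA _.
exact: omega_iid.2.
Qed.

Let ln_rho_ae (f : R -> R) : measurable_fun setT f ->
  (\int[P]_t (f (ln (rho (fun x => omega x t) 0)))%:E =
   \int[P]_t (f (log_ratio (omega 0 t)))%:E)%E.
Proof.
move=> mf; apply: ae_eq_integral => //.
- apply/measurable_EFinP; apply: measurableT_comp => //.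
  rewrite (_ : (fun t => ln _) = fun t => ln (1 - omega 0 t) - ln (omega 0 t)); last first.
    apply/funext => t; rewrite /rho ln_div// posrE; have := omega01 0 t; lra.
  apply: measurable_funB; apply: measurableT_comp => //.
  by apply: measurable_funB => //; exact: measurable_cst.
- apply/measurable_EFinP; apply: measurableT_comp => //.
  by apply: measurableT_comp => //; exact: measurable_log_ratio.
- have [N [mN PN sN]] := elliptic_all; exists N; split => // t /= h; apply: sN => /= ell.
  by apply: h => _; rewrite (log_ratioE 0 ell).
Qed.

Lemma Ex_log_ratio x : Ex P (fun t => log_ratio (omega x t)) = 0.
Proof.
rewrite Ex_identical; [|exact: measurable_log_ratio|]; last first.
  by exists log_bound => u; exact: log_ratio_bound.
have := @ln_rho_ae idfun (@measurable_id _ _ setT).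
by move: mean0; rewrite unlock /= => -> e; rewrite /Ex /Rintegral -e.
Qed.

Definition log_var : R := Ex P (fun t => log_ratio (omega 0 t) ^+ 2).

Lemma log_var_gt0 : 0 < log_var.
Proof.
have := @ln_rho_ae (fun u => u ^+ 2) _.
have m2 : measurable_fun setT (fun u : R => u ^+ 2) by exact: exprn_measurable.
move=> /(_ m2) e; move: var_gt0; rewrite unlock /= e /log_var /Ex /Rintegral => v0.
rewrite -lte_fin fineK//; apply: integrable_fin_num => //.
apply: (@bmf_integrable _ _ _ P (fun t => log_ratio (omega 0 t) ^+ 2)).
apply: (@bmf_comp (fun u => log_ratio u ^+ 2)).
  by apply: measurable_funX; exact: measurable_log_ratio.
exists (log_bound ^+ 2) => u; rewrite normrX; apply: lerXn2r; rewrite ?nnegrE//.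
  exact: log_bound_ge0.
exact: log_ratio_bound.
Qed.

Let expR_ge_quad (u : R) : -1 <= u <= 1 -> 1 + u + u ^+ 2 / 4 <= expR u.
Proof.
move=> u1; have -> : 1 + u + u ^+ 2 / 4 = (1 + u / 2) * (1 + u / 2) by field.
have -> : expR u = expR (u / 2) * expR (u / 2) by rewrite -expRD; congr expR; field.
by apply: ler_pM; rewrite ?expR_ge1Dx//; lra.
Qed.

(** The mean kills the linear term of the exponential, and a quarter of the square remains. The sign
    [s] covers the two sides, whose paths have opposite increments. *)
Lemma log_ratio_drift (lam s : R) x : 0 < lam -> lam * log_bound <= 1 / 2 ->
  s ^+ 2 = 1 ->
  lam ^+ 2 / 4 * log_var <= Ex P (fun t => expR (- lam * (s * log_ratio (omega x t))) - 1).
Proof.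
move=> lam0 lamL s2.
have sn : `|s| = 1.
  by apply/eqP; rewrite -(@eqrXn2 _ 2)// ?normr_ge0// expr1n -normrX s2 normr1.
have mlr := measurable_log_ratio.
have blr y : bmf (fun t => log_ratio (omega y t)).
  by apply: bmf_comp => //; exists log_bound; exact: log_ratio_bound.
have msq : measurable_fun setT (fun u => log_ratio u ^+ 2).
  exact: measurable_funX.
have bsq : exists M, forall u, `|log_ratio u ^+ 2| <= M.
  exists (log_bound ^+ 2) => u; rewrite normrX; apply: lerXn2r; rewrite ?nnegrE//.
    exact: log_bound_ge0.
  exact: log_ratio_bound.
have -> : lam ^+ 2 / 4 * log_var =
    Ex P (fun t => (- lam * s) * log_ratio (omega x t) +
                   (lam ^+ 2 / 4) * log_ratio (omega x t) ^+ 2).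
  rewrite ExD; [|exact: bmfZ|by apply: bmfZ; exact: bmf_comp msq bsq].
  rewrite (ExZ P _ (blr x)) Ex_log_ratio mulr0 add0r.
  rewrite (ExZ P _ (bmf_comp x msq bsq)).
  by rewrite (Ex_identical x msq bsq).
apply: Ex_le.
- by apply: bmfD; apply: bmfZ => //; exact: bmf_comp msq bsq.
- apply: bmfB; last exact: bmf_cst.
  split.
    apply: measurableT_comp => //; apply: measurable_funM; first exact: measurable_cst.
    apply: measurable_funM; first exact: measurable_cst.
    exact: (blr x).1.
  exists (expR (lam * log_bound)) => t; rewrite ger0_norm ?expR_ge0// ler_expR.
  apply: le_trans (ler_norm _) _; rewrite !normrM normrN sn mul1r (gtr0_norm lam0).
  by apply: ler_wpM2l; [exact: ltW|exact: log_ratio_bound].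
- move=> t; set u := log_ratio _.
  have ub : `|- lam * (s * u)| <= 1 / 2.
    rewrite !normrM normrN sn (gtr0_norm lam0) [1 * `|u|]mul1r; apply: (le_trans _ lamL).
    by apply: ler_wpM2l; [exact: ltW|exact: log_ratio_bound].
  have := @expR_ge_quad (- lam * (s * u)) _.
  have -> : -1 <= - lam * (s * u) <= 1.
    by move: ub; rewrite ler_norml; lra.
  move=> /(_ isT).
  have -> : (- lam * (s * u)) ^+ 2 = lam ^+ 2 * s ^+ 2 * u ^+ 2 by ring.
  rewrite s2; lra.
Qed.

End Environment.

(** * Choice of the scales *)

Section Scales.
Variables (R : realType) (g L var H : R).
Hypotheses (g_gt0 : 0 < g) (g_small : g <= 1 / 100) (L_ge0 : 0 <= L) (var_gt0 : 0 < var).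

Definition alpha := g ^+ 3.
(** The width is about [exp (kappa H)], and its square times [exp height1] must stay below
    [exp ((1 - alpha) H)]. [rate] keeps [exp (rate * height2)] below [exp (kappa H / 2)], far less
    than the width, and also [rate * L <= 1 / 2]. *)
Definition kappa := alpha / 8.
Definition rate := kappa / (4 * (1 + L)).
Definition theta := rate ^+ 2 / 4 * var.
(** The quotient makes the bound of [prob_weight] at most [g] without involving [H]; the summand 2
    is used in [width_height]. *)
Definition weight := 2 + (1 + L + 4 * (3 + L) / theta) / g.
Definition height1 := (1 - 2 * alpha) * H.
Definition height2 := (1 + alpha) * H.
Definition low3 := g * H.
Definition margin := g ^+ 2 * H.
Definition slack := alpha * H.
(** [4 * slack] is the length of the widest window: a window that starts below [margin] ends below
    [high2], hence below both maxima. *)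
Definition high2 := margin + 4 * slack.
(** A small power of [N] rather than the diffusive order [H ^+ 2]: a crude tail bound for the time
    of the climb is then enough, at the price of a factor of order [exp (2 kappa H)] in the hitting
    time. *)
Definition horizon := Num.truncn (expR (kappa * H)).
Definition delay :=
  (Num.truncn (8 * (2 * horizon).+1%:R ^+ 2 * expR (height1 + L))).+1.

Lemma alpha_gt0 : 0 < alpha. Proof. exact: exprn_gt0. Qed.

Lemma alpha_lt : alpha <= 1 / 100.
Proof.
rewrite /alpha exprSr; apply: (@le_trans _ _ (1 * (1 / 100))); last by rewrite mul1r.
apply: ler_pM => //; [exact: sqr_ge0|exact: ltW|].
by apply: exprn_ile1; [exact: ltW|move: g_small; lra].
Qed.

Lemma kappa_gt0 : 0 < kappa. Proof. by rewrite divr_gt0 ?alpha_gt0. Qed.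

Lemma rate_gt0 : 0 < rate.
Proof. by rewrite divr_gt0 ?kappa_gt0// mulr_gt0//; move: L_ge0; lra. Qed.

Lemma rate_le : rate <= kappa / 4.
Proof.
have k0 := kappa_gt0.
rewrite /rate ler_pdivrMr; last by rewrite mulr_gt0//; move: L_ge0; lra.
have -> : kappa / 4 * (4 * (1 + L)) = kappa + kappa * L by field.
by rewrite lerDl mulr_ge0// ltW.
Qed.

Lemma rate_half : rate <= 1 / 2.
Proof. by have := rate_le; have := alpha_lt; rewrite /kappa; lra. Qed.

Lemma rateL : rate * L <= 1 / 2.
Proof.
have k0 := kappa_gt0; have a1 := alpha_lt.
have -> : rate * L = kappa / 4 * (L / (1 + L)).
  by rewrite /rate; field; rewrite gt_eqF//; move: L_ge0; lra.
apply: (@le_trans _ _ (kappa / 4 * 1)); last by rewrite /kappa; lra.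
apply: ler_wpM2l; first by rewrite divr_ge0// ltW.
by rewrite ler_pdivrMr; move: L_ge0; lra.
Qed.

Lemma theta_gt0 : 0 < theta.
Proof. by rewrite mulr_gt0// divr_gt0// exprn_gt0// rate_gt0. Qed.

Lemma weight_ge2 : 2 <= weight.
Proof.
have t0 := theta_gt0; rewrite /weight lerDl divr_ge0 ?(ltW g_gt0)//.
apply: addr_ge0; first by move: L_ge0; lra.
by apply: divr_ge0; [move: L_ge0; lra|exact: ltW].
Qed.

Hypotheses (HL : 100 * (1 + L + expR L) <= alpha * H)
  (Htheta : 48 <= theta * g * kappa ^+ 2 * H).

Let aH : 100 + 100 * L + 100 * expR L <= slack.
Proof. by move: HL; rewrite /slack; lra. Qed.

Let eL1 : 1 <= expR L.
Proof. by apply: le_trans (expR_ge1Dx L); move: L_ge0; lra. Qed.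

Let H0 : 0 < H.
Proof.
by rewrite -(pmulr_rgt0 _ alpha_gt0) -/slack; move: aH eL1 L_ge0; lra.
Qed.

Let slackE : slack = g * margin.
Proof. by rewrite /slack /alpha /margin; ring. Qed.

Let marginE : margin = g * low3.
Proof. by rewrite /margin /low3; ring. Qed.

Let low3_le : low3 <= H / 100.
Proof. by rewrite /low3 mulrC; have := ler_wpM2l (ltW H0) g_small; lra. Qed.

Let margin_le : margin <= low3 / 100.
Proof.
have l0 : 0 <= low3 by rewrite /low3 mulr_ge0// ltW.
by rewrite marginE mulrC; have := ler_wpM2l l0 g_small; lra.
Qed.

Let slack_le : slack <= margin / 100.
Proof.
have l0 : 0 <= margin by rewrite /margin mulr_ge0 ?sqr_ge0// ltW.
by rewrite slackE mulrC; have := ler_wpM2l l0 g_small; lra.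
Qed.

Let h1E : height1 = H - 2 * slack.
Proof. by rewrite /height1 /slack; ring. Qed.

Let h2E : height2 = H + slack.
Proof. by rewrite /height2 /slack; ring. Qed.

Lemma height1_gt0 : 0 < height1.
Proof.
by rewrite h1E; move: low3_le margin_le slack_le H0 aH eL1 L_ge0; lra.
Qed.

Lemma height12 : height1 <= height2.
Proof. by rewrite h1E h2E; move: aH eL1 L_ge0; lra. Qed.

Lemma margin_gt0 : 0 < margin.
Proof. by move: slack_le aH eL1 L_ge0; lra. Qed.

Lemma slack_gt0 : 0 < slack.
Proof. by move: slack_le aH eL1 L_ge0; lra. Qed.

Lemma high2_gt0 : 0 < high2.
Proof. by rewrite /high2; move: slack_le aH eL1 L_ge0; lra. Qed.

Lemma low3_gt0 : 0 < low3.
Proof. by rewrite mulr_gt0. Qed.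

Lemma scales_fit : high2 + low3 + L < height1.
Proof.
by rewrite h1E /high2; move: low3_le margin_le slack_le H0 aH eL1 L_ge0; lra.
Qed.

Lemma slack_L : 2 * L <= slack.
Proof. by move: aH eL1 L_ge0; lra. Qed.

Let kH : kappa * H = slack / 8.
Proof. by rewrite /kappa /slack; ring. Qed.

Let ekH : 1 <= expR (kappa * H).
Proof. by apply: le_trans (expR_ge1Dx _); rewrite kH; move: aH eL1 L_ge0; lra. Qed.

Lemma horizon_gt0 : (0 < horizon)%N.
Proof. by rewrite /horizon truncn_ge_nat// expR_ge0. Qed.

Let horizon_le : horizon%:R <= expR (kappa * H).
Proof. by rewrite truncn_le expR_ge0. Qed.

Let horizon_ge : expR (kappa * H) <= 2 * horizon%:R.
Proof.
have := truncnS_gt (expR (kappa * H)); rewrite -/horizon -addn1 natrD.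
have : 1 <= horizon%:R :> R by rewrite (_ : 1 = 1%:R)// ler_nat horizon_gt0.
lra.
Qed.

Let width_le : (2 * horizon).+1%:R <= 3 * expR (kappa * H).
Proof.
by rewrite -addn1 natrD natrM; move: horizon_le ekH; lra.
Qed.

Lemma width_slack : (2 * horizon).+1%:R * expR (- (slack / 2)) <= 1 / 4.
Proof.
apply: (@le_trans _ _ (3 * expR (kappa * H) * expR (- (slack / 2)))).
  by apply: ler_wpM2r => //; exact: expR_ge0.
rewrite -mulrA -expRD kH.
have -> : slack / 8 - slack / 2 = - (3 / 8 * slack) by field.
rewrite expRN ler_pdivrMr ?expR_gt0//.
have := expR_ge1Dx (3 / 8 * slack); move: aH eL1 L_ge0; lra.
Qed.

Lemma width_height : horizon.+1%:R * expR (height1 - height2) <= weight.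
Proof.
apply: le_trans weight_ge2.
have e : height1 - height2 = - (3 * slack) by rewrite h1E h2E; ring.
rewrite e expRN ler_pdivrMr ?expR_gt0//.
apply: (@le_trans _ _ (2 * expR (kappa * H))).
  by rewrite -addn1 natrD; move: horizon_le ekH; lra.
by rewrite ler_pM2l// ler_expR kH; move: aH eL1 L_ge0; lra.
Qed.

Lemma time_height : expR H * expR (L - height2) <= 1 / 2.
Proof.
rewrite -expRD h2E; have -> : H + (L - (H + slack)) = - (slack - L) by ring.
rewrite expRN -[leLHS]mul1r ler_pdivrMr ?expR_gt0//.
have := expR_ge1Dx (slack - L); move: aH eL1 L_ge0; lra.
Qed.

Let base := 8 * (2 * horizon).+1%:R ^+ 2 * expR (height1 + L).

Lemma delay_ge : base <= delay%:R.
Proof. exact: ltW (truncnS_gt _). Qed.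

(** The successor leaves room for the additional step when the bottom is odd. *)
Lemma delay_le : delay.+1%:R <= expR ((1 - alpha) * H).
Proof.
have b0 : 0 <= base by rewrite !mulr_ge0 ?expR_ge0// sqr_ge0.
have d1 : delay.+1%:R <= base + 2.
  by rewrite /delay -addn2 natrD lerD2r; case/andP: (truncn_itv b0).
apply: le_trans d1 _.
have h10 := height1_gt0.
pose z := expR (2 * (kappa * H) + (height1 + L)).
have z1 : 1 <= z.
  apply: le_trans (expR_ge1Dx _); rewrite lerDl kH.
  by move: h10 aH eL1 L_ge0; lra.
have bz : base <= 72 * z.
  rewrite /base /z.
  have -> : 72 * expR (2 * (kappa * H) + (height1 + L)) =
      8 * (3 * expR (kappa * H)) ^+ 2 * expR (height1 + L).
    have -> : 2 * (kappa * H) + (height1 + L) =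
        kappa * H + kappa * H + (height1 + L) by ring.
    by rewrite expRD [expR (_ + kappa * H)]expRD; ring.
  apply: ler_wpM2r; first exact: expR_ge0.
  apply: ler_wpM2l => //.
  by rewrite ler_pXn2r ?nnegrE ?mulr_ge0 ?expR_ge0.
apply: (@le_trans _ _ (74 * z)); first lra.
have -> : (1 - alpha) * H = (2 * (kappa * H) + (height1 + L)) + (3 / 4 * slack - L).
  by rewrite kH h1E /slack; field.
rewrite [leRHS]expRD -/z mulrC; apply: ler_wpM2l; first lra.
rewrite expRD expRN ler_pdivlMr ?expR_gt0//.
by have := expR_ge1Dx (3 / 4 * slack); move: aH eL1 L_ge0; lra.
Qed.

Lemma start_small (m : nat) : m.+1%:R * (4 * (1 + L)) <= slack ->
  m%:R * L <= slack / 2 - L /\ m%:R * L < high2.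
Proof.
move=> ms.
have h : m%:R * L + L <= slack / 4.
  apply: (@le_trans _ _ (m.+1%:R * (1 + L))); last by move: ms; lra.
  rewrite -addn1 natrD mulrDl mul1r mulrDr mulr1.
  by have := ler0n R m; lra.
by rewrite /high2; split; move: h margin_gt0 aH eL1 L_ge0; lra.
Qed.

Lemma prob_side :
  (height2 + L) * expR (rate * height2) / (theta * horizon%:R) +
  ((1 + L + 2 * (3 + L) * ((height2 + L) / theta)) / (weight * height2) +
  ((height2 - height1 + L) / (height2 + L) +
  ((high2 + L) / (high2 + L + low3) + (high2 + low3 + 2 * L) / (height1 + L)))) <= 8 * g.
Proof.
have t0 := theta_gt0; have h10 := height1_gt0; have h12 := height12.
have h20 : 0 < height2 by apply: lt_le_trans h12.
have l30 := low3_gt0; have q20 := high2_gt0.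
have wp : 0 < horizon%:R :> R by rewrite ltr0n horizon_gt0.
have gl : low3 = g * H by [].
have p1 : (height2 + L) * expR (rate * height2) / (theta * horizon%:R) <= g.
  rewrite ler_pdivrMr; last exact: mulr_gt0 t0 wp.
  apply: (@le_trans _ _ (3 * H * expR (kappa * H / 2))).
    apply: ler_pM; rewrite ?expR_ge0//; first by move: L_ge0 h20; lra.
      by rewrite h2E; move: low3_le margin_le slack_le aH eL1 L_ge0; lra.
    rewrite ler_expR; apply: (@le_trans _ _ (kappa / 4 * (2 * H))).
      apply: ler_pM; [exact: ltW rate_gt0|exact: ltW|exact: rate_le|].
      by rewrite h2E; move: low3_le margin_le slack_le H0; lra.
    lra.
  apply: (@le_trans _ _ (g * (theta * (expR (kappa * H) / 2)))); last first.
    apply: ler_wpM2l; first exact: ltW.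
    by apply: ler_wpM2l; [exact: ltW|move: horizon_ge; lra].
  have -> : expR (kappa * H) = expR (kappa * H / 2) * expR (kappa * H / 2).
    by rewrite -expRD; congr expR; field.
  set e := expR (kappa * H / 2).
  have e0 : 0 < e by exact: expR_gt0.
  (* The quadratic term of the exponential beats the factor [3 * H]; this comparison is the origin
     of the constant 48 in [Htheta]. *)
  have e2 : kappa ^+ 2 * H ^+ 2 / 8 <= e.
    have k0 : 0 <= kappa * H / 2 by rewrite divr_ge0// mulr_ge0// ltW// kappa_gt0.
    have := @expR_ge1Dxn R _ 1 k0; rewrite -/e.
    have -> : (kappa * H / 2) ^+ 2 / 2`!%:R = kappa ^+ 2 * H ^+ 2 / 8.
      by rewrite (_ : 2`!%:R = 2)//; field.
    lra.
  have e3 : 48 * H <= theta * g * kappa ^+ 2 * H * H by apply: ler_wpM2r => //; exact: ltW.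
  have -> : g * (theta * (e * e / 2)) = (g * theta / 2 * e) * e by field.
  apply: ler_wpM2r; first exact: ltW.
  apply: (@le_trans _ _ (g * theta / 2 * (kappa ^+ 2 * H ^+ 2 / 8))); last first.
    by apply: ler_wpM2l => //; rewrite divr_ge0// mulr_ge0// ltW.
  have -> : g * theta / 2 * (kappa ^+ 2 * H ^+ 2 / 8) =
      theta * g * kappa ^+ 2 * H * H / 16 by field.
  lra.
have p2 : (1 + L + 2 * (3 + L) * ((height2 + L) / theta)) / (weight * height2) <= g.
  have w0 : 0 < weight by apply: lt_le_trans weight_ge2.
  rewrite ler_pdivrMr; last by rewrite mulr_gt0.
  rewrite [leRHS]mulrA.
  apply: (@le_trans _ _ ((1 + L + 4 * (3 + L) / theta) * height2)).
    have -> : (1 + L + 4 * (3 + L) / theta) * height2 =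
       (1 + L) * height2 + 2 * (3 + L) * (2 * height2 / theta).
      by field; rewrite gt_eqF.
    apply: lerD.
      have h21 : 1 <= height2 by rewrite h2E; move: H0 aH eL1 L_ge0; lra.
      by rewrite -[leLHS]mulr1; apply: ler_wpM2l => //; move: L_ge0; lra.
    apply: ler_wpM2l; first by move: L_ge0; lra.
    apply: ler_wpM2r; first by rewrite invr_ge0 ltW.
    by rewrite h2E; move: H0 aH eL1 L_ge0; lra.
  apply: ler_wpM2r; first exact: ltW.
  rewrite /weight [leRHS]mulrDr; set q := 1 + L + _.
  have -> : g * (q / g) = q by field; rewrite gt_eqF.
  by rewrite lerDr mulr_ge0// ltW.
have p3 : (height2 - height1 + L) / (height2 + L) <= g.
  rewrite ler_pdivrMr; last by move: h20 L_ge0; lra.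
  apply: (@le_trans _ _ (g * H)).
    by rewrite -gl h1E h2E; move: l30 margin_le slack_le aH eL1 L_ge0; lra.
  apply: ler_wpM2l; first exact: ltW.
  by rewrite h2E; move: aH eL1 L_ge0; lra.
have p4 : (high2 + L) / (high2 + L + low3) <= 2 * g.
  rewrite ler_pdivrMr; last by move: l30 q20 L_ge0; lra.
  apply: (@le_trans _ _ (2 * g * low3)).
    by rewrite -mulrA -marginE /high2; move: slack_le margin_gt0 aH eL1 L_ge0; lra.
  apply: ler_wpM2l; first by rewrite mulr_ge0// ltW.
  by move: q20 L_ge0; lra.
have p5 : (high2 + low3 + 2 * L) / (height1 + L) <= 3 * g.
  rewrite ler_pdivrMr; last by move: h10 L_ge0; lra.
  apply: (@le_trans _ _ (3 * g * (H / 2))).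
    have -> : 3 * g * (H / 2) = 3 / 2 * low3 by rewrite gl; field.
    by rewrite /high2; move: margin_le slack_le l30 aH eL1 L_ge0; lra.
  apply: ler_wpM2l; first by rewrite mulr_ge0// ltW.
  by rewrite h1E; move: low3_le margin_le slack_le H0 L_ge0; lra.
have -> : 8 * g = g + (g + (g + (2 * g + 3 * g))) by ring.
by do 4 apply: lerD => //.
Qed.

Lemma prob_window l : 0 <= l -> l <= 4 * slack ->
  (l + L) / (l + L + margin) <= 5 * g.
Proof.
move=> l0 ls; have m0 := margin_gt0.
rewrite ler_pdivrMr; last by move: L_ge0; lra.
apply: (@le_trans _ _ (5 * g * margin)).
  by rewrite -mulrA -slackE; move: ls aH eL1 L_ge0; lra.
by apply: ler_wpM2l; [rewrite mulr_ge0// ltW|move: L_ge0; lra].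
Qed.

End Scales.

(** * The favorable event *)

(** Choosing the first index makes the choice measurable: the sets [G k] are differences of
    measurable sets. The default value 0 is even, as the target has to be. *)
Lemma first_choice (d : measure_display) (T : measurableType d)
    (F : nat -> set T) (e : nat -> int) : (forall k, measurable (F k)) ->
  exists b : T -> int, (forall z, measurable (b @^-1` [set z])) /\
    forall t, if `[< exists k, F k t >] then exists2 k, F k t & b t = e k
              else b t = 0.
Proof.
move=> mF.
pose G k := F k `&` \bigcap_(j in [set j | (j < k)%N]) ~` F j.
have mG k : measurable (G k).
  apply: measurableI => //; apply: bigcap_measurableType => j _.
  exact: measurableC.
have ex t : (exists k, F k t) -> exists k, `[< F k t >].
  by move=> [k Fk]; exists k; apply/asboolP.
pose b t := if pselect (exists k, F k t) is left h then e (ex_minn (ex t h)) else 0.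
exists b; split=> [z|t]; last first.
  rewrite /b; case: pselect => h; case: asboolP => // _.
  by case: ex_minnP => k /asboolP Fk _; exists k.
have -> : b @^-1` [set z] =
    (\bigcup_k (if e k == z then G k else set0)) `|`
    (if z == 0 then ~` \bigcup_k F k else set0).
  apply/seteqP; split=> t /=.
    rewrite /b; case: pselect => [h|h].
      case: ex_minnP => k /asboolP Fk kmin ekz; left; exists k => //.
      rewrite ekz eqxx; split=> // j /= jk Fj.
      by have := kmin j (introT (asboolP (F j t)) Fj); rewrite leqNgt jk.
    by move=> <-; right; rewrite eqxx => -[k _ Fk]; apply: h; exists k.
  move=> [[k _]|]; case: ifP => // /eqP.
    move=> <- [Fk nF]; rewrite /b; case: pselect => [h|[]]; last by exists k.
    case: ex_minnP => j /asboolP Fj jmin; congr e.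
    apply/eqP; rewrite eqn_leq jmin/=; last exact/asboolP.
    by rewrite leqNgt; apply/negP => jk; exact: (nF j).
  move=> -> nF; rewrite /b; case: pselect => // -[k Fk]; exfalso; apply: nF.
  by exists k.
apply: measurableU.
  by apply: bigcupT_measurable => k; case: ifP.
by case: ifP => // _; apply: measurableC; exact: bigcupT_measurable.
Qed.

(** * Measurability of the favorable event *)

Section KernelMeasurable.
Context (R : realType) (d : measure_display) (Omega : measurableType d)
  (P : probability Omega R) (omega : int -> {RV P >-> R}).

Lemma adapted_kern n b y : adapted omega [set: int] (fun t => kern (omega ^~ t) n b y).
Proof.
elim: n y => [|n IH] y; first exact: measurable_cst.
have aX z : adapted omega [set: int] (omega z) by exact: adapted_X.
rewrite /adapted (_ : (fun t => _) = fun t =>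
  omega y t * kern (omega ^~ t) n b (y + 1) + (1 - omega y t) * kern (omega ^~ t) n b (y - 1))//.
apply: measurable_funD; apply: measurable_funM.
- exact: aX.
- exact: IH.
- by apply: measurable_funB; [exact: measurable_cst|exact: aX].
- exact: IH.
Qed.

(** The estimate for all starting points and times at once. The range of [y] widens with [r], which
    will be of order [ln N], so that every fixed [y] is eventually covered. *)
Definition favorable (c lo a r : R) (N : nat) (b : int) (t : Omega) : Prop :=
  forall (y : int) (n : nat), `|y|%N.+1%:R * a <= r -> lo <= n%:R -> (n <= N)%N ->
    (2 %| y - b + n%:Z)%Z -> c <= kern (omega ^~ t) n b y.

Lemma measurable_favorable c lo a r N b :
  <<s gens omega [set: int] >> [set t | favorable c lo a r N b t].
Proof.
pose S (y : int) (n : nat) : set (known omega [set: int]) :=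
  if `[< [/\ `|y|%N.+1%:R * a <= r, lo <= n%:R, (n <= N)%N & (2 %| y - b + n%:Z)%Z] >]
  then [set t | c <= kern (omega ^~ t) n b y] else setT.
have -> : [set t | favorable c lo a r N b t] = \bigcap_m
    (if @choice.unpickle (int * nat)%type m is Some p then S p.1 p.2 else setT).
  apply/seteqP; split=> t /=.
    move=> h m _; case: (@choice.unpickle (int * nat)%type m) => [[y n]|//] /=.
    by rewrite /S; case: asboolP => // -[h1 h2 h3 h4]; exact: h.
  move=> h y n h1 h2 h3 h4; have := h (choice.pickle (y, n)) I.
  by rewrite choice.pickleK /S /=; case: asboolP => // -[].
have mS y n : measurable (S y n).
  rewrite /S; case: asboolP => // _.
  have mb : @measurable_fun _ _ (known omega [set: int]) _ setT
      (fun t => c <= kern (omega ^~ t) n b y).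
    by apply: measurable_fun_ler; [exact: measurable_cst|exact: adapted_kern].
  by have := mb measurableT [set true] I; rewrite setTI.
apply: (@bigcapT_measurable _ (known omega [set: int])) => m.
by case: (@choice.unpickle (int * nat)%type m) => [[y n]|].
Qed.

End KernelMeasurable.

Definition siteR (k : nat) : int := k.+1%:Z.
Definition siteL (k : nat) : int := - k.+1%:Z.

(* [IR k] is the set of the sites that a gambler on the right path may know at
   time [k]; it contains all sites of the left path, which allows her to use
   levels that depend on the left path.  [JR k] is what the right path needs. *)
Definition IR (k : nat) := [set x : int | x <= k%:Z].
Definition IL (k : nat) := [set x : int | - k%:Z <= x].
Definition JR (k : nat) := [set x : int | 0 < x <= k%:Z].
Definition JL (k : nat) := [set x : int | - k%:Z <= x < 0].

Lemma siteRI k : ~ IR k (siteR k). Proof. by rewrite /IR /siteR /=; lia. Qed.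
Lemma siteRS k : IR k.+1 (siteR k). Proof. by rewrite /IR /siteR /=; lia. Qed.
Lemma IRS k : IR k `<=` IR k.+1. Proof. by move=> x; rewrite /IR /=; lia. Qed.
Lemma siteLI k : ~ IL k (siteL k). Proof. by rewrite /IL /siteL /=; lia. Qed.
Lemma siteLS k : IL k.+1 (siteL k). Proof. by rewrite /IL /siteL /=; lia. Qed.
Lemma ILS k : IL k `<=` IL k.+1. Proof. by move=> x; rewrite /IL /=; lia. Qed.
Lemma siteRJ k : JR k.+1 (siteR k). Proof. by rewrite /JR /siteR /=; lia. Qed.
Lemma JRS k : JR k `<=` JR k.+1. Proof. by move=> x; rewrite /JR /=; lia. Qed.
Lemma siteLJ k : JL k.+1 (siteL k). Proof. by rewrite /JL /siteL /=; lia. Qed.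
Lemma JLS k : JL k `<=` JL k.+1. Proof. by move=> x; rewrite /JL /=; lia. Qed.
Lemma JR_IL k : JR k `<=` IL 0. Proof. by move=> x; rewrite /JR /IL /=; lia. Qed.
Lemma JL_IR k : JL k `<=` IR 0. Proof. by move=> x; rewrite /JL /IR /=; lia. Qed.

Lemma dvd2_succ (b : int) : ~~ (2 %| b)%Z -> (2 %| b + 1)%Z.
Proof. lia. Qed.

Lemma dvd2_shift (y b : int) (n : nat) :
  (2 %| y - (b + 1) + n.+1%:Z)%Z -> (2 %| y - b + n%:Z)%Z.
Proof. lia. Qed.

(** * Probability of the favorable event *)

Section Favorable.
Context (R : realType) (d : measure_display) (Omega : measurableType d)
  (P : probability Omega R) (omega : int -> {RV P >-> R}).
Hypotheses (omega01 : forall x t, 0 < omega x t < 1) (omega_iid : iid omega).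
Variable eps0 : R.
Hypotheses (eps0_gt0 : 0 < eps0) (eps0_lt : eps0 < 1 / 2)
  (elliptic : P [set t | eps0 <= omega 0 t <= 1 - eps0] = 1%E)
  (mean0 : ('E_P[fun t => ln (rho (fun x => omega x t) 0)%R] = 0)%E)
  (var_gt0 : (0 < 'E_P[fun t => (ln (rho (fun x => omega x t) 0) ^+ 2)%R])%E).
Variables (g : R) (N : nat).
Hypotheses (g_gt0 : 0 < g) (g_small : g <= 1 / 100) (N_gt0 : (0 < N)%N).

Let L := log_bound eps0.
Let phi := log_ratio eps0.
Let var := log_var omega eps0.
Let H : R := ln N%:R.
Hypotheses (HL : 100 * (1 + L + expR L) <= alpha g * H)
  (Htheta : 48 <= theta g L var * g * kappa g ^+ 2 * H).

Let L_ge0 : 0 <= L. Proof. exact: log_bound_ge0. Qed.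
Let var0 : 0 < var. Proof. exact: log_var_gt0. Qed.
Let h1 := height1 g H.
Let h2 := height2 g H.
Let W := horizon g H.
Let K := weight g L var.
Let q2 := high2 g H.
Let q3 := low3 g H.
Let q := margin g H.
Let eta := slack g H.
Let n0 := delay g L H.

Let h1_gt0 : 0 < h1. Proof. exact: height1_gt0 g_gt0 g_small L_ge0 HL. Qed.
Let h12 : h1 <= h2. Proof. exact: height12 L_ge0 HL. Qed.
Let q2_gt0 : 0 < q2. Proof. exact: high2_gt0 g_gt0 g_small L_ge0 HL. Qed.
Let q3_gt0 : 0 < q3. Proof. exact: low3_gt0 g_gt0 L_ge0 HL. Qed.
Let q_gt0 : 0 < q. Proof. exact: margin_gt0 g_gt0 g_small L_ge0 HL. Qed.
Let eta_gt0 : 0 < eta. Proof. exact: slack_gt0 g_gt0 g_small L_ge0 HL. Qed.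
Let q23 : q2 + q3 + L < h1. Proof. exact: scales_fit g_gt0 g_small L_ge0 HL. Qed.
Let K_gt0 : 0 < K.
Proof. exact: lt_le_trans (weight_ge2 g_gt0 L_ge0 var0). Qed.
Let W_gt0 : (0 < W)%N. Proof. exact: horizon_gt0 L_ge0 HL. Qed.

Let phiN (u : R) := - phi u.

Let mphi : measurable_fun setT phi. Proof. exact: measurable_log_ratio. Qed.
Let mphiN : measurable_fun setT phiN. Proof. exact: measurable_funN mphi. Qed.
Let phiL u : `|phi u| <= L. Proof. exact: log_ratio_bound. Qed.
Let phiNL u : `|phiN u| <= L. Proof. by rewrite normrN. Qed.

Let phi0 x : Ex P (fun t => phi (omega x t)) = 0.
Proof. exact: Ex_log_ratio mean0 x. Qed.

Let phiN0 x : Ex P (fun t => phiN (omega x t)) = 0.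
Proof.
have -> : (fun t => phiN (omega x t)) = (fun t => (-1) * phi (omega x t)).
  by apply/funext => t; rewrite mulN1r.
rewrite ExZ ?phi0 ?mulr0//; split; first exact: measurableT_comp.
by exists L.
Qed.

Let drift x : theta g L var <= Ex P (fun t => expR (- rate g L * phi (omega x t)) - 1).
Proof.
have := @log_ratio_drift _ _ _ P omega omega01 omega_iid eps0 eps0_gt0 eps0_lt elliptic
  mean0 (rate g L) 1 x (rate_gt0 g_gt0 L_ge0) (rateL g_gt0 g_small L_ge0) (expr1n _ 2).
by under eq_fun do rewrite mul1r.
Qed.

Let driftN x : theta g L var <= Ex P (fun t => expR (- rate g L * phiN (omega x t)) - 1).
Proof.
have := @log_ratio_drift _ _ _ P omega omega01 omega_iid eps0 eps0_gt0 eps0_lt elliptic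
  mean0 (rate g L) (-1) x (rate_gt0 g_gt0 L_ge0) (rateL g_gt0 g_small L_ge0) (etrans (sqrrN 1) (expr1n _ 2)).
by under eq_fun do rewrite mulN1r.
Qed.

Let xR := walk omega siteR phi.
Let xL := walk omega siteL phiN.
Let vR t := low (run h1 (xR t) W).
Let vL t := low (run h1 (xL t) W).
Let MR t := pretop (run h1 (xR t) W).
Let ML t := pretop (run h1 (xL t) W).

Let lost (x : nat -> R) (z l : R) : bool :=
  gain x (window_start x z q) (window_stop x z q l) W <= - q.

(** Lower ends of the forbidden windows: around the right maximum for the left one, and from
    [h1 - eta] to [h2] above the bottom of one side for the maximum of the other. Each level is
    computed from the side opposite to the bet. *)
Let zM t := MR t - eta.
Let zR t := vR t + h1 - eta.
Let zL t := vL t + h1 - eta.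

Let azM : adapted omega (IL 0) zM.
Proof.
apply: measurable_funB; last exact: measurable_cst.
exact: (adapted_pretop_run siteRJ JRS mphi h1 (JR_IL (k := W))).
Qed.

Let azR : adapted omega (IL 0) zR.
Proof.
apply: measurable_funB; last exact: measurable_cst.
apply: measurable_funD; last exact: measurable_cst.
exact: (adapted_low_run siteRJ JRS mphi h1 (JR_IL (k := W))).
Qed.

Let azL : adapted omega (IR 0) zL.
Proof.
apply: measurable_funB; last exact: measurable_cst.
apply: measurable_funD; last exact: measurable_cst.
exact: (adapted_low_run siteLJ JLS mphiN h1 (JL_IR (k := W))).
Qed.

Let wide := h2 - h1 + eta.

Let wideE : wide = 4 * eta.
Proof. by rewrite /wide /h1 /h2 /eta /height1 /height2 /slack; ring. Qed.

Let bad t : bool :=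
  [|| bad_side omega siteR phi L W h1 h2 q2 q3 K t,
      bad_side omega siteL phiN L W h1 h2 q2 q3 K t,
      lost (xL t) (zM t) (2 * eta),
      lost (xL t) (zR t) wide |
      lost (xR t) (zL t) wide].

Let unlikely_bad : unlikely P bad (31 * g).
Proof.
have ind := omega_iid.1.
have -> : 31 * g = 8 * g + (8 * g + (5 * g + (5 * g + 5 * g))) by ring.
have rg := rate_gt0 g_gt0 L_ge0; have rL := rateL g_gt0 g_small L_ge0.
have rh := rate_half g_gt0 g_small L_ge0; have tg := theta_gt0 g_gt0 L_ge0 var0.
have ps := prob_side g_gt0 g_small L_ge0 var0 HL Htheta.
have pw l : 0 <= l -> l <= 4 * eta -> (l + L) / (l + L + q) <= 5 * g.
  exact: (prob_window g_gt0 g_small L_ge0 HL).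
have e0 := ltW eta_gt0.
have w0 : 0 <= wide by rewrite wideE mulr_ge0.
apply: unlikely_or.
  apply: unlikely_le ps.
  exact: (unlikely_bad_side ind siteRI siteRS IRS mphi phiL (fun k => phi0 (siteR k))
    h1_gt0 h12 q2_gt0 q3_gt0 q23 rg rL rh tg K_gt0 W_gt0 (fun k => drift (siteR k))).
apply: unlikely_or.
  apply: unlikely_le ps.
  exact: (unlikely_bad_side ind siteLI siteLS ILS mphiN phiNL (fun k => phiN0 (siteL k))
    h1_gt0 h12 q2_gt0 q3_gt0 q23 rg rL rh tg K_gt0 W_gt0 (fun k => driftN (siteL k))).
apply: unlikely_or.
  apply: unlikely_le (pw (2 * eta) _ _); [|by rewrite mulr_ge0|lra].
  apply: (unlikely_window ind siteLI siteLS ILS mphiN phiNL (fun k => phiN0 (siteL k)) W azM q_gt0).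
  by rewrite mulr_ge0.
apply: unlikely_or.
  apply: unlikely_le (pw wide w0 _); last by rewrite wideE.
  exact: (unlikely_window ind siteLI siteLS ILS mphiN phiNL (fun k => phiN0 (siteL k)) W azR q_gt0).
apply: unlikely_le (pw wide w0 _); last by rewrite wideE.
exact: (unlikely_window ind siteRI siteRS IRS mphi phiL (fun k => phi0 (siteR k)) W azL q_gt0).
Qed.

Let c := eps0 * (1 / (16 * K * (expR L + 1))).

Let favorable_at := favorable omega c (expR ((1 - alpha g) * H)) (4 * (1 + L)) eta N.

Let good_favorable t : (forall x, eps0 <= omega x t <= 1 - eps0) -> ~~ bad t ->
  exists2 b, (2 %| b)%Z & favorable_at b t.
Proof.
move=> ell /norP[bR /norP[bL /norP[wM /norP[wR wL]]]].
rewrite /lost -ltNge in wM; rewrite /lost -ltNge in wR; rewrite /lost -ltNge in wL.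
pose w := omega ^~ t.
have w01 x : 0 < w x < 1 by exact: omega01.
have pR : xR t = side_path w.
  by apply/funext => k; apply: eq_bigr => i _; rewrite /step /phi (log_ratioE omega01 _ ell).
have pL : xL t = side_path (reflect_env w).
  apply/funext => k; apply: eq_bigr => i _.
  by rewrite /step /phiN /phi (log_ratioE omega01 _ ell) xi_reflect.
have xiL x : `|xi w x| <= L by rewrite -(log_ratioE omega01 x ell); exact: phiL.
have [t1 [t2 [b sv]]] := good_side phiL h1_gt0 h12 q2_gt0 q23 bR.
have [u1 [u2 [b' sl]]] := good_side phiNL h1_gt0 h12 q2_gt0 q23 bL.
have MR0 : q2 <= MR t := sv_M0 sv.
have ML0 : q2 <= ML t := sv_M0 sl.
have q2E : q2 = q + 4 * eta by [].
have xR0 : xR t 0%N = 0 by exact: walk0.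
have xL0 : xL t 0%N = 0 by exact: walk0.
have alt0 : (MR t + eta <= ML t) || (ML t + eta <= MR t).
  have [zm|zm] := leP (zM t) (ML t); last first.
    by apply/orP; right; move: zm; rewrite /zM; lra.
  have qz : q <= zM t by rewrite /zM; move: eta_gt0; lra.
  have := pretop_window xL0 q_gt0 qz wM zm.
  by rewrite -/(ML t) /zM => h; apply/orP; left; move: eta_gt0; lra.
have alt1 : (ML t <= vR t + h1 - eta) || (vR t + h2 <= ML t).
  have [h|h] := leP (ML t) (vR t + h1 - eta) => //=.
  (* A level below [q] needs no bet: the window then ends below [q + 4 * eta = q2], and no maximum
     is below [q2]. *)
  have [qz|qz] := leP q (zR t); last first.
    by move: qz wideE; rewrite /zR /wide; lra.
  have := pretop_window xL0 q_gt0 qz wR (ltW h).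
  by rewrite -/(ML t) /zR /wide; lra.
have alt2 : (MR t <= vL t + h1 - eta) || (vL t + h2 <= MR t).
  have [h|h] := leP (MR t) (vL t + h1 - eta) => //=.
  have [qz|qz] := leP q (zL t); last first.
    by move: qz wideE; rewrite /zL /wide; lra.
  have := pretop_window xR0 q_gt0 qz wL (ltW h).
  by rewrite -/(MR t) /zL /wide; lra.
have NH : N%:R = expR H :> R by rewrite lnK// posrE ltr0n.
have Nh2 : N%:R * expR (L - h2) <= 1 / 2 by rewrite NH; exact: time_height L_ge0 HL.
have svR : side_valley (side_path w) W h1 h2 q2 K (vR t) (MR t) t1 t2 b.
  by rewrite -pR; exact: sv.
have svL : side_valley (side_path (reflect_env w)) W h1 h2 q2 K (vL t) (ML t) u1 u2 b'.
  by rewrite -pL; exact: sl.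
have [b0 tb] := target_exists h1_gt0 q2_gt0 K_gt0 L_ge0 (slack_L L_ge0 HL) Nh2
  (width_slack L_ge0 HL) (delay_ge g L H) (width_height g_gt0 L_ge0 var0 HL)
  w01 xiL svR svL alt0 alt1 alt2.
pose c1 := 1 / (16 * K * (expR L + 1)).
have c10 : 0 <= c1.
  apply: divr_ge0 => //; apply: mulr_ge0; first by rewrite mulr_ge0// ltW.
  by rewrite addr_ge0// expR_ge0.
have n0_le (n : nat) : expR ((1 - alpha g) * H) <= n%:R -> (n0 < n)%N.
  move=> hn; rewrite -(ltr_nat R); apply: lt_le_trans hn.
  apply: lt_le_trans (delay_le g_gt0 g_small L_ge0 HL).
  by rewrite ltr_nat.
have [be|bo] := boolP (2 %| b0)%Z.
  exists b0 => // y n ys ln nN par; have [y1 y2] := start_small g_gt0 g_small L_ge0 HL ys.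
  have nn := n0_le n ln.
  apply: (@le_trans _ _ c1).
    rewrite -[leRHS]mul1r; apply: ler_wpM2r => //; move: eps0_gt0 eps0_lt; lra.
  apply: tb => //; first exact: leq_ltn_trans nn.
  by rewrite (ltnW nn).
(* The walk is at the odd site [b0] at time [n - 1] and then steps to the right with probability at
   least [eps0]. *)
exists (b0 + 1); first exact: dvd2_succ.
move=> y n ys ln nN par; have [y1 y2] := start_small g_gt0 g_small L_ge0 HL ys.
have := n0_le n ln; case: n ln nN par => // n ln nN par nn.
rewrite kern_forward addrK.
have /andP[w0 w1] := w01 (b0 + 1 + 1).
have k0 := kern_ge0 w01 n (b0 + 1 + 1) y.
apply: (@le_trans _ _ (w b0 * kern w n b0 y)); last first.
  by rewrite lerDl mulr_ge0// subr_ge0 ltW.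
apply: ler_pM => //; first exact: ltW.
  by case/andP: (ell b0).
apply: tb => //.
- by rewrite ltnS in nn; apply: leq_trans nn.
- by rewrite -ltnS nn (ltnW nN).
- exact: dvd2_shift par.
Qed.

Lemma favorable_likely : exists2 bad : Omega -> bool, unlikely P bad (31 * g) &
  forall t, (forall x, eps0 <= omega x t <= 1 - eps0) -> ~~ bad t ->
  exists2 b, (2 %| b)%Z &
    favorable omega (eps0 * (1 / (16 * weight g L var * (expR L + 1))))
      (expR ((1 - alpha g) * H)) (4 * (1 + L)) (slack g H) N b t.
Proof. by exists bad. Qed.

End Favorable.

Lemma limn_einf_ge (R : realType) (u : (\bar R)^nat) (l : \bar R) (N : nat) :
  (forall n, (N <= n)%N -> (l <= u n)%E) -> (l <= limn_einf u)%E.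
Proof.
move=> lu; rewrite limn_einf_lim; apply: lime_ge; first exact: is_cvg_einfs.
exists N => // n /= Nn; apply: le_ereal_inf_tmp => _ [k /= nk <-].
by apply: lu; exact: leq_trans nk.
Qed.

Lemma dvd2_parity (b y : int) (n : nat) (o : bool) : (2 %| b)%Z ->
  (2 %| y)%Z = ~~ o -> odd n = o -> (2 %| y - b + n%:Z)%Z.
Proof. lia. Qed.

Lemma ln_nat_large (R : realType) (h : R) : exists N0, forall N, (N0 <= N)%N ->
  (0 < N)%N /\ h <= ln N%:R.
Proof.
exists (Num.truncn (expR h)).+1 => N hN.
have N0 : (0 < N)%N by exact: leq_ltn_trans hN.
split=> //; rewrite -ler_expR lnK ?posrE ?ltr0n//.
by apply: ltW; apply: lt_le_trans (truncnS_gt _) _; rewrite ler_nat.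
Qed.

Theorem proposition5p1 (R : realType) (d : measure_display)
    (Omega : measurableType d) (P : probability Omega R)
    (omega : int -> {RV P >-> R})
    (omega01 : forall x t, 0 < omega x t < 1)
    (omega_iid : iid omega)
    (eps0 : R) (eps0_gt0 : 0 < eps0) (eps0_lt : eps0 < 1 / 2)
    (elliptic : P [set t | eps0 <= omega 0 t <= 1 - eps0] = 1%E)
    (mean0 : ('E_P[fun t => ln (rho (fun x => omega x t) 0)%R] = 0)%E)
    (var_gt0 : (0 < 'E_P[fun t => (ln (rho (fun x => omega x t) 0) ^+ 2)%R])%E)
    (r : nat) (r_gt1 : (1 < r)%N)
    (delta : R) (delta_gt0 : 0 < delta) (delta_lt1 : delta < 1) :
  exists (Delta : nat -> set Omega) (bhat : nat -> Omega -> int) (c eps : R),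
    let env_sigma := generated_sigma measurable (fun x => omega x : Omega -> R) in
    (forall N, env_sigma (Delta N)) /\
    (forall N z, env_sigma (bhat N @^-1` [set z])) /\
    (forall N t, (2 %| bhat N t)%Z) /\
    0 < c /\ 0 < eps /\ eps < 1 /\
    ((1 - delta)%:E <= limn_einf (fun N => P (Delta N)))%E /\
    (* [odd_case] selects (2Z)^r and 2N, or (2Z+1)^r and 2N+1 *)
    forall (odd_case : bool) (y : 'I_r -> int),
      (forall j, (2 %| y j)%Z = ~~ odd_case) ->
      exists N1 : nat, forall N : nat, (N1 <= N)%N ->
      forall t : Omega, t \in Delta N ->
      forall (d' : measure_display) (T : measurableType d')
        (Q : probability T R) (Z : 'I_r -> nat -> T -> int),
        independent_walks (fun x => omega x t) y Q Z ->
        forall (j : 'I_r) (n : nat),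
          N%:R `^ (1 - eps) <= n%:R -> (n <= N)%N -> odd n = odd_case ->
          (c%:E <= Q [set u | Z j n u = bhat N t])%E.
Proof.
(* The failure probabilities add up to [31 * g], less than [delta]. *)
pose g := delta / 100.
have g0 : 0 < g by rewrite divr_gt0.
have g1 : g <= 1 / 100 by rewrite /g; move: delta_lt1; lra.
pose L := log_bound eps0; pose var := log_var omega eps0.
have L0 : 0 <= L by exact: log_bound_ge0.
have var0 : 0 < var by exact: (log_var_gt0 omega01 omega_iid eps0_gt0 eps0_lt elliptic var_gt0).
have a0 : 0 < alpha g := alpha_gt0 g0.
have a1 : alpha g < 1 by have := alpha_lt g0 g1; lra.
have t0 : 0 < theta g L var := theta_gt0 g0 L0 var0.
have k0 : 0 < kappa g := kappa_gt0 g0.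
pose c := eps0 * (1 / (16 * weight g L var * (expR L + 1))).
have c0 : 0 < c.
  have w2 := weight_ge2 g0 L0 var0; have e0 := expR_gt0 L.
  apply: mulr_gt0 => //; apply: divr_gt0 => //; apply: mulr_gt0; last lra.
  by apply: mulr_gt0 => //; move: w2; lra.
(* An enumeration of the even integers, with value 0 at the numbers that encode no integer. *)
pose e (k : nat) : int := if @choice.unpickle int k is Some z then z * 2 else 0.
have e2 k : (2 %| e k)%Z.
  rewrite /e; case: choice.unpickle => [z|]; last exact: dvdz0.
  exact: dvdz_mull (dvdzz 2).
pose fav (N : nat) (b : int) : set (known omega [set: int]) :=
  [set t | favorable omega c (expR ((1 - alpha g) * ln N%:R)) (4 * (1 + L))
    (slack g (ln N%:R)) N b t].
have mfav N b : measurable (fav N b) by exact: measurable_favorable.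
pose Delta N : set (known omega [set: int]) := \bigcup_k fav N (e k).
have /choice[bhat hb] : forall N, exists b : known omega [set: int] -> int,
    (forall z, measurable (b @^-1` [set z])) /\
    forall t, if `[< exists k, fav N (e k) t >]
              then exists2 k, fav N (e k) t & b t = e k else b t = 0.
  by move=> N; apply: (@first_choice _ _ (fun k => fav N (e k)) e) => k; exact: mfav.
exists Delta, bhat, c, (alpha g) => env_sigma.
have mDelta N : env_sigma (Delta N).
  by apply: (@bigcupT_measurable _ (known omega [set: int])) => k; exact: mfav.
split=> //; split; first by move=> N z; exact: (hb N).1.
split.
  move=> N t; have := (hb N).2 t; case: asboolP => _; last by move=> ->; rewrite dvdz0.
  by move=> [k _ ->].
split=> //; split=> //; split=> //; split.
  (* Both conditions on the scales are lower bounds on [ln N]; the sum of the two thresholds meets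
     them together. *)
  pose h := 100 * (1 + L + expR L) / alpha g + 48 / (theta g L var * g * kappa g ^+ 2).
  have [N0 hN0] := ln_nat_large h.
  apply: (@limn_einf_ge _ _ _ N0) => N /hN0[Np hN].
  have z0 : 0 < theta g L var * g * kappa g ^+ 2 by exact: mulr_gt0 (mulr_gt0 t0 g0) (exprn_gt0 2 k0).
  have x0 : 0 <= 100 * (1 + L + expR L) / alpha g.
    by apply: divr_ge0; [have := expR_ge0 L; lra|exact: ltW].
  have y0 : 0 <= 48 / (theta g L var * g * kappa g ^+ 2) by rewrite divr_ge0// ltW.
  have HL : 100 * (1 + L + expR L) <= alpha g * ln N%:R.
    by rewrite [leRHS]mulrC -ler_pdivrMr//; move: hN; rewrite /h; lra.
  have Ht : 48 <= theta g L var * g * kappa g ^+ 2 * ln N%:R.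
    by rewrite [leRHS]mulrC -ler_pdivrMr//; move: hN; rewrite /h; lra.
  have [bad [mbad Pbad] good] := favorable_likely omega01 omega_iid eps0_gt0 eps0_lt
    elliptic mean0 var_gt0 g0 g1 Np HL Ht.
  have [S [mS PS nS]] := elliptic_all omega_iid elliptic.
  have mB : measurable [set t | bad t].
    by have := mbad measurableT [set true] I; rewrite setTI.
  have mD : measurable (Delta N : set Omega) := known_measurable (mDelta N).
  (* The construction of a favorable site works in elliptic environments only; the others lie in the
     null set [S]. *)
  have sub : ~` [set t | bad t] `<=` (Delta N : set Omega) `|` S.
    move=> t /= /negP nb.
    have [ell|nell] := pselect (forall x, eps0 <= omega x t <= 1 - eps0); last first.
      by right; exact: nS.
    left; have [b b2 fb] := good t ell nb.
    exists (choice.pickle (b %/ 2)%Z) => //.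
    by rewrite /e choice.pickleK divzK.
  apply: (@le_trans _ _ (P (~` [set t | bad t]))).
    have -> : P (~` [set t | bad t]) = (1 - P [set t | bad t])%E := probability_setC P mB.
    rewrite EFinB; apply: leeB => //; apply: le_trans Pbad _.
    by rewrite lee_fin /g; move: delta_gt0; lra.
  apply: (@le_trans _ _ (P ((Delta N : set Omega) `|` S))).
    by apply: le_measure => //; rewrite inE; [exact: measurableC|exact: measurableU].
  apply: (@le_trans _ _ (P (Delta N : set Omega) + P S)%E).
    exact: measureU2.
  by rewrite PS adde0.
move=> o y yo.
(* The sum dominates every [|y j| + 1], so one [N1] serves all walks. *)
pose m := (\sum_j `|y j|%N.+1)%N.
have [N1 hN1] := ln_nat_large (m%:R * (4 * (1 + L)) / alpha g).
exists N1 => N /hN1[Np hN] t; rewrite inE => tD d' T Q Z [walks _] j n ln nN par.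
have := (hb N).2 t; case: asboolP => [_ [k fk ->]|[]]; last first.
  by move: tD => [k _ fk]; exists k.
apply: (@le_trans _ _ (kern (fun x => omega x t) n (e k) (y j))%:E); last first.
  exact: walk_law_ge (walks j) n (e k).
rewrite lee_fin; apply: fk => //.
- apply: (@le_trans _ _ (m%:R * (4 * (1 + L)))).
    apply: ler_wpM2r; first by move: L0; lra.
    by rewrite ler_nat /m (bigD1 j)//= leq_addr.
  by rewrite /slack [leRHS]mulrC -ler_pdivrMr.
- by move: ln; rewrite /powR pnatr_eq0 (gtn_eqF Np).
- exact: dvd2_parity par.
Qed.
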